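(* Let $L/K$ be a finitely $\sigma$-generated Galois extension of $\sigma$-fields. Then there exists a chain $$K\subseteq L_1\subseteq L_2\subseteq\ldots\subseteq L_n\subseteq L$$ of intermediate $\sigma$-fields such that $L_1=\pi_0^\sigma(L/K)$, $L_{i+1}/L_i$ is benign with Galois group isomorphic to a full one-sided group shift on a finite simple group $\mathcal{G}_i$ for $i=1,\ldots,n-1$, and $L/L_n$ is $\sigma$-radicial. Moreover, the length $n$ of such a chain and the isomorphism classes of the finite simple groups $\mathcal{G}_i$ (up to a permutation of the indices) are uniquely determined by $L/K$.
   Context: $\mathbb{N}$ contains $0$. A $\sigma$-field (difference field) is a field $K$ with an endomorphism $\sigma\colon K\to K$. An extension $L/K$ of $\sigma$-fields is a field extension such that $\sigma\colon L\to L$ extends $\sigma\colon K\to K$. An intermediate $\sigma$-field is an intermediate field $M$ with $\sigma(M)\subseteq M$. For $A\subseteq L$, $K\langle A\rangle=K(A,\sigma(A),\sigma^2(A),\ldots)$; $L/K$ is finitely $\sigma$-generated if $L=K\langle A\rangle$ for a finite set $A$. $L/K$ is Galois if the underlying field extension is Galois, i.e. normal and separable (algebraic, not necessarily finite). $L/K$ is $\sigma$-separable if for every $\sigma$-field extension $K'/K$ the map $L\otimes_K K'\to L\otimes_K K'$, $a\otimes b\mapsto\sigma(a)\otimes\sigma(b)$ is injective. For $L/K$ finitely $\sigma$-generated Galois, $\pi_0^\sigma(L/K)$ is the union of all intermediate $\sigma$-fields $M$ of $L/K$ such that $M/K$ is a finite field extension and $\sigma$-separable (it is known that $\pi_0^\sigma(L/K)$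 is itself the largest intermediate $\sigma$-field that is finite Galois and $\sigma$-separable over $K$). A Galois extension $L/K$ of $\sigma$-fields is benign if there is an intermediate field $K\subseteq M\subseteq L$ such that $M/K$ is finite Galois with $L=K\langle M\rangle$, $[K(\sigma^n(M)):K]=[M:K]$ for all $n\in\mathbb{N}$, and the fields $(K(\sigma^n(M)))_{n\in\mathbb{N}}$ are linearly disjoint over $K$. An extension $L/K$ of $\sigma$-fields is $\sigma$-radicial if for every $a\in L$ there is $n\in\mathbb{N}$ with $\sigma^n(a)\in K$. The Galois group $G=G(L/K)$ of a Galois extension of $\sigma$-fields is a profinite group equipped with the continuous endomorphism $\sigma\colon G\to G$, $g\mapsto g^\sigma$, where $g^\sigma\in G$ is the unique element with $\sigma\circ g^\sigma=g\circ\sigma$ as maps $L\to L$. The full one-sided group shift on a finite group $\mathcal{G}$ is $\mathcal{G}^{\mathbb{N}}$ with $\sigma(g_0,g_1,\ldots)=(g_1,g_2,\ldots)$; isomorphism means isomorphism of topological groups commuting with $\sigma$. *)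

(* Defs.v *)
From HB Require Import structures.
From mathcomp Require Import all_boot all_order all_algebra all_fingroup.
From mathcomp Require Import all_solvable.
From mathcomp Require Import separable generic_quotient.
From mathcomp Require Import mathcomp_extra boolp classical_sets functions.
From mathcomp Require Import topology.

Set Implicit Arguments.
Unset Strict Implicit.
Unset Printing Implicit Defensive.

Import GRing.Theory.
Local Open Scope classical_set_scope.
Local Open Scope ring_scope.
Local Open Scope quotient_scope.

(* MathComp's [fieldExtType] only covers finite extensions, whereas the
   extensions considered here are typically infinite.  All fields live in an
   ambient field [W]; a subfield of [W] is a predicate of type
   [divringClosed W], an extension E/F is a pair of subfields with
   [{subset F <= E}]. *)

Section Subfield.
Variables (W : fieldType) (M : divringClosed W).

Record subfield : Type :=
  Subfield { subfield_val : W; subfield_valP : subfield_val \in M }.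

HB.instance Definition _ := [isSub for subfield_val].
HB.instance Definition _ := [Choice of subfield by <:].
HB.instance Definition _ := [SubChoice_isSubComUnitRing of subfield by <:].
HB.instance Definition _ :=
  [SubComUnitRing_isSubIntegralDomain of subfield by <:].
HB.instance Definition _ :=
  [SubIntegralDomain_isSubField of subfield by <:].

End Subfield.

Section FieldExtensions.
Variable W : fieldType.
Implicit Types (F E : divringClosed W) (X : {pred W}) (A : set W).

(* The value is meaningful when F is contained in E. *)
Definition incl F E (x : subfield F) : subfield E := insubd 0 (val x).

(* F(A) *)
Definition adjoin F A : {pred W} :=
  [pred x | `[< forall M : divringClosed W,
                  {subset F <= M} -> (forall a, A a -> a \in M) -> x \in M >]].

Definition lin_indep F (I : finType) (b : I -> W) : Prop :=
  forall c : I -> subfield F,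
    \sum_i val (c i) * b i = 0 -> forall i, c i = 0.

Definition is_basis F X (I : finType) (b : I -> W) : Prop :=
  [/\ forall i, b i \in X,
      lin_indep F b &
      forall x, x \in X ->
        exists c : I -> subfield F, x = \sum_i val (c i) * b i].

(* [X : F] = d *)
Definition has_degree F X (d : nat) : Prop :=
  exists b : 'I_d -> W, is_basis F X b.

Definition finite_ext F X : Prop := exists d, has_degree F X d.

Definition algebraic_ext F E : Prop :=
  forall x, x \in E -> algebraicOver (val : subfield F -> W) x.

(* The irreducible polynomials over F with a root in E are, up to scalars,
   the minimal polynomials over F of the elements of E. *)
Definition separable_ext F E : Prop :=
  algebraic_ext F E /\
  forall p : {poly subfield F}, irreducible_poly p ->
    (exists2 x, x \in E & root (map_poly val p) x) -> separable_poly p.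

Definition normal_ext F E : Prop :=
  algebraic_ext F E /\
  forall p : {poly subfield F}, irreducible_poly p ->
    (exists2 x, x \in E & root (map_poly val p) x) ->
    exists2 rs : seq W, {subset rs <= E} &
      map_poly val p %= \prod_(a <- rs) ('X - a%:P).

Definition galois_ext F E : Prop :=
  [/\ {subset F <= E}, normal_ext F E & separable_ext F E].

(* Injectivity of the canonical map from the tensor product over F of any
   finite subfamily to W, spelled out on linearly independent families. *)
Definition lin_disjoint_family F (X : nat -> {pred W}) : Prop :=
  forall (k : nat) (e : 'I_k -> nat), injective e ->
  forall (d : 'I_k -> nat) (b : forall j, 'I_(d j) -> W),
    (forall j i, b j i \in X (e j)) ->
    (forall j, lin_indep F (b j)) ->
    lin_indep F
      (fun f : {dffun forall j : 'I_k, 'I_(d j)} => \prod_j b j (f j)).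

End FieldExtensions.

(* A (x)_R B, for ring morphisms f : R -> A and g : R -> B, is the quotient of
   the formal finite sums of pure tensors [:: (a1, b1); ...; (an, bn)] by the
   congruence generated by the usual relations. *)
Section Tensor.
Variables (R A B : comNzRingType) (f : R -> A) (g : R -> B).

Inductive tensor_cong : seq (A * B) -> seq (A * B) -> Prop :=
| TensorRefl s : tensor_cong s s
| TensorSym s t : tensor_cong s t -> tensor_cong t s
| TensorTrans s t u : tensor_cong s t -> tensor_cong t u -> tensor_cong s u
| TensorCat s s' t t' :
    tensor_cong s s' -> tensor_cong t t' -> tensor_cong (s ++ t) (s' ++ t')
| TensorCatC s t : tensor_cong (s ++ t) (t ++ s)
| TensorZero b : tensor_cong [:: (0, b)] [::]
| TensorAddl a a' b : tensor_cong [:: (a + a', b)] [:: (a, b); (a', b)]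
| TensorAddr a b b' : tensor_cong [:: (a, b + b')] [:: (a, b); (a, b')]
| TensorScale r a b : tensor_cong [:: (f r * a, b)] [:: (a, g r * b)].

Definition tensor_congb : rel (seq (A * B)) :=
  fun s t => `[< tensor_cong s t >].

Fact tensor_congb_equiv : equiv_class_of tensor_congb.
Proof.
split=> [s|s t|t s u].
- by apply/asboolP; apply: TensorRefl.
- by apply/asboolP/asboolP; apply: TensorSym.
- by move=> /asboolP st /asboolP tu; apply/asboolP; apply: TensorTrans st tu.
Qed.

Canonical tensor_equiv := EquivRelPack tensor_congb_equiv.

Definition tensor := {eq_quot tensor_equiv}.

End Tensor.

(* The map a (x) b |-> h a (x) k b on A (x)_R B. *)
Definition tensor_map (R A B : comNzRingType) (f : R -> A) (g : R -> B)
    (h : A -> A) (k : B -> B) (x : tensor f g) : tensor f g :=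
  (\pi_(tensor f g) [seq (h p.1, k p.2) | p <- repr x]).

(* [tensor_map] does not depend on the representative, whenever h and k are
   ring morphisms compatible with an endomorphism l of R. *)
Lemma tensor_mapE (R A B : comNzRingType) (f : R -> A) (g : R -> B)
    (l : R -> R) (h : {rmorphism A -> A}) (k : {rmorphism B -> B}) :
    (forall r, h (f r) = f (l r)) -> (forall r, k (g r) = g (l r)) ->
  forall s : seq (A * B),
    (tensor_map h k (\pi_(tensor f g) s) =
     \pi_(tensor f g) [seq (h p.1, k p.2) | p <- s]).
Proof.
move=> hf kg s; apply/eqmodP/asboolP.
have : \pi_(tensor f g) (repr (\pi_(tensor f g) s)) = \pi_(tensor f g) s.
  by rewrite reprK.
move=> /eqmodP/asboolP; move: s (repr _) => t u; elim=> {t u} /=.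
- by move=> s; apply: TensorRefl.
- by move=> s t _; apply: TensorSym.
- by move=> s t u _ st _; apply: TensorTrans st.
- by move=> s s' t t' _ ss' _ tt'; rewrite !map_cat; apply: TensorCat.
- by move=> s t; rewrite !map_cat; apply: TensorCatC.
- by move=> b; rewrite rmorph0; apply: TensorZero.
- by move=> a a' b; rewrite rmorphD; apply: TensorAddl.
- by move=> a b b'; rewrite rmorphD; apply: TensorAddr.
- by move=> r a b; rewrite !rmorphM hf kg; apply: TensorScale.
Qed.

(* The Galois group G(E/F), as a group under composition, with the Krull
   topology. *)
Section GaloisGroup.
Variables (W : fieldType) (F E : divringClosed W).

Record gal : Type := Gal {
  gal_fun :> subfield E -> subfield E;
  gal_add : {morph gal_fun : x y / x + y};
  gal_mul : {morph gal_fun : x y / x * y};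
  gal_bij : bijective gal_fun;
  gal_fix : forall x, val x \in F -> gal_fun x = x
}.

Lemma gal_eq (g h : gal) : g =1 h -> g = h.
Proof.
case: g h => [g ga gm gb gf] [h ha hm hb hf] /= /funext gh.
by case: h / gh ha hm hb hf => *; congr Gal; apply: Prop_irrelevance.
Qed.

HB.instance Definition _ := gen_eqMixin gal.
HB.instance Definition _ := gen_choiceMixin gal.

Definition gal_id : gal.
Proof. by exists idfun => //; exists idfun. Defined.

Definition gal_comp (g h : gal) : gal.
Proof.
exists (g \o h).
- by move=> x y; rewrite /= !gal_add.
- by move=> x y; rewrite /= !gal_mul.
- exact: bij_comp (gal_bij g) (gal_bij h).
- by move=> x xF; rewrite /= !gal_fix.
Defined.

Definition gal_inv_fun (g : gal) (x : subfield E) : subfield E :=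
  xget x [set y | g y = x].

Lemma gal_inv_funK (g : gal) : cancel (gal_inv_fun g) g.
Proof.
move=> x; rewrite /gal_inv_fun; case: xgetP => // h.
by have [k _ gk] := gal_bij g; have := h (k x); rewrite /= gk.
Qed.

Lemma gal_funK (g : gal) : cancel g (gal_inv_fun g).
Proof. by move=> x; apply: (bij_inj (gal_bij g)); rewrite gal_inv_funK. Qed.

Definition gal_inv (g : gal) : gal.
Proof.
exists (gal_inv_fun g).
- by move=> x y; apply: (bij_inj (gal_bij g)); rewrite gal_add !gal_inv_funK.
- by move=> x y; apply: (bij_inj (gal_bij g)); rewrite gal_mul !gal_inv_funK.
- by exists g; [apply: gal_inv_funK|apply: gal_funK].
- by move=> x xF; apply: (bij_inj (gal_bij g)); rewrite gal_inv_funK gal_fix.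
Defined.

Fact gal_compA : associative gal_comp.
Proof. by move=> g h k; apply: gal_eq. Qed.
Fact gal_comp1g : left_id gal_id gal_comp.
Proof. by move=> g; apply: gal_eq. Qed.
Fact gal_compg1 : right_id gal_id gal_comp.
Proof. by move=> g; apply: gal_eq. Qed.
Fact gal_compVg : left_inverse gal_id gal_inv gal_comp.
Proof. by move=> g; apply: gal_eq => x; apply: gal_funK. Qed.
Fact gal_compgV : right_inverse gal_id gal_inv gal_comp.
Proof. by move=> g; apply: gal_eq => x; apply: gal_inv_funK. Qed.

HB.instance Definition _ :=
  isGroup.Build gal gal_compA gal_comp1g gal_compg1 gal_compVg gal_compgV.

(* The coset g Gal(E/M), for M an intermediate field finite Galois over F. *)
Definition krull_coset (B : set gal) : Prop :=
  exists (g : gal) (M : divringClosed W),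
    [/\ {subset M <= E}, galois_ext F M, finite_ext F M &
        B = [set h : gal | forall x, val x \in M -> h x = g x]].

HB.instance Definition _ :=
  @isSubBaseTopological.Build gal (set gal) krull_coset id.

End GaloisGroup.

(* A sigma-field is a field W with an endomorphism s; below W is an ambient
   sigma-field, and all sigma-fields are sigma-subfields of W, except for the
   base changes K' in the definition of sigma-separability. *)
Record sigmaSubfield (W : fieldType) (s : {rmorphism W -> W}) : Type :=
  SigmaSubfield {
    sfield :> divringClosed W;
    sfieldP : forall x, x \in sfield -> s x \in sfield
  }.

Section SigmaExtensions.
Variables (W : fieldType) (s : {rmorphism W -> W}).
Implicit Types (F E K L : sigmaSubfield s).

(* The endomorphism of E induced by s. *)
Definition sigma_on E (x : subfield E) : subfield E :=
  Subfield (sfieldP (subfield_valP x)).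

(* F<A> *)
Definition sigma_adjoin (F : divringClosed W) (A : set W) : {pred W} :=
  adjoin F (\bigcup_n (iter n s @` A)).

Definition sigma_finitely_generated F E : Prop :=
  exists A : seq W, E =i sigma_adjoin F [set x | x \in A].

Definition sigma_separable F E : Prop :=
  forall (K' : fieldType) (s' : {rmorphism K' -> K'})
         (i : {rmorphism subfield F -> K'}),
    (forall x, i (sigma_on x) = s' (i x)) ->
    injective (@tensor_map _ _ _ (@incl W F E) i (@sigma_on E) s').

Definition pi0_sigma F E : set W :=
  [set x | exists M : sigmaSubfield s,
     [/\ {subset F <= M}, {subset M <= E}, finite_ext F M,
         sigma_separable F M & x \in M]].

(* F(s^n(M)) *)
Definition adjoin_iter (F M : divringClosed W) (n : nat) : {pred W} :=
  adjoin F (iter n s @` [set x | x \in M]).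

Definition benign F E : Prop :=
  galois_ext F E /\
  exists M : divringClosed W,
    [/\ {subset F <= M} /\ {subset M <= E},
        galois_ext F M /\ finite_ext F M,
        E =i sigma_adjoin F [set x | x \in M],
        forall n d, has_degree F (adjoin_iter F M n) d <-> has_degree F M d &
        lin_disjoint_family F (adjoin_iter F M)].

Definition sigma_radicial F E : Prop :=
  forall a, a \in E -> exists n, iter n s a \in F.

(* g |-> g^s, where g^s is the unique element with s \o g^s = g \o s; it
   exists when E/F is Galois. *)
Definition gal_sigma F E (g : gal F E) : gal F E :=
  xget 1%g [set h : gal F E | forall x, sigma_on (h x) = g (sigma_on x)].

Definition full_shift (G : finGroupType) : topologicalType :=
  {ptws nat -> discrete_topology G}.

(* G(E/F), with its topology and endomorphism, is isomorphic to the full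
   one-sided shift on G. *)
Definition gal_isog_full_shift F E (G : finGroupType) : Prop :=
  exists (phi : gal F E -> full_shift G) (psi : full_shift G -> gal F E),
    [/\ cancel phi psi /\ cancel psi phi,
        continuous phi /\ continuous psi,
        forall (g h : gal F E) n, phi (g * h)%g n = (phi g n * phi h n :> G)%g &
        forall (g : gal F E) n, phi (gal_sigma g) n = phi g n.+1].

(* The chain L_1, ..., L_n is C 0, ..., C m with n = m + 1,
   and the groups are indexed by 'I_m. *)
Definition benign_chain K L (m : nat) (C : 'I_m.+1 -> sigmaSubfield s)
    (G : 'I_m -> finGroupType) : Prop :=
  [/\ forall i, {subset K <= C i} /\ {subset C i <= L},
      [set x | x \in C ord0] = pi0_sigma K L,
      forall i : 'I_m,
        let Li := C (widen_ord (leqnSn m) i) in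
        let Li1 := C (lift ord0 i) in
        [/\ {subset Li <= Li1}, benign Li Li1,
            simple [set: G i]%G & gal_isog_full_shift Li Li1 (G i)] &
      sigma_radicial (C ord_max) L].

End SigmaExtensions.

(* Main.v *)
(** The Galois group G of L/K, with its endomorphism s : g |-> g^s, is profinite,
    and finite sigma-generation provides an open normal subgroup U containing no
    s-stable subgroup other than 1; the argument takes place in such a pair (G, s).

    Existence.  The intersection G0 of all open subgroups H with s^-1 H = H is
    open, and its fixed field is pi_0.  Over pi_0 one has s^j G = s^(j+1) G for
    some j; replacing L by the fixed field of ker s^j, over which L is
    sigma-radicial, makes s surjective.  Take m minimal such that ker s^m contains
    nontrivial elements close to 1, and a minimal normal subgroup E of G consisting
    of such elements.  The lifts of E along the powers of s commute with each other,
    and their infinite products define an equivariant map E^N -> G; its image N is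
    normal and is a full shift, even when the map is not injective (E is then central
    of prime order and one changes coordinates).  The fixed field of N has a smaller
    ker s, so induction applies; a full shift on a group T is refined along a maximal
    normal subgroup of T.

    Uniqueness.  A chain corresponds to a series H_0 >= H_1 >= ... of s-stable
    subgroups whose quotients are full shifts on the simple groups T_i.  For large r
    the finite groups s^r (H_i :&: ker s^(r+1)) have the T_i as successive quotients,
    and the Jordan-Hoelder theorem applies to the first of them. *)

Require Import Defs.
From HB Require Import structures.
From mathcomp Require Import all_boot all_order all_algebra all_fingroup.
From mathcomp Require Import all_solvable separable generic_quotient.
From mathcomp Require Import mathcomp_extra boolp classical_sets.
From mathcomp Require Import topology.
From mathcomp Require finmap.

Set Implicit Arguments.
Unset Strict Implicit.
Unset Printing Implicit Defensive.

Local Open Scope group_scope.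

(** * Expansive endomorphisms of profinite groups *)

(** Finite index is encoded by a code into a finite type, so that monotone families of cosets
    stabilize; limits come from the completeness clause of [expansive]. The recurring consequence:
    near 1, every x in a closed s-stable subgroup is s y with y in it and one level closer to 1. The
    infinite product Psi0 of the lifts is injective but not equivariant, since shifting leaves an
    extra factor s (f (e 0)). Composing with s^p, where m = p + 1, removes this factor and may
    create a kernel. The kernel is finite, and the g that fix its entries suitably form an open
    invariant subgroup; connectedness makes these entries central and minimality of E then leaves
    only prime order. There the kernel is given by a recurrence, whose defect serves as the new
    coordinate. The induction runs on the finite group ker s: it meets N nontrivially, and s N = N
    lets the kernel of s on G / N be lifted to ker s. In a full shift on T the group s^r (ker
    s^(r+1)) is T for every r; a large r is chosen to annihilate the last group of the series, on
    which s is nilpotent. *)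

Lemma dependent_choice (A : Type) (P : nat -> A -> Prop)
    (R : nat -> A -> A -> Prop) :
  (exists a, P 0 a) ->
  (forall n a, P n a -> exists2 b, P n.+1 b & R n a b) ->
  exists2 f : nat -> A, forall n, P n (f n) & forall n, R n (f n) (f n.+1).
Proof.
move=> [a0 Pa0] step.
pose nxt n (x : {a | P n a}) : {b | P n.+1 b /\ R n (sval x) b} :=
  let: exist2 b Pb Rb := cid2 (step n (sval x) (svalP x)) in exist _ b (conj Pb Rb).
pose f := fix f n : {a | P n a} := match n with
  | 0 => exist _ a0 Pa0
  | n.+1 => exist _ (sval (nxt n (f n))) (proj1 (svalP (nxt n (f n)))) end.
exists (fun n => sval (f n)) => n; first exact: svalP.
exact: (proj2 (svalP (nxt n (f n)))).
Qed.

(** Finite index is exploited through this lemma and its dual: with a code that separates the cosets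
    of an open subgroup, a monotone sequence of sets of cosets becomes a monotone sequence of
    predicates on a finite type. *)
Lemma increasing_stabilizes (Q : finType) (S : nat -> Q -> Prop) :
  (forall n c, S n c -> S n.+1 c) ->
  exists n, forall m c, S m c -> S n c.
Proof.
move=> S_incr.
have S_le n m c : n <= m -> S n c -> S m c.
  by move=> /subnKC <-; elim: (m - n) => [|k IH]; rewrite ?addn0 ?addnS // => /IH; apply: S_incr.
have /choice[f fP] : forall c, exists n, forall m, S m c -> S n c.
  move=> c; have [[n Sn]|nS] := pselect (exists n, S n c); first by exists n.
  by exists 0 => m Sm; case: nS; exists m.
exists (\max_c f c) => m c /fP; apply: S_le.
by apply: leq_bigmax.
Qed.

Lemma decreasing_stabilizes (Q : finType) (S : nat -> Q -> Prop) :
  (forall n c, S n.+1 c -> S n c) ->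
  exists n, forall m c, S n c -> S m c.
Proof.
move=> S_decr.
have [|n nP] := @increasing_stabilizes Q (fun n c => ~ S n c).
  by move=> n c nS /S_decr.
by exists n => m c Sn; apply: contrapT => /nP.
Qed.

Record is_subgroup (G : groupType) (H : set G) : Prop := IsSubgroup {
  sub1 : H 1;
  subM : forall x y, H x -> H y -> H (x * y);
  subV : forall x, H x -> H x^-1
}.

Ltac gsimp := rewrite ?(invgM, invgK, invg1, =^~ mulgA, mulKg, mulVKg, mulgV, mulVg, mulg1, mul1g).

Lemma mulVg_eq1 (G : groupType) (x y : G) : x^-1 * y = 1 -> x = y.
Proof. by move/mulg1_eq; rewrite invgK. Qed.

Section Endo.
Variables (G : groupType) (s : G -> G).
Hypothesis sM : {morph s : x y / x * y}.

Lemma endo1 : s 1 = 1.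
Proof. by apply: (mulgI (s 1)); rewrite -sM !mulg1. Qed.

Lemma endoV : {morph s : x / x^-1}.
Proof. by move=> x; apply: (mulgI (s x)); rewrite -sM !mulgV endo1. Qed.

Lemma iter_endoM n : {morph iter n s : x y / x * y}.
Proof. by elim: n => [|n IH] x y //; rewrite !iterS IH sM. Qed.

End Endo.

Lemma iter_endo1 (G : groupType) (s : G -> G) (sM : {morph s : x y / x * y}) n :
  iter n s 1 = 1.
Proof. exact: endo1 (iter_endoM sM n). Qed.

Lemma iter_endoV (G : groupType) (s : G -> G) (sM : {morph s : x y / x * y}) n :
  {morph iter n s : x / x^-1}.
Proof. exact: endoV (iter_endoM sM n). Qed.

(** Written U_n below. In the Galois group of L over K, with U the stabilizer of a finite set B, it
    is the stabilizer of B, s B, ..., s^(n-1) B, by [stab_sigma]. *)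
Definition level (G : groupType) (s : G -> G) (U : set G) (n : nat) : set G :=
  fun x => forall i, i < n -> U (iter i s x).

(* The topology of G is given by the sets [level s U n], a base of neighbourhoods
   of 1: [exp_fin] and [exp_complete] make it compact. *)
Record expansive (G : groupType) (s : G -> G) (U : set G) : Prop := Expansive {
  expM : {morph s : x y / x * y};
  exp_sub : is_subgroup U;
  exp_norm : forall x g, U x -> U (x ^ g);
  exp_fin : exists (Q : finType) (q : G -> Q), forall x y, q x = q y -> U (x^-1 * y);
  exp_sep : forall x, (forall n, level s U n x) -> x = 1;
  exp_complete : forall x : nat -> G,
    (forall n, level s U n ((x n)^-1 * x n.+1)) ->
    exists y, forall n, level s U n ((x n)^-1 * y)
}.

Section Expansive.
Variables (G : groupType) (s : G -> G) (U : set G).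
Hypothesis GU : expansive s U.

Let sM : {morph s : x y / x * y} := expM GU.
Let sV : {morph s : x / x^-1} := endoV sM.
Local Notation Un := (level s U).

Lemma levelS n x : Un n.+1 x <-> U x /\ Un n (s x).
Proof.
split=> [Ux|[Ux Usx] [|i]] //.
  by split=> [|i ltin]; [exact: (Ux 0) | rewrite -iterSr; apply: Ux].
by rewrite ltnS iterSr => /Usx.
Qed.

Lemma levelSr n x : Un n.+1 x <-> Un n x /\ U (iter n s x).
Proof.
split=> [Ux|[Unx Ux] i].
  by split=> [i ltin|]; apply: Ux => //; apply: ltnW.
by rewrite ltnS leq_eqVlt => /predU1P[->|/Unx].
Qed.

Lemma level_le m n x : m <= n -> Un n x -> Un m x.
Proof. by move=> lemn Ux i ltim; apply: Ux; apply: leq_trans lemn. Qed.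

Lemma level_sub n : is_subgroup (Un n).
Proof.
split=> [i _|x y Ux Uy i lti|x Ux i lti].
- by rewrite (iter_endo1 sM); apply: sub1 (exp_sub GU).
- by rewrite (iter_endoM sM); apply: (subM (exp_sub GU)); auto.
- by rewrite (iter_endoV sM); apply: (subV (exp_sub GU)); auto.
Qed.

Lemma iter_endoJ n x g : iter n s (x ^ g) = iter n s x ^ iter n s g.
Proof. by rewrite /conjg !(iter_endoM sM) (iter_endoV sM). Qed.

Lemma level_norm n x g : Un n x -> Un n (x ^ g).
Proof. by move=> Ux i lti; rewrite iter_endoJ; apply: (exp_norm GU); auto. Qed.

Lemma level_fin n : exists (Q : finType) (q : G -> Q),
  forall x y, q x = q y -> Un n (x^-1 * y).
Proof.
have [Q [q qP]] := exp_fin GU.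
exists {ffun 'I_n -> Q}, (fun x => [ffun i : 'I_n => q (iter i s x)]) => x y.
move=> /ffunP qxy i lti; have := qxy (Ordinal lti); rewrite !ffunE => /qP.
by rewrite -(iter_endoV sM) -(iter_endoM sM).
Qed.

Lemma level_iter k n x : Un (k + n) x -> Un n (iter k s x).
Proof. by move=> Ux i lti; rewrite -iterD; apply: Ux; rewrite addnC ltn_add2l. Qed.

Lemma level_add k n x : Un k x -> Un n (iter k s x) -> Un (k + n) x.
Proof.
move=> Ux Usx i lti; case: (ltnP i k) => [/Ux//|leki].
by rewrite -(subnK leki) iterD; apply: Usx; rewrite ltn_subLR.
Qed.

Definition closed_set (N : set G) : Prop :=
  forall x, (forall n, exists2 h, N h & Un n (h^-1 * x)) -> N x.

Definition open_set (N : set G) : Prop := exists n, forall x, Un n x -> N x.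

(** The cosets modulo U of s^n x, for x in N of level n, decrease with n and are constant from n0
    on. So beyond n0 each x is approximated by some s y, with y in N one level deeper and an error
    of level n + 1. Correcting the error repeatedly gives an infinite product; it converges by
    [exp_complete], and its limit is in N because N is closed. *)
Lemma lift_closed (N : set G) : is_subgroup N -> closed_set N ->
  (forall x, N x -> N (s x)) ->
  exists n0, forall n, n0 <= n -> forall x, N x -> Un n x ->
    exists y, [/\ N y, Un n.+1 y & s y = x].
Proof.
move=> Nsub Ncl Ns; have [Q [q qP]] := exp_fin GU.
have [|n0 n0P] := @decreasing_stabilizes Q
    (fun n c => exists x, [/\ N x, Un n x & q (iter n s x) = c]).
  move=> n c [x [Nx Ux <-]]; exists (s x); split; rewrite -?iterSr //; first exact: Ns.
  by have [_] := (levelS n x).1 Ux.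
have approx n x : n0 <= n -> N x -> Un n x ->
    exists y, [/\ N y, Un n.+1 y & Un n.+1 ((s y)^-1 * x)].
  move=> len Nx Ux.
  have [y [Ny Uy /qP]] : exists y, [/\ N y, Un n.+1 y & q (iter n.+1 s y) = q (iter n s x)].
    apply: n0P; exists (iter (n - n0) s x); split.
    - by elim: (n - n0) => //= k; apply: Ns.
    - by apply: level_iter; rewrite subnK.
    - by rewrite -iterD subnKC.
  exists y; split=> //; apply/levelSr; split.
    apply: (subM (level_sub _)) => //; apply: (subV (level_sub _)).
    by have [] := (levelS n y).1 Uy.
  by rewrite (iter_endoM sM) (iter_endoV sM) -iterSr.
exists n0 => n len x Nx Ux.
pose P k y := [/\ N y, Un n.+1 y & Un (n.+1 + k) ((s y)^-1 * x)].
have [||y yP yR] := @dependent_choice G P (fun k y z => Un (n.+1 + k) (y^-1 * z)).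
- have [y [Ny Uy Uyx]] := approx n x len Nx Ux.
  by exists y; split; rewrite ?addn0.
- move=> k y [Ny Uy Uyx]; have [] := approx (n.+1 + k) ((s y)^-1 * x).
  + by rewrite (leq_trans len) // addSnnS leq_addr.
  + by apply: (subM Nsub) => //; apply: (subV Nsub); apply: Ns.
  + by [].
  move=> z [Nz Uz Uzx]; exists (y * z).
    split; first exact: (subM Nsub).
    - by apply: (subM (level_sub _)) => //; apply: level_le Uz; rewrite leqW // leq_addr.
    - by rewrite addnS sM invgM -mulgA.
  by rewrite mulKg; apply: level_le Uz; rewrite leqnSn.
have [z zP] := exp_complete GU (fun k => level_le (leq_addl n.+1 k) (yR k)).
have Nz : N z by apply: Ncl => k; exists (y k) => //; have [] := yP k.
exists z; split=> //.
  rewrite -(mulVKg (y n.+1) z); apply: (subM (level_sub _)) => //.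
  by have [] := yP n.+1.
apply: mulVg_eq1; apply: (exp_sep GU) => k.
have -> : (s z)^-1 * x = (s ((y k.+1)^-1 * z))^-1 * ((s (y k.+1))^-1 * x).
  by rewrite sM sV; gsimp.
apply: (subM (level_sub _)).
  by apply: (subV (level_sub _)); have [] := (levelS k _).1 (zP k.+1).
have [_ _] := yP k.+1; apply: level_le.
by rewrite addnS ltnW // ltnS leq_addl.
Qed.

End Expansive.

Section Expansive2.
Variables (G : groupType) (s : G -> G) (U : set G).
Hypothesis GU : expansive s U.

Let sM : {morph s : x y / x * y} := expM GU.
Let s1 : s 1 = 1 := endo1 sM.
Let sV : {morph s : x / x^-1} := endoV sM.
Local Notation Un := (level s U).

(** The condition G0 = G. For Galois groups it follows from pi_0 being the base field
    ([connected_shift_connected]). *)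
Definition shift_connected : Prop :=
  forall H : set G, is_subgroup H -> open_set s U H ->
  (forall x, H (s x) <-> H x) -> forall x, H x.

Lemma setT_sub : is_subgroup (setT : set G). Proof. by []. Qed.

Lemma lift_iter (N : set G) n0 :
  (forall n, n0 <= n -> forall x, N x -> Un n x ->
    exists y, [/\ N y, Un n.+1 y & s y = x]) ->
  forall k n, n0 <= n -> forall x, N x -> Un n x ->
    exists y, [/\ N y, Un (n + k) y & iter k s y = x].
Proof.
move=> lift; elim=> [|k IH] n len x Nx Ux; first by exists x; rewrite addn0.
have [y [Ny Uy <-]] := lift n len x Nx Ux.
have [z [Nz Uz <-]] := IH n.+1 (leqW len) y Ny Uy.
by exists z; rewrite addnS -addSn.
Qed.

(** An x close to 1 is s^n y with y as deep as desired, hence with y in H, and then x is in H by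
    stability. As n0 does not depend on H, the intersection of all open H with s^-1 H = H is still
    open. *)
Lemma stable_open_bound : exists n0,
  (forall n, n0 <= n -> forall k x, Un n x ->
     exists2 y, Un (n + k) y & iter k s y = x) /\
  forall H : set G, open_set s U H -> (forall x, H x -> H (s x)) ->
    forall x, Un n0 x -> H x.
Proof.
have [n0 lift] := lift_closed GU setT_sub (fun _ _ => I) (fun _ _ => I).
exists n0; split=> [n len k x Ux|H [n nP] Hs x Ux].
  by have [y [_ Uy sy]] := lift_iter lift k len I Ux; exists y.
have [y [_ Uy <-]] := lift_iter lift n (leqnn n0) I Ux.
have /nP Hy : Un n y by apply: level_le Uy; rewrite leq_addl.
by elim: (n) => //= j; apply: Hs.
Qed.

(** The images s^n U_n0 increase and stabilize modulo U_n0, at n = k say; then V = s^k U_n0 is an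
    open s-stable subgroup. The preimages of V under s^n increase and stabilize too, so at some j
    they are invariant in both directions and connectedness makes them G. Thus s^j G lies in V, all
    of whose elements are of the form s^(k+j+1) w. *)
Lemma connected_image_stabilizes : shift_connected ->
  exists j, forall x, exists y, iter j s x = iter j.+1 s y.
Proof.
move=> conn; have [n0 [lift _]] := stable_open_bound.
have [Q [q qP]] := level_fin GU n0.
have Vsub := level_sub GU n0.
have liftV k x : Un n0 x -> exists2 y, Un n0 y & iter k s y = x.
  move=> /(lift n0 (leqnn n0) k)[y Uy <-]; exists y => //.
  by apply: level_le Uy; rewrite leq_addr.
have [|k kP] := @increasing_stabilizes Q
    (fun n c => exists2 x, Un n0 x & q (iter n s x) = c).
  by move=> n c [x /(liftV 1%N)[y Uy <-] <-]; exists y; rewrite // iterSr.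
pose V x := exists2 v, Un n0 v & iter k s v = x.
have Vs x : V x -> V (s x).
  move=> [v Uv <-].
  have [|w Uw qw] := kP k.+1 (q (s (iter k s v))); first by exists v.
  have [z Uz zE] := liftV k _ (qP _ _ qw).
  exists (w * z); first exact: (subM Vsub).
  by rewrite (iter_endoM sM) zE mulVKg.
have subV' : is_subgroup V.
  split=> [|_ _ [v Uv <-] [w Uw <-]|_ [v Uv <-]].
  - by exists 1; [apply: (sub1 Vsub) | apply: (iter_endo1 sM k)].
  - by exists (v * w); [apply: (subM Vsub) | apply: (iter_endoM sM k)].
  - by exists v^-1; [apply: (subV Vsub) | apply: (iter_endoV sM k)].
have openV x : Un n0 x -> V x by move=> /(liftV k).
have iterV j x : V x -> V (iter j s x) by elim: j => //= j IH /IH/Vs.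
have [|j jP] := @increasing_stabilizes Q
    (fun n c => exists2 x, V (iter n s x) & q x = c).
  by move=> n c [x /Vs Vx <-]; exists x.
have Vall : forall x, V (iter j s x).
  apply: (conn (fun x => V (iter j s x))).
  - split=> [|x y Vx Vy|x Vx]; first by rewrite (iter_endo1 sM); apply: (sub1 subV').
      by rewrite (iter_endoM sM); apply: (subM subV').
    by rewrite (iter_endoV sM); apply: (subV subV').
  - by exists n0 => x /openV; apply: iterV.
  - move=> x; rewrite -iterSr; split=> [Vx|/Vs//].
    have [|y Vy /qP/openV/(iterV j)] := jP j.+1 (q x); first by exists x.
    by rewrite (iter_endoM sM) (iter_endoV sM) => /(subM subV' Vy); rewrite mulVKg.
exists j => x; have [v Uv <-] := Vall x.
have [w Uw <-] := liftV j.+1 v Uv.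
by exists (iter k s w); rewrite -!iterD addnC.
Qed.

(** This is expansiveness of G / N: the image of U_n contains no nontrivial s-orbit. Let x = h u and
    s x = k u' with h, k in N and u, u' in U_n. Then (s h)^-1 k lies in N and U_(n-1), so it lifts
    to w in N and U_n by [lift_closed]; now s (w^-1 u) = u', and replacing h by h w puts x in N
    U_(n+1). *)
Lemma closed_quotient_level (N : set G) : is_subgroup N -> closed_set s U N ->
  (forall x, N x -> N (s x)) ->
  exists n, forall x,
    (forall k, exists2 h, N h & Un n (h^-1 * iter k s x)) -> N x.
Proof.
move=> Nsub Ncl Ns; have [n0 lift] := lift_closed GU Nsub Ncl Ns.
exists n0.+1; have step n x : n0 < n ->
    (exists2 h, N h & Un n (h^-1 * x)) ->
    (exists2 h, N h & Un n (h^-1 * s x)) -> exists2 h, N h & Un n.+1 (h^-1 * x).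
  case: n => // n; rewrite ltnS => len [h Nh Uh] [k Nk Uk].
  pose u := h^-1 * x; pose v := s h^-1 * k.
  have Nv : N v by apply: (subM Nsub) => //; apply: Ns; apply: (subV Nsub).
  have Uv : Un n v.
    have -> : v = s u * (k^-1 * s x)^-1 by rewrite /v /u sM; gsimp.
    apply: (subM (level_sub GU _)); first by have [] := (levelS _ _ _ _).1 Uh.
    by apply: (subV (level_sub GU _)); apply: level_le Uk.
  have [w [Nw Uw swv]] := lift n len v Nv Uv.
  exists (h * w); first exact: (subM Nsub).
  have -> : (h * w)^-1 * x = w^-1 * u by rewrite /u; gsimp.
  have Uwu : Un n.+1 (w^-1 * u).
    by apply: (subM (level_sub GU _)) => //; apply: (subV (level_sub GU _)).
  apply/levelS; split; first exact: (Uwu 0).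
  suff -> : s (w^-1 * u) = k^-1 * s x by [].
  by rewrite sM sV swv /v /u !sM sV; gsimp.
move=> x xP.
have all_levels j k : exists2 h, N h & Un (n0.+1 + j) (h^-1 * iter k s x).
  elim: j k => [|j IH] k; rewrite ?addn0 // addnS; apply: step => //.
    by rewrite addSn ltnS leq_addr.
  exact: (IH k.+1).
apply: Ncl => n; have [h Nh Uh] := all_levels n 0.
by exists h => //; apply: level_le Uh; rewrite leq_addl.
Qed.

(** Hence ker s^k has at most one point in each coset of U_k, and is finite. *)
Lemma ker_level k x : Un k x -> iter k s x = 1 -> x = 1.
Proof.
move=> Ux sx; apply: (exp_sep GU) => n; apply: (@level_le _ _ _ _ (k + n)).
  by rewrite leq_addl.
by apply: level_add => //; rewrite sx; apply: (sub1 (level_sub GU n)).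
Qed.

(** If all the ker s^m met U_n0 trivially, their orders would be bounded by the index of U_n0, so
    they would stabilize, and surjectivity of s would make s injective. The increasing union of the
    s^k U_n0 is then open and invariant in both directions, so it is G, and it is reached at a
    finite k. Injectivity gives U_n0 = G, then U = G, and G is trivial. *)
Lemma connected_ker_meets n0 : shift_connected ->
  (forall x, exists y, s y = x) ->
  (forall n, n0 <= n -> forall k x, Un n x ->
     exists2 y, Un (n + k) y & iter k s y = x) ->
  (exists x : G, x <> 1) ->
  exists m x, [/\ x <> 1, Un n0 x & iter m s x = 1].
Proof.
move=> conn surj lift [x0 x0N1]; apply: contrapT => nex.
have ker1 m x : Un n0 x -> iter m s x = 1 -> x = 1.
  by move=> Ux sx; apply: contrapT => xN1; case: nex; exists m, x.
have [Q [q qP]] := level_fin GU n0.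
have Vsub := level_sub GU n0.
have [|m mP] := @increasing_stabilizes Q
    (fun n c => exists2 x, iter n s x = 1 & q x = c).
  by move=> n c [x sx <-]; exists x; rewrite //= sx.
have injs x : s x = 1 -> x = 1.
  have isurj : forall n x, exists y, iter n s y = x.
    elim=> [|n IH] y; first by exists y.
    by have [z <-] := surj y; have [w <-] := IH z; exists w.
  have [y <-] := isurj m x; rewrite -iterS => sy.
  have [|z sz /qP Uzy] := mP m.+1 (q y); first by exists y.
  suff <- : z = y by [].
  apply: mulVg_eq1; apply: (ker1 m.+1) => //.
  by rewrite (iter_endoM sM) (iter_endoV sM) sy /= sz s1 mulg1 invg1.
have sinj : injective s.
  by move=> x y sxy; apply/mulVg_eq1/injs; rewrite sM sV sxy mulVg.
have liftV k x : Un n0 x -> exists2 y, Un n0 y & iter k s y = x.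
  move=> /(lift n0 (leqnn n0) k)[y Uy <-]; exists y => //.
  by apply: level_le Uy; rewrite leq_addr.
pose H x := exists k, exists2 v, Un n0 v & iter k s v = x.
have HP k v : Un n0 v -> H (iter k s v) by move=> Uv; exists k, v.
have Hmax k l v : Un n0 v -> exists2 w, Un n0 w & iter (k + l) s w = iter k s v.
  by move=> /(liftV l)[w Uw <-]; exists w; rewrite // iterD.
have HT : forall x, H x.
  apply: conn.
  - split=> [|_ _ [k [v Uv <-]] [l [w Uw <-]]|_ [k [v Uv <-]]].
    + by exists 0, 1; [apply: (sub1 Vsub) |].
    + have [v' Uv' <-] := Hmax k l v Uv; have [w' Uw' <-] := Hmax l k w Uw.
      rewrite (addnC l) -(iter_endoM sM); apply: HP; exact: (subM Vsub).
    + by rewrite -(iter_endoV sM); apply: HP; apply: (subV Vsub).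
  - by exists n0 => x; apply: (HP 0).
  - move=> x; split=> [[k [v /(liftV 1%N)[w Uw <-]]]|[k [v Uv <-]]]; last exact: (HP k.+1).
    by rewrite -iterD addn1 iterS => /sinj <-; apply: HP.
have [|k kP] := @increasing_stabilizes Q
    (fun n c => exists2 x, Un n0 x & q (iter n s x) = c).
  by move=> n c [x /(liftV 1%N)[y Uy <-] <-]; exists y; rewrite // iterSr.
have iinj n : injective (iter n s).
  by elim: n => [|n IH] x y //= /sinj/IH.
have VT x : Un n0 x.
  have [j [v Uv vE]] := HT (iter k s x).
  have [|w Uw /qP/(liftV k)[z Uz zE]] := kP j (q (iter k s x)); first by exists v; rewrite ?vE.
  suff -> : x = w * z by apply: (subM Vsub).
  by apply: (iinj k); rewrite (iter_endoM sM) zE mulVKg.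
apply: x0N1; apply: (exp_sep GU) => n i _.
(* One more lift is taken because for n0 = 0 the equality U_n0 = G says nothing about U. *)
have [y Uy /sinj <-] := lift n0 (leqnn _) 1%N _ (VT (s (iter i s x0))).
by apply: (Uy 0); rewrite addn1.
Qed.

End Expansive2.

Lemma minimal_coded (A : Type) (Q : finType) (q : A -> Q) (E : set A)
    (P : set A -> Prop) :
  (forall x y, E x -> E y -> q x = q y -> x = y) -> P E ->
  exists F : set A, [/\ P F, (forall x, F x -> E x) &
    forall F', P F' -> (forall x, F' x -> F x) -> forall x, F x -> F' x].
Proof.
move=> qE PE; pose code (F : set A) := [set c : Q | `[< exists2 x, F x & q x = c >]]%SET.
have [n] := ubnP #|code E|; elim: n => // n IH in E PE qE *; rewrite ltnS => leE.
have [min|nmin] := pselect (forall F', P F' -> (forall x, F' x -> E x) -> forall x, E x -> F' x).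
  by exists E.
have [F' [PF' [F'E [x [Ex F'x]]]]] : exists F',
    P F' /\ (forall x, F' x -> E x) /\ exists x, E x /\ ~ F' x.
  apply: contrapT => nex; apply: nmin => F' PF' F'E x Ex.
  by apply: contrapT => nF'x; apply: nex; exists F'; split=> //; split=> //; exists x.
have [||F [PF FF' Fmin]] := IH F' PF'; last by exists F; split=> // y /FF'/F'E.
  by move=> y z /F'E Ey /F'E Ez; apply: qE.
apply: leq_trans leE; apply: proper_card; apply/properP; split.
  by apply/fintype.subsetP => c; rewrite !inE => -[y /F'E Ey <-]; exists y.
exists (q x); first by rewrite inE; apply/asboolP; exists x.
rewrite inE. apply/asboolP => -[y F'y /qE]; have Ey := F'E _ F'y.
by move=> /(_ Ey Ex) yx; apply: F'x; rewrite -yx.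
Qed.

(** * Normal subgroups that are full shifts *)

Section FiniteSubgroup.
Variables (G : groupType) (l : seq G).
Hypotheses (l1 : 1 \in l) (lM : {in l &, forall x y, x * y \in l})
  (lV : {in l, forall x, x^-1 \in l}).

(** The closure proofs are arguments of the type so that the group structure declared on it can
    refer to them. *)
Definition fsub of 1 \in l & {in l &, forall x y, x * y \in l} &
  {in l, forall x, x^-1 \in l} : Type := seq_sub l.
Local Notation T := (fsub l1 lM lV).

HB.instance Definition _ := Finite.copy T (seq_sub l).

Definition fsub_mul (x y : T) : T := SeqSub (lM (ssvalP x) (ssvalP y)).
Definition fsub_one : T := SeqSub l1.
Definition fsub_inv (x : T) : T := SeqSub (lV (ssvalP x)).

Fact fsub_mulA : associative fsub_mul.
Proof. by move=> x y z; apply: val_inj; rewrite /= mulgA. Qed.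
Fact fsub_mul1 : left_id fsub_one fsub_mul.
Proof. by move=> x; apply: val_inj; rewrite /= mul1g. Qed.
Fact fsub_mulV : left_inverse fsub_one fsub_inv fsub_mul.
Proof. by move=> x; apply: val_inj; rewrite /= mulVg. Qed.

HB.instance Definition _ := Finite_isGroup.Build T fsub_mulA fsub_mul1 fsub_mulV.

Definition fsub_finGroupType : finGroupType := T.
Definition fsub_val (x : fsub_finGroupType) : G := ssval x.

End FiniteSubgroup.

Lemma finite_subgroup_model (G : groupType) (E : set G) (Q : finType) (q : G -> Q) :
  is_subgroup E -> (forall x y, E x -> E y -> q x = q y -> x = y) ->
  exists (T : finGroupType) (f : T -> G),
    [/\ injective f, {morph f : x y / x * y} & forall x, E x <-> exists t, f t = x].
Proof.
move=> Esub Einj.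
pose l := [seq xget 1 [set x | E x /\ q x = c] | c <- enum Q].
have lP x : E x <-> x \in l.
  split=> [Ex|/mapP[c _ ->]]; last by case: xgetP => [y _ []|_] //; apply: (sub1 Esub).
  apply/mapP; exists (q x); first by rewrite mem_enum.
  by case: xgetP => [y _ [Ey qy]|/(_ x)[]//]; apply: Einj.
have l1 : 1 \in l by apply/lP; apply: (sub1 Esub).
have lM : {in l &, forall x y, x * y \in l}.
  by move=> x y /lP Ex /lP Ey; apply/lP; apply: (subM Esub).
have lV : {in l, forall x, x^-1 \in l} by move=> x /lP Ex; apply/lP; apply: (subV Esub).
exists (fsub_finGroupType l1 lM lV), (@fsub_val _ _ l1 lM lV); split=> //.
  exact: val_inj.
move=> x; rewrite lP; split=> [xl|[t <-]]; last exact: ssvalP.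
by exists (SeqSub xl).
Qed.

(** Compactness of the full shift on T. The solution is built one coordinate at a time, keeping
    prefixes that extend to a solution of every R n ([good]). If every value t of the next
    coordinate failed, each at some index f t, then R at the maximum of the f t would have no
    solution with this prefix. *)
Lemma koenig (T : finType) (t0 : T) (R : nat -> (nat -> T) -> Prop) :
  (forall n e, R n.+1 e -> R n e) ->
  (forall n, exists k, forall e e', (forall i, i < k -> e i = e' i) -> R n e -> R n e') ->
  (forall n, exists e, R n e) -> exists e, forall n, R n e.
Proof.
move=> Rdec Rloc Rex.
have Rle m n e : m <= n -> R n e -> R m e.
  by move=> /subnK <-; elim: (n - m) => //= k IH /Rdec.
pose good k a := forall n, exists2 e, R n e & forall i, i < k -> e i = a i.
have [||f fgood fext] := @dependent_choice (nat -> T) good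
    (fun k a b => forall i, i < k -> b i = a i).
- by exists (fun=> t0) => n; have [e Re] := Rex n; exists e.
- move=> k a agood; pose upd t i := if i == k then t else a i.
  suff [t tgood] : exists t, good k.+1 (upd t).
    by exists (upd t) => // i; rewrite /upd; case: ltngtP.
  apply: contrapT => nex.
  have /choice[f fP] : forall t, exists n, forall e, R n e ->
      ~ forall i, i < k.+1 -> e i = upd t i.
    move=> t; apply: contrapT => nf; apply: nex; exists t => n.
    by apply: contrapT => nRe; apply: nf; exists n => e Re eE; apply: nRe; exists e.
  have [e Re eE] := agood (\max_t f t).
  have lef : f (e k) <= \max_t f t by apply: leq_bigmax.
  apply: (fP (e k) e (Rle _ _ _ lef Re)) => i; rewrite /upd ltnS leq_eqVlt.
  by case: eqVneq => [-> //|_ /= /eE].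
have fstable k j i : i < k -> f (k + j) i = f k i.
  by move=> ltik; elim: j => [|j IH]; rewrite ?addn0 // addnS fext ?IH // ltn_addr.
exists (fun i => f i.+1 i) => n; have [k kP] := Rloc n.
have [e Re eE] := fgood k n; apply: kP Re => i ltik.
by rewrite eE // -(subnKC ltik) fstable.
Qed.

Section Recode.
Variables (T : finGroupType) (K : set (nat -> T)).
Hypothesis K1 : K (fun=> 1).
Hypothesis KM : forall e e', K e -> K e' -> K (fun i => e i * e' i).
Hypothesis KV : forall e, K e -> K (fun i => (e i)^-1).
Hypothesis Kshift : forall e, K e -> K (fun i => e i.+1).
Variable r : nat.
Hypothesis Kr : forall e, K e -> (forall i, i < r -> e i = 1) -> forall i, e i = 1.

(* P induces an equivariant isomorphism from T^N / K to T^N; the last clause gives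
   the continuity of its inverse. *)
Definition recoding (P : (nat -> T) -> nat -> T) : Prop :=
  [/\ forall e e' n, P (fun i => e i * e' i) n = P e n * P e' n,
      forall e n, P (fun i => e i.+1) n = P e n.+1,
      forall e, (forall n, P e n = 1) <-> K e,
      exists d, forall e e', (forall i, i < d -> e i = e' i) -> P e 0 = P e' 0 &
      forall f, exists2 e, (forall n, P e n = f n) &
        forall k, (forall i, i < k -> f i = 1) -> forall i, i < k -> e i = 1].

Lemma recoding_trivial : (forall e, K e -> forall i, e i = 1) -> exists P, recoding P.
Proof.
move=> Ktriv; exists id; split=> //.
- move=> e; split=> [e1|/Ktriv//]; suff -> : e = (fun=> 1) by [].
  exact/funext.
- by exists 1%N => e e'; apply.
- by move=> f; exists f.
Qed.

(* K is the solution set of a recurrence e (n + d) = rho (e n, ..., e (n + d - 1)),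
   and P measures the failure of this recurrence. *)
Lemma recoding_cyclic (t0 : T) : t0 != 1 -> abelian [set: T] ->
  (forall D : {group T}, D :=: 1 \/ D :=: [set: T]) -> exists P, recoding P.
Proof.
move=> t0N1 /centsP abT primeT.
have mulC (x y : T) : x * y = y * x by apply: abT; rewrite inE.
have shiftn n e : K e -> K (fun i => e (n + i)).
  elim: n e => [|n IH] e Ke //.
  suff -> : (fun i => e (n.+1 + i)) = (fun i => e (n + i).+1) by exact: IH (Kshift Ke).
  exact/funext.
pose surj d := forall t : nat -> T, exists2 k, K k & forall i, i < d -> k i = t i.
(* d is the order of the recurrence: the largest length for which K surjects onto T^d, at most r by
   [Kr]. *)
have [d surjd nsurjd] : exists2 d, surj d & ~ surj d.+1.
  have nsr : ~ surj r.+1.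
    move=> /(_ (fun i => if i == r then t0 else 1))[k Kk kE].
    have := kE r (leqnn _); rewrite eqxx (Kr Kk) => [t01|i lti].
      by rewrite -t01 eqxx in t0N1.
    by rewrite kE ?ltnS 1?ltnW // ltn_eqF.
  apply: contrapT => nex; apply: nsr; elim: r.+1 => [|d IH] t; first by exists (fun=> 1).
  by apply: contrapT => nt; apply: nex; exists d => // /(_ t).
(* D is a subgroup, hence 1 or T, and D = T would make K surject onto T^(d+1). So in K the first d
   coordinates determine the next one, which defines rho. *)
pose D : {set T} := [set u | `[< exists k, [/\ K k, forall i, i < d -> k i = 1 & k d = u] >]]%SET.
have DP u : u \in D <-> exists k, [/\ K k, forall i, i < d -> k i = 1 & k d = u].
  by rewrite /D finset.in_set; split=> /asboolP.
have Dg : group_set D.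
  apply/group_setP; split=> [|u v /DP[k [Kk k1 <-]] /DP[k' [Kk' k'1 <-]]].
    by apply/DP; exists (fun=> 1).
  apply/DP; exists (fun i => k i * k' i); split=> //; first exact: KM.
  by move=> i ltid; rewrite k1 // k'1 // mulg1.
have D1 k : K k -> (forall i, i < d -> k i = 1) -> k d = 1.
  move=> Kk k1; have : k d \in D by apply/DP; exists k.
  have [/= ->|/= DT] := primeT (Group Dg); first by rewrite inE => /eqP.
  case: nsurjd => t; have [k' Kk' k'E] := surjd t.
  have /DP[k'' [Kk'' k''1 k''d]] : (k' d)^-1 * t d \in D by rewrite DT inE.
  exists (fun i => k' i * k'' i); first exact: KM.
  move=> i; rewrite ltnS leq_eqVlt => /predU1P[->|ltid]; first by rewrite k''d mulKVg.
  by rewrite k''1 // mulg1 k'E.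
have /choice[rho rhoP] : forall e, exists u, forall k, K k ->
    (forall i, i < d -> k i = e i) -> k d = u.
  move=> e; have [k Kk kE] := surjd e; exists (k d) => k' Kk' k'E.
  have : (fun i => k' i * (k i)^-1) d = 1.
    apply: (D1 (fun i => k' i * (k i)^-1)) => [|i ltid]; first exact: (KM Kk' (KV Kk)).
    by rewrite k'E // kE // mulgV.
  by move/mulg1_eq/invg_inj.
have rho_ext e e' : (forall i, i < d -> e i = e' i) -> rho e = rho e'.
  move=> ee'; have [k Kk kE] := surjd e; rewrite -(rhoP e k) //.
  by apply: rhoP => // i ltid; rewrite kE // ee'.
have rhoM e e' : rho (fun i => e i * e' i) = rho e * rho e'.
  have [k Kk kE] := surjd e; have [k' Kk' k'E] := surjd e'.
  rewrite -(rhoP e k) // -(rhoP e' k') //; symmetry.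
  apply: (rhoP _ (fun i => k i * k' i)); first exact: KM.
  by move=> i ltid; rewrite kE // k'E.
have rho1 e : (forall i, i < d -> e i = 1) -> rho e = 1.
  by move=> e1; rewrite -(rhoP e (fun=> 1)) // => i /e1.
pose P (e : nat -> T) n := e (n + d) * (rho (fun i => e (n + i)))^-1.
exists P; split.
- move=> e e' n; rewrite /P rhoM invgM -!mulgA; congr (_ * _).
  by rewrite [RHS]mulC -!mulgA; congr (_ * _); rewrite mulC.
- by move=> e n; rewrite /P !addSn; congr (_ * (rho _)^-1); apply/funext.
- move=> e; split=> [Pe1|Ke n]; last first.
    by rewrite /P -(rhoP _ (fun i => e (n + i))) ?mulgV //; apply: shiftn.
  have [k Kk kE] := surjd e; suff <- : k = e by [].
  apply/funext => n; have [m] := ubnP n; elim: m n => // m IH n; rewrite ltnS => lenm.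
  case: (ltnP n d) => [/kE//|ledn].
  have /mulg1_eq/invg_inj := Pe1 (n - d); rewrite subnK // => ->.
  rewrite -(rhoP _ (fun i => k (n - d + i))) ?subnK //; first exact: shiftn.
  move=> i ltid; apply: IH; apply: leq_trans lenm.
  by rewrite -[X in _ < X](subnK ledn) ltn_add2l.
- exists d.+1 => e e' ee'; rewrite /P add0n ee' //; congr (_ * (_)^-1).
  by apply: rho_ext => i ltid; apply: ee'; apply: leqW.
(* A preimage of f solves the recurrence with defect f, starting from d entries equal to 1: [step n]
   fills coordinate n + d, and from w n on the coordinates below n + d no longer change. *)
- move=> f; pose step n (w : nat -> T) i :=
    if i == n + d then f n * rho (fun j => w (n + j)) else w i.
  pose w := fix w n := if n is n'.+1 then step n' (w n') else (fun=> 1).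
  have wS n i : w n.+1 i = step n (w n) i by [].
  have w_stable n m i : i < n + d -> w (n + m) i = w n i.
    move=> lti; elim: m => [|m IH]; rewrite ?addn0 // addnS wS /step ltn_eqF ?IH //.
    by rewrite -addnA addnCA ltn_addl.
  pose e i := w i.+1 i.
  have eE n i : i < n + d -> e i = w n i.
    move=> lti; case: (leqP n i.+1) => [leni|ltin].
      by rewrite /e -(subnKC leni) w_stable.
    by rewrite /e -(subnKC (ltnW ltin)) w_stable // ltn_addr.
  exists e => [n|k f1 i ltik].
    rewrite /P (eE n.+1) ?addSn // wS /step eqxx.
    rewrite (rho_ext (fun i => e (n + i)) (fun j => w n (n + j))) ?mulgK //.
    by move=> i ltid; apply: eE; rewrite ltn_add2l.
  rewrite /e; move: i.+1 => n; elim: n i ltik => [|n IH] i ltik //.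
  rewrite wS /step; case: eqVneq => [iE|_]; last exact: IH.
  rewrite f1 ?rho1 ?mulg1 //; last by apply: leq_ltn_trans ltik; rewrite iE leq_addr.
  by move=> j ltjd; apply: IH; apply: leq_ltn_trans ltik; rewrite iE leq_add2l ltnW.
Qed.

End Recode.

(** The codes of the images of the iterates of F decrease and stabilize, which relates F^n x to some
    F^n (F y); the n outer applications of F are then cancelled. This replaces a count of classes,
    as q need only be finer than R. *)
Lemma pigeonhole_surj (A : Type) (Q : finType) (q : A -> Q) (E : set A)
    (R : A -> A -> Prop) (F : A -> A) :
  (forall x y, E x -> E y -> q x = q y -> R x y) ->
  (forall x, E x -> E (F x)) ->
  (forall x y, E x -> E y -> R (F x) (F y) -> R x y) ->
  forall x, E x -> exists2 y, E y & R (F y) x.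
Proof.
move=> qR EF FR x Ex.
have EFn n y : E y -> E (iter n F y) by elim: n => //= n IH /IH/EF.
have FnR n y z : E y -> E z -> R (iter n F y) (iter n F z) -> R y z.
  by elim: n => //= n IH Ey Ez /FR; auto.
have [|n nP] := @decreasing_stabilizes Q
    (fun n c => exists2 y, E y & q (iter n F y) = c).
  by move=> n c [y Ey <-]; exists (F y); rewrite -?iterSr //; apply: EF.
have [|y Ey] := nP n.+1 (q (iter n F x)); first by exists x.
rewrite iterSr => /qR Ryx; exists y => //.
by apply: (FnR n); auto.
Qed.

(** The map sending x to the sequence of the chi (s^i x) is an isomorphism from N to the full shift
    on T, so its coordinate 0 carries all the information; [shs_open] and [shs_sep] express
    continuity of the map and of its inverse. *)
Record shift_subgroup (G : groupType) (s : G -> G) (U : set G)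
    (T : finGroupType) (N : set G) (chi : G -> T) : Prop := ShiftSubgroup {
  shs_sub : is_subgroup N;
  shs_norm : forall x g, N x -> N (x ^ g);
  shs_closed : closed_set s U N;
  shs_stable : forall x, N x -> N (s x);
  shs_M : forall x y, N x -> N y -> chi (x * y) = chi x * chi y;
  shs_open : exists n, forall x, N x -> level s U n x -> chi x = 1;
  shs_surj : forall t : nat -> T, exists2 x, N x & forall i, chi (iter i s x) = t i;
  shs_sep : forall n, exists k, forall x, N x ->
    (forall i, i < k -> chi (iter i s x) = 1) -> level s U n x
}.

Section Image.
Variables (G : groupType) (s : G -> G) (U : set G).
Hypothesis GU : expansive s U.
Local Notation Un := (level s U).
Variables (T : finGroupType) (Psi : (nat -> T) -> G).
Hypothesis PsiM : forall e e', Psi (fun i => e i * e' i) = Psi e * Psi e'.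
Hypothesis PsiS : forall e, s (Psi e) = Psi (fun i => e i.+1).
Hypothesis Psi_cont : forall n, exists k, forall e, (forall i, i < k -> e i = 1) -> Un n (Psi e).
Hypothesis Psi_norm : forall e g, exists e', Psi e' = Psi e ^ g.

Let Psi1 : Psi (fun=> 1) = 1.
Proof.
apply: (mulgI (Psi (fun=> 1))); rewrite -PsiM [RHS]mulg1; congr (Psi _).
by apply/funext => i; rewrite mulg1.
Qed.

Let PsiV e : Psi (fun i => (e i)^-1) = (Psi e)^-1.
Proof.
apply: (mulgI (Psi e)); rewrite -PsiM mulgV -Psi1; congr (Psi _).
by apply/funext => i; rewrite mulgV.
Qed.

(** By the recoding, the quotient of the full shift by ker Psi is again the full shift, and so is
    the image N of Psi. [chi] is read off an arbitrary preimage, which is legitimate because P and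
    Psi have the same kernel. Closedness of N and continuity of chi come from compactness
    ([koenig]). *)
Lemma image_shift_subgroup P : recoding (fun e => Psi e = 1) P ->
  exists N (chi : G -> T), shift_subgroup s U N chi.
Proof.
move=> [PM Pshift Pker [d Ploc] Plift].
have eqPsi e e' : Psi e = Psi e' <-> Psi (fun i => (e i)^-1 * e' i) = 1.
  by rewrite PsiM PsiV; split=> [->|/mulg1_eq]; rewrite ?mulVg // invgK.
have P1 n : P (fun=> 1) n = 1.
  by move: n; apply/Pker.
have PV e n : P (fun i => (e i)^-1) n = (P e n)^-1.
  apply: (mulgI (P e n)); rewrite -PM mulgV -(P1 n); congr (P _ n).
  by apply/funext => i; rewrite mulgV.
have eqP e e' : Psi e = Psi e' -> forall n, P e n = P e' n.
  move=> /eqPsi/Pker Pe n; have := Pe n; rewrite PM PV => /mulg1_eq.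
  by rewrite invgK.
pose N x := exists e, Psi e = x.
pose inv x : nat -> T := xget (fun=> 1) [set e | Psi e = x].
have invP e : Psi (inv (Psi e)) = Psi e.
  by rewrite /inv; case: xgetP => [e' -> //|/(_ e)]; case.
pose chi x := P (inv x) 0.
have chiE e : chi (Psi e) = P e 0 by apply: eqP; apply: invP.
have iterPsi i e : iter i s (Psi e) = Psi (fun j => e (i + j)).
  elim: i e => [|i IH] e; first by congr (Psi _).
  by rewrite iterSr PsiS IH.
have iterP i j e : P (fun k => e (i + k)) j = P e (i + j).
  elim: i j e => [|i IH] j e //.
  by rewrite addSn -Pshift -(IH j (fun k => e k.+1)).
have chi_iter i e : chi (iter i s (Psi e)) = P e i by rewrite iterPsi chiE iterP addn0.
have Psi_loc n : exists k, forall e e', (forall i, i < k -> e i = e' i) -> Un n ((Psi e)^-1 * Psi e').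
  have [k kP] := Psi_cont n; exists k => e e' ee'; rewrite -PsiV -PsiM; apply: kP => i /ee' ->.
  by rewrite mulVg.
exists N, chi; split.
- split=> [|_ _ [e <-] [e' <-]|_ [e <-]]; first by exists (fun=> 1).
    by exists (fun i => e i * e' i).
  by exists (fun i => (e i)^-1).
- by move=> _ g [e <-]; have [e' e'E] := Psi_norm e g; exists e'.
- move=> x xN; have [||n|e eP] := @koenig T 1 (fun n e => Un n ((Psi e)^-1 * x)).
  + by move=> n e; apply: level_le.
  + move=> n; have [k kP] := Psi_loc n; exists k => e e' ee' Ue.
    have -> : (Psi e')^-1 * x = (Psi e')^-1 * Psi e * ((Psi e)^-1 * x) by gsimp.
    by apply: (subM (level_sub GU _)) => //; apply: kP => i /ee'.
  + by have [_ [e <-] Ue] := xN n; exists e.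
  + by exists e; apply: mulVg_eq1; apply: (exp_sep GU).
- by move=> _ [e <-]; rewrite PsiS; exists (fun i => e i.+1).
- by move=> _ _ [e <-] [e' <-]; rewrite -PsiM !chiE.
- apply: contrapT => nex.
  have [||n|e eP] := @koenig T 1 (fun n e => Un n (Psi e) /\ P e 0 <> 1).
  + by move=> n e [Ue Pe]; split=> //; apply: level_le Ue.
  + move=> n; have [k kP] := Psi_loc n; exists (maxn k d) => e e' ee' [Ue Pe]; split.
      rewrite -(mulVKg (Psi e) (Psi e')); apply: (subM (level_sub GU _)) => //.
      by apply: kP => i ltik; apply: ee'; rewrite leq_max ltik.
    by rewrite -(Ploc e) // => i ltid; apply: ee'; rewrite leq_max ltid orbT.
  + apply: contrapT => nen; apply: nex; exists n => _ [e <-] Ue; rewrite chiE.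
    by apply: contrapT => Pe; apply: nen; exists e.
  + have /Pker/(_ 0) : Psi e = 1 by apply: (exp_sep GU) => n; have [] := eP n.
    by have [] := eP 0.
- move=> t; have [e eE _] := Plift t; exists (Psi e); first by exists e.
  by move=> i; rewrite chi_iter.
- move=> n; have [k kP] := Psi_cont n; exists k => _ [e <-] chi1.
  have [e' e'E e'1] := Plift (P e).
  have <- : Psi e' = Psi e.
    by apply/eqPsi/Pker => m; rewrite PM PV e'E mulVg.
  by apply: kP; apply: e'1 => i /chi1; rewrite chi_iter.
Qed.

End Image.

(* f identifies T with a minimal normal subgroup of G inside ker s^(p+1); beta i t
   is the lift of f t along s^i lying close to 1, and Psi0 e is the infinite product
   of the beta i (e i). *)
Section Construction.
Variables (G : groupType) (s : G -> G) (U : set G).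
Hypothesis GU : expansive s U.
Let sM : {morph s : x y / x * y} := expM GU.
Let s1 : s 1 = 1 := endo1 sM.
Let sV : {morph s : x / x^-1} := endoV sM.
Local Notation Un := (level s U).
Hypotheses (conn : shift_connected s U) (surj : forall x, exists y, s y = x).
Variable n0 : nat.
Hypothesis lift : forall n, n0 <= n -> forall k x, Un n x ->
  exists2 y, Un (n + k) y & iter k s y = x.
Variables (p : nat) (T : finGroupType) (f : T -> G).
Hypothesis kerp : forall x, Un n0 x -> iter p s x = 1 -> x = 1.
Hypotheses (finj : injective f) (fM : {morph f : x y / x * y}).
Hypothesis fU : forall t, Un n0 (f t).
Hypothesis fker : forall t, iter p.+1 s (f t) = 1.
Hypothesis fnorm : forall t g, exists u, f u = f t ^ g.
Variable t0 : T.
Hypothesis t0N1 : t0 != 1.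
Hypothesis Tmin : forall D : {group T},
  (forall t g u, t \in D -> f u = f t ^ g -> u \in D) -> D :=: 1 \/ D :=: [set: T].

Let f1 : f 1 = 1.
Proof. by apply: (mulgI (f 1)); rewrite -fM !mulg1. Qed.
Let fV : {morph f : x / x^-1}.
Proof. by move=> x; apply: (mulgI (f x)); rewrite -fM !mulgV f1. Qed.

Let act g t : T := xget 1 [set u | f u = f t ^ g].
Let actE g t : f (act g t) = f t ^ g.
Proof. by rewrite /act; case: xgetP => // nex; have [u /nex] := fnorm t g. Qed.

Let liftT_ex i t : exists x, Un (n0 + i) x /\ iter i s x = f t.
Proof. by have [x] := lift (leqnn n0) i (fU t); exists x. Qed.
Let beta i t : G := xget 1 [set x | Un (n0 + i) x /\ iter i s x = f t].
Let betaP i t : Un (n0 + i) (beta i t) /\ iter i s (beta i t) = f t.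
Proof. by rewrite /beta; case: xgetP => // nex; have [x /nex] := liftT_ex i t. Qed.
(** Lifts along s^i inside U_i are unique because ker s^i meets U_i trivially. The rules for
    products, conjugates and images under s all follow by recognizing one side as such a lift. *)
Let beta_uniq i t x : Un i x -> iter i s x = f t -> x = beta i t.
Proof.
have [Ub sb] := betaP i t => Ux sx.
apply: mulVg_eq1; apply: (ker_level GU (k := i)); last first.
  by rewrite (iter_endoM sM) (iter_endoV sM) sx sb mulVg.
apply: (subM (level_sub GU i)); first exact: (subV (level_sub GU i)).
by apply: level_le Ub; rewrite leq_addl.
Qed.
Let betaU i t : Un i (beta i t).
Proof. by have [Ub _] := betaP i t; apply: level_le Ub; rewrite leq_addl. Qed.
Let betaM i t u : beta i (t * u) = beta i t * beta i u.
Proof.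
symmetry; apply: beta_uniq; first exact: (subM (level_sub GU i)).
by rewrite (iter_endoM sM) !(betaP _ _).2 fM.
Qed.
Let beta1 i : beta i 1 = 1.
Proof. by apply: (mulgI (beta i 1)); rewrite -betaM !mulg1. Qed.
Let betaS i t : s (beta i.+1 t) = beta i t.
Proof.
have [Ub sb] := betaP i.+1 t; apply: beta_uniq; last by rewrite -iterSr.
by have [] := (levelS _ _ _ _).1 (@betaU i.+1 t).
Qed.
Let betaJ i t g : beta i t ^ g = beta i (act (iter i s g) t).
Proof.
apply: beta_uniq; first exact: (level_norm GU).
by rewrite (iter_endoJ GU) (betaP _ _).2 actE.
Qed.

(** This is where minimality of m = p + 1 acts: s (f t) lies in U_n0 and is killed by s^p, so s (f
    t) = 1, and f t in U forces f t = 1. *)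
Let deep_trivial t : Un n0.+1 (f t) -> t = 1.
Proof.
move=> Uf; have [U1f Usf] := (levelS _ _ _ _).1 Uf.
apply: finj; rewrite f1; apply: (ker_level GU (k := 1%N)).
  by move=> [|//] _; apply: (U1f).
by apply: (kerp Usf); rewrite -iterSr.
Qed.
(** Applying s^i to the common value puts f t in level n0 + (j - i), beyond n0. *)
Let beta_disjoint i j t u : i < j -> beta i t = beta j u -> beta i t = 1.
Proof.
move=> ltij bE; suff -> : t = 1 by rewrite beta1.
apply: deep_trivial; rewrite -(betaP i t).2 bE.
apply: (level_iter (k := i)); have [Ub _] := betaP j u.
by apply: level_le Ub; rewrite addnS addnC -addnS leq_add2l.
Qed.
(** The images of beta i and beta j are normal by [betaJ] and meet trivially, and commutators
    between them lie in both. *)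
Let beta_comm i j t u : i != j -> beta i t * beta j u = beta j u * beta i t.
Proof.
wlog ltij : i j t u / i < j => [wl|_].
  by case: ltngtP => // [ltij|ltji] _; [|symmetry]; apply: wl; rewrite // ltn_eqF.
have : [~ beta i t, beta j u] = 1.
  have E1 : [~ beta i t, beta j u] = beta i (t^-1 * act (iter i s (beta j u)) t).
    rewrite commgEl betaJ -[(beta i t)^-1]mul1g -(beta1 i) -(mulVg t) betaM mulgK -betaM //.
  have E2 : [~ beta i t, beta j u] = beta j (act (iter j s (beta i t)) u^-1 * u).
    rewrite commgEr betaM -betaJ; congr (_ ^ _ * _).
    by apply: (mulgI (beta j u)); rewrite -betaM !mulgV beta1.
  by rewrite E1; apply: (beta_disjoint ltij); rewrite -E1 E2.
by move/eqP/commgP.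
Qed.

Let w (e : nat -> T) := fix w n := if n is n'.+1 then w n' * beta n' (e n') else 1.
Let wS e n : w e n.+1 = w e n * beta n (e n). Proof. by []. Qed.
Let w_step e n : Un (n0 + n) ((w e n)^-1 * w e n.+1).
Proof. by rewrite wS mulKg; have [] := betaP n (e n). Qed.
Let w_steps e n k : Un (n0 + n) ((w e n)^-1 * w e (n + k)).
Proof.
elim: k => [|k IH]; first by rewrite addn0 mulVg; apply: (sub1 (level_sub GU _)).
rewrite addnS wS mulgA; apply: (subM (level_sub GU _)) => //.
by have [Ub _] := betaP (n + k) (e (n + k)); apply: level_le Ub; rewrite leq_add2l leq_addr.
Qed.
Let Psi0_ex e : exists y, forall n, Un n ((w e n)^-1 * y).
Proof.
apply: (exp_complete GU) => n; apply: level_le (@w_step e n); exact: leq_addl.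
Qed.
Let Psi0 e : G := xget 1 [set y | forall n, Un n ((w e n)^-1 * y)].
Let Psi0P e n : Un (n0 + n) ((w e n)^-1 * Psi0 e).
Proof.
have H m : Un m ((w e m)^-1 * Psi0 e).
  by rewrite /Psi0; case: xgetP => // nex; have [y /nex] := Psi0_ex e.
have -> : (w e n)^-1 * Psi0 e = (w e n)^-1 * w e (n + n0) * ((w e (n + n0))^-1 * Psi0 e) by gsimp.
by apply: (subM (level_sub GU _)); [exact: w_steps|rewrite addnC].
Qed.
Let Psi0_uniq e y : (forall n, Un n ((w e n)^-1 * y)) -> Psi0 e = y.
Proof.
move=> yP; apply: mulVg_eq1; apply: (exp_sep GU) => n.
have -> : (Psi0 e)^-1 * y = ((w e n)^-1 * Psi0 e)^-1 * ((w e n)^-1 * y) by gsimp.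
apply: (subM (level_sub GU _)) => //; apply: (subV (level_sub GU _)).
by apply: level_le (@Psi0P e n); exact: leq_addl.
Qed.
Let Psi0U e n : Un n ((w e n)^-1 * Psi0 e).
Proof. by apply: level_le (@Psi0P e n); exact: leq_addl. Qed.

Let w_comm e n j t : n <= j -> w e n * beta j t = beta j t * w e n.
Proof.
elim: n => [|n IH] lenj; first by rewrite mulg1 mul1g.
by rewrite wS -mulgA beta_comm ?ltn_eqF // mulgA IH ?mulgA // ltnW.
Qed.
Let wM e e' n : w (fun i => e i * e' i) n = w e n * w e' n.
Proof.
elim: n => [|n IH]; first by rewrite mulg1.
by rewrite !wS IH betaM !mulgA; congr (_ * _); rewrite -!mulgA w_comm.
Qed.
Let Psi0M e e' : Psi0 (fun i => e i * e' i) = Psi0 e * Psi0 e'.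
Proof.
apply: Psi0_uniq => n; rewrite wM.
have -> : (w e n * w e' n)^-1 * (Psi0 e * Psi0 e') =
   ((w e n)^-1 * Psi0 e) ^ (w e' n) * ((w e' n)^-1 * Psi0 e') by rewrite /conjg; gsimp.
by apply: (subM (level_sub GU _)) => //; apply: (level_norm GU).
Qed.
Let wJ e g n : w (fun i => act (iter i s g) (e i)) n = w e n ^ g.
Proof. by elim: n => [|n IH]; rewrite ?conj1g // !wS conjMg IH betaJ. Qed.
Let Psi0J e g : Psi0 (fun i => act (iter i s g) (e i)) = Psi0 e ^ g.
Proof.
apply: Psi0_uniq => n; rewrite wJ -conjVg -conjMg; exact: (level_norm GU).
Qed.
Let wshift e n : s (w e n.+1) = s (beta 0 (e 0)) * w (fun i => e i.+1) n.
Proof.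
elim: n => [|n IH]; first by rewrite /= mul1g mulg1.
by rewrite wS sM IH betaS -mulgA.
Qed.
Let Psi0S e : s (Psi0 e) = s (beta 0 (e 0)) * Psi0 (fun i => e i.+1).
Proof.
apply: (mulgI (s (beta 0 (e 0)))^-1); rewrite mulKg; symmetry; apply: Psi0_uniq => n.
rewrite mulgA -invgM -wshift -sV -sM.
by have [] := (levelS _ _ _ _).1 (@Psi0U e n.+1).
Qed.
Let Psi0_start e n : (forall i, i < n -> e i = 1) -> Un (n0 + n) (Psi0 e).
Proof.
move=> e1; have := @Psi0P e n; suff -> : w e n = 1 by rewrite invg1 mul1g.
elim: n e1 => // n IH e1; rewrite wS e1 // beta1 mulg1 IH // => i lti.
by apply: e1; apply: ltnW.
Qed.
Let Psi0_inj e : Psi0 e = 1 -> forall i, e i = 1.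
Proof.
move=> Pe i; have [m] := ubnP i; elim: m i => // m IH i; rewrite ltnS => leim.
have e1 j : j < i -> e j = 1 by move=> ltji; apply: IH; apply: leq_trans leim.
have wi : w e i = 1.
  elim: (i) e1 => // n IHn e1; rewrite wS e1 // beta1 mulg1 IHn // => j ltj.
  by apply: e1; apply: ltnW.
have := @Psi0P e i.+1; rewrite Pe mulg1 wS wi mul1g => /(subV (level_sub GU _)).
rewrite invgK addnS -addSn addnC => /(level_iter (k := i)); rewrite (betaP _ _).2.
exact: deep_trivial.
Qed.

(** By [Psi0S], Psi0 commutes with the shifts only up to the factor s (f (e 0)). Applying s^p kills
    this factor, as s^(p+1) kills f T, at the price of a possible kernel. *)
Let Psi e := iter p s (Psi0 e).
Let PsiM e e' : Psi (fun i => e i * e' i) = Psi e * Psi e'.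
Proof. by rewrite /Psi Psi0M (iter_endoM sM). Qed.
Let PsiS e : s (Psi e) = Psi (fun i => e i.+1).
Proof.
have b0 t : beta 0 t = f t := (betaP 0 t).2.
by rewrite /Psi -iterS iterSr Psi0S (iter_endoM sM) -iterSr b0 fker mul1g.
Qed.
Let Psi_cont n : exists k, forall e, (forall i, i < k -> e i = 1) -> Un n (Psi e).
Proof.
exists (p + n) => e /Psi0_start Ue; apply: (level_iter (k := p)).
by apply: level_le Ue; exact: leq_addl.
Qed.
Let PsiJ e g : Psi (fun i => act (iter i s g) (e i)) = Psi e ^ iter p s g.
Proof. by rewrite /Psi Psi0J (iter_endoJ GU). Qed.
Let iter_surj n x : exists y, iter n s y = x.
Proof.
elim: n x => [|n IH] x; first by exists x.
by have [y <-] := surj x; have [z <-] := IH y; exists z.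
Qed.
Let Psi_norm e g : exists e', Psi e' = Psi e ^ g.
Proof. by have [h <-] := iter_surj p g; rewrite -PsiJ; eexists. Qed.
Let Psi0_skip n e : (forall i, i < n -> e i = 1) -> iter n s (Psi0 e) = Psi0 (fun i => e (n + i)).
Proof.
elim: n e => [|n IH] e e1; first by congr (Psi0 _).
rewrite iterSr Psi0S e1 // beta1 s1 mul1g (IH (fun i => e i.+1)) //.
by move=> i lti; apply: e1.
Qed.
(** On sequences that vanish before p, s^p acts through the p-fold shift ([Psi0_skip]), and Psi0 is
    injective. *)
Let Kr e : Psi e = 1 -> (forall i, i < p -> e i = 1) -> forall i, e i = 1.
Proof.
move=> Pe e1 i; case: (ltnP i p) => [/e1//|lepi].
by rewrite -(subnKC lepi); apply: (Psi0_inj (e := fun i => e (p + i))); rewrite -Psi0_skip.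
Qed.

Let Psi1 : Psi (fun=> 1) = 1.
Proof.
apply: (mulgI (Psi (fun=> 1))); rewrite -PsiM [RHS]mulg1; congr (Psi _).
by apply/funext => i; rewrite mulg1.
Qed.
Let PsiV e : Psi (fun i => (e i)^-1) = (Psi e)^-1.
Proof.
apply: (mulgI (Psi e)); rewrite -PsiM mulgV -Psi1; congr (Psi _).
by apply/funext => i; rewrite mulgV.
Qed.
Let act1 t : act 1 t = t.
Proof. by apply: finj; rewrite actE conjg1. Qed.
Let actM g h t : act (g * h) t = act h (act g t).
Proof. by apply: finj; rewrite !actE conjgM. Qed.

(** The commutator of f t and g lies in the normal subgroup f T and in U_(n0+1), which meet
    trivially. *)
Let act_trivial g t : Un n0.+1 g -> act g t = t.
Proof.
move=> Ug; symmetry; apply: mulVg_eq1; apply: deep_trivial.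
rewrite fM fV actE -commgEl commgEr; apply: (subM (level_sub GU _)) => //.
by apply: (level_norm GU); apply: (subV (level_sub GU _)).
Qed.

Let K e := Psi e = 1.
Let moved g e i := act (iter i s g) (e i) * (e i)^-1.
Let moved_ker g e : K e -> K (moved g e).
Proof.
by rewrite /K /moved PsiM PsiV PsiJ => ->; rewrite conj1g invg1 mulg1.
Qed.
Let Kshift e : K e -> K (fun i => e i.+1).
Proof. by rewrite /K -PsiS => ->. Qed.
(** For a sequence supported at 0, Psi0 e = f (e 0) is in U_n0, and s^p kills it. Thus the shift is
    injective on K. *)
Let K_inj e : K e -> (forall i, e i.+1 = 1) -> forall i, e i = 1.
Proof.
move=> Ke e1 [|//]; have Pe : Psi0 e = f (e 0).
  apply: Psi0_uniq => -[|n] //; suff -> : w e n.+1 = f (e 0).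
    by rewrite mulVg; apply: (sub1 (level_sub GU _)).
  elim: n => [|n IH]; first by rewrite wS mul1g; exact: (betaP 0 _).2.
  by rewrite wS e1 beta1 mulg1.
by apply: finj; rewrite f1; apply: kerp => //; rewrite -Pe.
Qed.

Let centralizes g := forall e, K e -> forall i, act (iter i s g) (e i) = e i.
Let moved1 g e i : moved g e i = 1 <-> act (iter i s g) (e i) = e i.
Proof. by rewrite /moved; split=> [/mulg1_eq/invg_inj //|->]; rewrite mulgV. Qed.

(* The centralizer of ker Psi is open and invariant, hence everything. *)
Let all_centralize g : centralizes g.
Proof.
move: g; apply: conn.
- split=> [e _ i|x y Cx Cy e Ke i|x Cx e Ke i]; first by rewrite (iter_endo1 sM) act1.
    by rewrite (iter_endoM sM) actM Cx // Cy.
  by rewrite (iter_endoV sM) -[in LHS](Cx e Ke i) -actM mulgV act1.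
- exists (p + n0.+1) => g Ug e Ke i; apply/moved1; apply: (Kr (e := moved g e)).
    exact: moved_ker.
  move=> j ltjp; apply/moved1; apply: act_trivial; apply: (level_iter (k := j)).
  by apply: level_le Ug; rewrite leq_add2r ltnW.
- move=> g; split=> [Cg e Ke i|Cg e Ke i]; last first.
    (* K is finite by [Kr] and the shift is injective on it by [K_inj], hence also surjective. *)
    have [e' [Ke' e'E]] : exists e', K e' /\ forall i, e i = e' i.+1.
      have [||e' Ke' eE] := @pigeonhole_surj _ {ffun 'I_p -> T}
        (fun e : nat -> T => [ffun i : 'I_p => e i]) K eq (fun e i => e i.+1) _ Kshift _ e Ke.
      + move=> x y Kx Ky /ffunP qxy; apply/funext => j; apply: mulVg_eq1.
        apply: (Kr (e := fun i => (x i)^-1 * y i)) => [|k ltkp].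
          by rewrite PsiM PsiV Kx Ky invg1 mulg1.
        by have := qxy (Ordinal ltkp); rewrite !ffunE /= => ->; rewrite mulVg.
      + move=> x y Kx Ky sxy; apply/funext => j; apply: mulVg_eq1.
        apply: (K_inj (e := fun i => (x i)^-1 * y i)) => [|k].
          by rewrite /K PsiM PsiV Kx Ky invg1 mulg1.
        by have /= -> := congr1 (fun h : nat -> T => h k) sxy; rewrite mulVg.
      by exists e'; split=> // j; rewrite -eE.
    by rewrite e'E -iterSr; apply: Cg.
  apply/moved1; apply: (K_inj (moved_ker g Ke)) => j; apply/moved1.
  by rewrite iterSr; apply: (Cg (fun i => e i.+1)); apply: Kshift.
Qed.

Lemma construct_shift_subgroup : exists N (chi : G -> T), shift_subgroup s U N chi.
Proof.
suff [P Prec] : exists P, recoding K P.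
  exact: (image_shift_subgroup GU PsiM PsiS Psi_cont Psi_norm Prec).
have [Ktriv|] := pselect (forall e, K e -> forall i, e i = 1); first exact: recoding_trivial.
(* Shift a nontrivial element of K until a nontrivial entry z stands at 0; [all_centralize] makes f
   z central. Minimality then gives T = <z> without proper nontrivial subgroups, the situation of
   [recoding_cyclic]. *)
move=> nKtriv; have [z zN1 zC] : exists2 z, z != 1 & forall g, act g z = z.
  apply: contrapT => nz; apply: nKtriv => e Ke i; apply: contrapT => /eqP ei.
  apply: nz; exists (e i) => // g.
  elim: i e Ke ei => [|i IH] e Ke ei; first exact: (@all_centralize g e Ke 0).
  exact: (IH (fun j => e j.+1) (Kshift Ke)).
have zX g n : f (z ^+ n) ^ g = f (z ^+ n).
  elim: n => [|n IH]; first by rewrite expg0 f1 conj1g.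
  by rewrite expgS fM conjMg IH -[f z ^ g]actE zC.
have Tz : <[z]> = [set: T].
  have [|/eqP|//] := Tmin (D := <[z]>%G).
    by move=> t g u /cycleP[n ->]; rewrite zX => /finj ->; exact: mem_cycle.
  by rewrite cycle_eq1 (negbTE zN1).
have fC t g : f t ^ g = f t.
  have /cycleP[n ->] : t \in <[z]> by rewrite Tz inE.
  exact: zX.
apply: (@recoding_cyclic T K _ _ _ _ p Kr t0 t0N1).
- by rewrite /K.
- by move=> e e'; rewrite /K PsiM => -> ->; rewrite mulg1.
- by move=> e; rewrite /K PsiV => ->; rewrite invg1.
- exact: Kshift.
- by rewrite -Tz cycle_abelian.
- by move=> D; apply: Tmin => t g u Dt; rewrite fC => /finj ->.
Qed.

End Construction.

Theorem exists_shift_subgroup (G : groupType) (s : G -> G) (U : set G) :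
  expansive s U -> shift_connected s U -> (forall x, exists y, s y = x) ->
  (exists x : G, x <> 1) ->
  exists (T : finGroupType) (N : set G) (chi : G -> T),
    (exists t : T, t != 1) /\ shift_subgroup s U N chi.
Proof.
move=> GU conn surj Gnt; have sM := expM GU.
have [n0 [lift _]] := stable_open_bound GU.
pose meets m := exists x, [/\ x <> 1, level s U n0 x & iter m s x = 1].
have ex_meets : exists m, `[< meets m >].
  by have [m mP] := connected_ker_meets GU conn surj lift Gnt; exists m; apply/asboolP.
case: (ex_minnP ex_meets) => -[|p] /asboolP[x [xN1 Ux sx]] pmin; first by case: xN1.
have kerp y : level s U n0 y -> iter p s y = 1 -> y = 1.
  move=> Uy sy; apply: contrapT => yN1.
  have /pmin : `[< meets p >] by apply/asboolP; exists y.
  by rewrite ltnn.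
pose E y := level s U n0 y /\ iter p.+1 s y = 1.
have [Q [q qP]] := level_fin GU p.+1.
have Eq y z : E y -> E z -> q y = q z -> y = z.
  move=> [_ sy] [_ sz] /qP Uyz; apply: mulVg_eq1; apply: (ker_level GU Uyz).
  by rewrite (iter_endoM sM) (iter_endoV sM) sy sz invg1 mulg1.
(* E is finite, since elements with equal codes coincide ([Eq]), so a minimal good subset exists. *)
pose good (F : set G) := [/\ is_subgroup F, forall y g, F y -> F (y ^ g) & exists2 y, F y & y <> 1].
have Egood : good E.
  split; last by exists x.
    split=> [|y z [Uy sy] [Uz sz]|y [Uy sy]].
    - by split; [apply: (sub1 (level_sub GU n0))|rewrite (iter_endo1 sM)].
    - by split; [apply: (subM (level_sub GU n0))|rewrite (iter_endoM sM) sy sz mulg1].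
    - by split; [apply: (subV (level_sub GU n0))|rewrite (iter_endoV sM) sy invg1].
  move=> y g [Uy sy]; split; first exact: (level_norm GU).
  by rewrite (iter_endoJ GU) sy conj1g.
have [F [[Fsub Fnorm [y Fy yN1]] FE Fmin]] := minimal_coded Eq Egood.
have [|T [f [finj fM FP]]] := finite_subgroup_model Fsub (q := q).
  by move=> u v /FE Eu /FE Ev; apply: Eq.
have Ff t : F (f t) by apply/FP; exists t.
have f1 : f 1 = 1 by apply: (mulgI (f 1)); rewrite -fM !mulg1.
have [t0 t0E] := (FP y).1 Fy.
have t0N1 : t0 != 1 by apply/eqP => t01; apply: yN1; rewrite -t0E t01.
have [||||N [chi Nchi]] := 
  @construct_shift_subgroup G s U GU conn surj n0 lift p T f kerp finj fM _ _ _ t0 t0N1.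
- by move=> t; have [] := FE _ (Ff t).
- by move=> t; have [] := FE _ (Ff t).
- by move=> t g; apply/FP; apply: Fnorm.
- move=> D Dstab; have [D1|] := eqVneq D 1%G; first by left; rewrite D1.
  move=> /trivgPn[d Dd dN1]; right; apply/setP => t; rewrite inE.
  have [||u Du /finj <-] // := Fmin (fun z => exists2 u, u \in D & f u = z) _ _ (f t) (Ff t).
  + split=> [|_ g [u Du <-]|]; last by exists (f d); [exists d|rewrite -f1 => /finj/eqP; apply/negP].
      split=> [|_ _ [u Du <-] [v Dv <-]|_ [u Du <-]]; first by exists 1.
        by exists (u * v); rewrite ?groupM.
      exists u^-1; rewrite ?groupV //; apply: (mulgI (f u)).
      by rewrite -fM !mulgV f1.
    have [v vE] := (FP _).1 (Fnorm _ g (Ff u)).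
    by exists v => //; apply: Dstab Du vE.
  + by move=> _ [u _ <-].
by exists T, N, chi; split=> //; exists t0.
Qed.

(** * Jordan-Hoelder theorem for series of shifts *)

Record epi_on (G : groupType) (D D' : set G) (T : finGroupType) (theta : G -> T) : Prop :=
  EpiOn {
    epi_M : forall x y, D x -> D y -> theta (x * y) = theta x * theta y;
    epi_surj : forall t, exists2 x, D x & theta x = t;
    epi_ker : forall x, D' x <-> D x /\ theta x = 1
  }.

Section JordanHolder.
Variables (G : groupType).

Record simple_series m (T : 'I_m -> finGroupType) (D : nat -> set G) : Prop :=
  SimpleSeries {
    ser_sub : forall i, i <= m -> is_subgroup (D i);
    ser_last : forall x, D m x -> x = 1;
    ser_simple : forall i, simple [set: T i];
    ser_epi : forall i : 'I_m, exists theta : G -> T i, epi_on (D i) (D i.+1) theta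
  }.

(** Induction from the bottom of the series: an element is coded by its image in the top factor,
    together with the code of its quotient by a chosen representative of that image. *)
Lemma simple_series_finite m (T : 'I_m -> finGroupType) (D : nat -> set G) :
  simple_series T D -> exists (Q : finType) (q : G -> Q),
    forall x y, D 0 x -> D 0 y -> q x = q y -> x = y.
Proof.
move=> [Dsub Dm _ Depi].
suff H k : k <= m -> exists (Q : finType) (q : G -> Q),
    forall x y, D (m - k) x -> D (m - k) y -> q x = q y -> x = y.
  by have := H m (leqnn m); rewrite subnn.
elim: k => [_|k IH ltkm].
  by exists unit, (fun=> tt) => x y; rewrite subn0 => /Dm-> /Dm->.
have [Q [q qP]] := IH (ltnW ltkm).
have ltm : m - k.+1 < m by rewrite ltn_subrL (leq_trans _ ltkm).
have [theta [thM thS thK]] := Depi (Ordinal ltm); rewrite /= in thM thS thK.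
have /choice[g gP] : forall t, exists x, D (m - k.+1) x /\ theta x = t.
  by move=> t; have [x] := thS t; exists x.
have Dk := Dsub _ (ltnW ltm).
exists (T (Ordinal ltm) * Q)%type, (fun x => (theta x, q ((g (theta x))^-1 * x))) => x y Dx Dy.
have DK z : D (m - k.+1) z -> D (m - k) ((g (theta z))^-1 * z).
  move=> Dz; have [Dg gE] := gP (theta z); have -> : (m - k = (m - k.+1).+1)%N by rewrite subnSK.
  apply/thK; split; first by apply: (subM Dk) => //; apply: (subV Dk).
  apply: (mulgI (theta z)); rewrite -{1}gE -thM ?mulVKg ?mulg1 //.
  by apply: (subM Dk) => //; apply: (subV Dk).
case=> thE /qP; rewrite thE => E.
by apply: (mulgI (g (theta y))^-1); apply: E; [rewrite -thE; exact: DK|exact: DK].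
Qed.

Lemma simple_series_comps m (T : 'I_m -> finGroupType) (D : nat -> set G)
    (F : finGroupType) (f : F -> G) :
  injective f -> {morph f : x y / x * y} -> (forall x, D 0 x <-> exists t, f t = x) ->
  simple_series T D ->
  exists l : seq {group F}, [/\ size l = m, comps [set: F]%G l &
    forall i : 'I_m, (nth 1%G ([set: F]%G :: l) i / nth 1%G ([set: F]%G :: l) i.+1) \isog [set: T i]].
Proof.
move=> finj fM D0 [Dsub Dm Tsimple Depi].
have f1 : f 1 = 1 by apply: (mulgI (f 1)); rewrite -fM !mulg1.
have fV : {morph f : x / x^-1}.
  by move=> x; apply: (mulgI (f x)); rewrite -fM !mulgV f1.
pose S i : {set F} := [set x | `[< D i (f x) >]]%SET.
have SP i x : x \in S i <-> D i (f x) by rewrite /S finset.in_set; split=> /asboolP.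
have Sg i : i <= m -> group_set (S i).
  move=> /Dsub Di; apply/group_setP; split; first by apply/SP; rewrite f1; apply: (sub1 Di).
  by move=> x y /SP Dx /SP Dy; apply/SP; rewrite fM; apply: (subM Di).
pose Sgp i : {group F} := insubd 1%G (S i).
have SgpE i : i <= m -> Sgp i :=: S i by move=> /Sg Si; rewrite /Sgp /insubd insubT.
have SgpP i x : i <= m -> x \in Sgp i <-> D i (f x) by move=> lei; rewrite SgpE //; exact: SP.
have step (i : 'I_m) : Sgp i.+1 <| Sgp i /\ (Sgp i / Sgp i.+1) \isog [set: T i].
  have lei := ltnW (ltn_ord i).
  have [theta [thM thS thK]] := Depi i.
  have thfM : {in Sgp i &, {morph theta \o f : x y / x * y}}.
    by move=> x y /(SgpP _ _ lei) Dx /(SgpP _ _ lei) Dy; rewrite /= fM thM.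
  pose phi := Morphism thfM.
  have kerE : 'ker phi = Sgp i.+1.
    apply/setP => x; apply/idP/idP.
      move=> /morphpreP[/(SgpP _ _ lei) Dx /set1gP th1].
      by apply/(SgpP _ _ (ltn_ord i))/thK.
    move=> /(SgpP _ _ (ltn_ord i)) Dx; have [Dx' th1] := (thK _).1 Dx.
    by apply/morphpreP; split; [apply/SgpP|apply/set1gP].
  have D0i : forall j, j <= i -> forall x, D j x -> D 0 x.
    elim=> // j IH ltji x; have ltjm := leq_trans ltji lei.
    have [th [_ _ K]] := Depi (Ordinal ltjm).
    by move=> /K[Dx _]; apply: IH => //; apply: ltnW.
  have imE : phi @* Sgp i = [set: T i].
    apply/setP => t; rewrite inE; have [x Dx <-] := thS t.
    have [z zE] := (D0 x).1 (D0i i (leqnn i) x Dx).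
    have Sz : z \in Sgp i by apply/SgpP; rewrite ?zE.
    by apply/morphimP; exists z; rewrite //= zE.
  split; first by rewrite -kerE ker_normal.
  by rewrite -kerE -imE; exact: first_isog.
exists [seq Sgp i.+1 | i <- iota 0 m]; rewrite size_map size_iota.
have S0 : Sgp 0 = [set: F]%G.
  apply/val_inj/setP => x; rewrite [RHS]inE.
  by apply/SgpP => //; apply/D0; exists x.
have nthE i : i <= m -> nth 1%G ([set: F]%G :: [seq Sgp i.+1 | i <- iota 0 m]) i = Sgp i.
  case: i => [_|i ltim]; first by rewrite S0.
  by rewrite /= (nth_map 0) ?size_iota // nth_iota.
split=> //; last by move=> i; rewrite !nthE // 1?ltnW //; exact: (step i).2.
apply/compsP; split.
  rewrite (last_nth 1%G) size_map size_iota nthE //; apply/trivGP.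
  by apply/fintype.subsetP => x /(SgpP _ _ (leqnn m))/Dm; rewrite -f1 => /finj ->; apply/set1gP.
apply/(pathP 1%G) => i; rewrite size_map size_iota => ltim.
have [nS isoS] := step (Ordinal ltim).
have -> : nth 1%G [seq Sgp i0.+1 | i0 <- iota 0 m] i = Sgp i.+1 by rewrite -(nthE i.+1).
rewrite /= nthE // 1?ltnW // -quotient_simple //.
by rewrite (isog_simple isoS).
Qed.

Theorem simple_series_uniq m (T : 'I_m -> finGroupType) (D : nat -> set G)
    m' (T' : 'I_m' -> finGroupType) (D' : nat -> set G) :
  simple_series T D -> simple_series T' D' -> (forall x, D 0 x <-> D' 0 x) ->
  m = m' /\ exists2 p : 'I_m -> 'I_m', bijective p &
    forall i, [set: T i]%G \isog [set: T' (p i)]%G.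
Proof.
move=> DT DT' DD'; have [Q [q qP]] := simple_series_finite DT.
have [F [f [finj fM fP]]] := finite_subgroup_model (ser_sub DT (leq0n m)) qP.
have [l [sz_l comp_l fac_l]] := simple_series_comps finj fM fP DT.
have [|l' [sz_l' comp_l' fac_l']] := simple_series_comps finj fM _ DT'.
  by move=> x; rewrite -DD'.
have := JordanHolderUniqueness comp_l comp_l'.
set S := mkfactors _ l; set S' := mkfactors _ l' => permS.
have szS : size S = m by rewrite size_map size_pairmap.
have szS' : size S' = m' by rewrite size_map size_pairmap.
have mm' : m = m' by rewrite -szS -szS' (perm_size permS).
split=> //.
pose x0 : section F := mkSec 1%G 1%G.
have nthS (l0 : seq {group F}) i : i < size l0 ->
    (nth x0 (mkfactors [set: F]%G l0) i : {group _}) \isog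
    (nth 1%G ([set: F]%G :: l0) i / nth 1%G ([set: F]%G :: l0) i.+1).
  move=> lti; rewrite (nth_map x0) ?size_pairmap // (nth_pairmap 1%G) //.
  exact: section_reprP.
(* Jordan-Hoelder yields two lists of representatives of the factors that are permutations of each
   other; the index list [Is] of this permutation is the map p. *)
have /(perm_iotaP x0)[Is permI SE] := permS.
have szI : size Is = m by rewrite -szS SE size_map.
have ltI (i : 'I_m) : nth 0 Is i < m'.
  have : nth 0 Is i \in Is by rewrite mem_nth ?szI.
  by rewrite (perm_mem permI) mem_iota add0n szS'.
pose p (i : 'I_m) := Ordinal (ltI i).
have pinj : injective p.
  move=> i j [] /eqP; rewrite nth_uniq ?szI // => [/eqP/val_inj //|].
  by rewrite (perm_uniq permI) iota_uniq.
exists p; first by apply: inj_card_bij; rewrite // !card_ord mm'.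
move=> i; apply: isog_trans (isog_trans _ (fac_l' (p i))).
  by rewrite isog_sym; exact: fac_l.
have H1 := nthS l i; rewrite sz_l in H1.
have H2 := nthS l' (p i); rewrite sz_l' in H2.
have := isog_trans _ (H2 (ltn_ord _)); apply.
rewrite isog_sym.
suff -> : nth x0 (mkfactors [set: F]%G l') (p i) = nth x0 (mkfactors [set: F]%G l) i.
  exact: H1.
by rewrite -/S -/S' SE (nth_map 0) ?szI.
Qed.

End JordanHolder.

(** * From a series of shifts to a series of finite groups *)

Section ShiftSeries.
Variables (G : groupType) (s : G -> G).
Hypothesis sM : {morph s : x y / x * y}.

Record shift_epi (A B : set G) (T : finGroupType) (rho : G -> nat -> T) : Prop := ShiftEpi {
  she_M : forall x y n, A x -> A y -> rho (x * y) n = rho x n * rho y n;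
  she_surj : forall t : nat -> T, exists2 x, A x & forall n, rho x n = t n;
  she_ker : forall x, B x <-> A x /\ forall n, rho x n = 1;
  she_shift : forall x n, A x -> rho (s x) n = rho x n.+1
}.

(** When A is the full shift on T, this is the copy of T in coordinate 0, whatever r is. *)
Definition theta_set r (A : set G) : set G :=
  fun y => exists x, [/\ A x, iter r.+1 s x = 1 & iter r s x = y].

(** For s-stable A this means s^r A = s^(r+1) A. Applied to the kernel B of [rho], it serves to
    correct by elements of B what is only known modulo B. *)
Definition iter_stable r (A : set G) : Prop :=
  forall x, A x -> exists2 y, A y & iter r.+1 s y = iter r s x.

Lemma theta_set_sub r A : is_subgroup A -> is_subgroup (theta_set r A).
Proof.
move=> Asub; split=> [|_ _ [x [Ax sx <-]] [y [Ay sy <-]]|_ [x [Ax sx <-]]].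
- by exists 1; rewrite !(iter_endo1 sM); split=> //; apply: (sub1 Asub).
- by exists (x * y); rewrite !(iter_endoM sM) sx sy mulg1; split=> //; apply: (subM Asub).
- by exists x^-1; rewrite !(iter_endoV sM) sx invg1; split=> //; apply: (subV Asub).
Qed.

Variables (A B : set G) (T : finGroupType) (rho : G -> nat -> T).
Hypotheses (Asub : is_subgroup A) (Bsub : is_subgroup B).
Hypotheses (As : forall x, A x -> A (s x)) (Bs : forall x, B x -> B (s x)).
Hypothesis rhoP : shift_epi A B rho.

Let rhoM := she_M rhoP.
Let rho1 n : rho 1 n = 1.
Proof.
by apply: (mulgI (rho 1 n)); rewrite -rhoM ?mulg1 //; apply: (sub1 Asub).
Qed.
Let rhoV x n : A x -> rho x^-1 n = (rho x n)^-1.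
Proof.
move=> Ax; apply: (mulgI (rho x n)); rewrite -rhoM ?mulgV ?rho1 //.
exact: (subV Asub).
Qed.
Let eq_rho x y : A x -> A y -> (forall n, rho x n = rho y n) -> B (x^-1 * y).
Proof.
move=> Ax Ay xy; have AV := subV Asub Ax; apply/(she_ker rhoP); split; first exact: (subM Asub).
by move=> n; rewrite rhoM // rhoV // xy mulVg.
Qed.
Let A_iter n x : A x -> A (iter n s x).
Proof. by elim: n => //= n IH /IH/As. Qed.
Let rho_iter n x k : A x -> rho (iter n s x) k = rho x (n + k).
Proof.
elim: n k => // n IH k Ax; rewrite iterS (she_shift rhoP) ?IH ?addnS //.
exact: A_iter.
Qed.

(** The shift is onto on A / B, so x is s y times an element of B, to which the hypothesis
    applies. *)
Lemma shift_iter_stable r : iter_stable r B -> iter_stable r A.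
Proof.
move=> PB x Ax; have [y Ay yE] := she_surj rhoP (fun n => if n is n'.+1 then rho x n' else 1).
have [|z Bz zE] := PB ((s y)^-1 * x).
  by apply: eq_rho => // [|n]; rewrite ?(she_shift rhoP) ?yE //; apply: As.
have [Az _] := (she_ker rhoP z).1 Bz.
exists (y * z); first exact: (subM Asub).
by rewrite (iter_endoM sM) zE iterSr -(iter_endoM sM) mulVKg.
Qed.

(* The image of A :&: ker s^r in the shift A / B consists of the sequences that
   vanish from some index j on, so the coordinate j identifies the quotient with T. *)
Lemma theta_epi r : simple [set: T] -> iter_stable r B ->
  exists theta : G -> T, epi_on (theta_set r A) (theta_set r B) theta.
Proof.
move=> Tsimple PB.
have [TN1 Tmin] := simpleP _ Tsimple.
pose Kr e := exists x, [/\ A x, iter r s x = 1 & forall n, rho x n = e n].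
have Kr_ext e e' : (forall n, e n = e' n) -> Kr e -> Kr e'.
  by move=> ee' [x [Ax sx xE]]; exists x; split=> // n; rewrite xE.
have Kr1 : Kr (fun=> 1).
  by exists 1; rewrite (iter_endo1 sM); split=> //; apply: (sub1 Asub).
have KrM e e' : Kr e -> Kr e' -> Kr (fun n => e n * e' n).
  move=> [x [Ax sx xE]] [y [Ay sy yE]]; exists (x * y).
  rewrite (iter_endoM sM) sx sy mulg1; split=> // [|n]; first exact: (subM Asub).
  by rewrite rhoM // xE yE.
have KrV e : Kr e -> Kr (fun n => (e n)^-1).
  move=> [x [Ax sx xE]]; exists x^-1.
  rewrite (iter_endoV sM) sx invg1; split=> // [|n]; first exact: (subV Asub).
  by rewrite rhoV // xE.
have KrJ e t : Kr e -> Kr (fun n => e n ^ t n).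
  move=> [x [Ax sx xE]]; have [y Ay yE] := she_surj rhoP t; exists (x ^ y).
  rewrite /conjg !(iter_endoM sM) sx mul1g (iter_endoV sM) mulVg.
  have AV := subV Asub Ay; have AM := subM Asub Ax Ay.
  by split=> // [|n]; [exact: (subM Asub)|rewrite !rhoM // rhoV // xE yE].
have Krs e : Kr e -> Kr (fun n => e n.+1).
  move=> [x [Ax sx xE]]; exists (s x); rewrite -iterSr iterS sx (endo1 sM).
  by split=> // [|n]; [exact: As|rewrite (she_shift rhoP) // xE].
have Krsn k e : Kr e -> Kr (fun n => e (k + n)).
  by elim: k e => [|k IH] e Ke //; apply: Kr_ext (IH _ (Krs _ Ke)).
have Kr_end e n : Kr e -> r <= n -> e n = 1.
  move=> [x [Ax sx <-]] lern; rewrite -(subnKC lern) -rho_iter // sx.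
  exact: rho1.
have ex_j : exists j, `[< forall e, Kr e -> forall n, j <= n -> e n = 1 >].
  by exists r; apply/asboolP => e Ke n; apply: Kr_end.
case: (ex_minnP ex_j) => j /asboolP jP jmin.
(* The last possibly nontrivial coordinates of elements of Kr form a normal subgroup of T,
   nontrivial by minimality of j, hence T by simplicity. Shifting moves that coordinate to i. *)
have full_step i t : i < j -> exists2 e, Kr e & e i = t /\ forall n, i < n -> e n = 1.
  case: j jP jmin => // j jP jmin; rewrite ltnS => leij.
  pose D : {set T} := [set u | `[< exists2 e, Kr e & e j = u >]]%SET.
  have DP u : u \in D <-> exists2 e, Kr e & e j = u.
    by rewrite /D finset.in_set; split=> /asboolP.
  have Dg : group_set D.
    apply/group_setP; split=> [|_ _ /DP[e Ke <-] /DP[e' Ke' <-]].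
      by apply/DP; exists (fun=> 1).
    by apply/DP; exists (fun n => e n * e' n) => //; apply: KrM.
  have /(Tmin (Group Dg))[D1|DT] : D <| [set: T].
  - rewrite /normal finset.subsetT; apply/fintype.subsetP => t' _; rewrite inE.
    apply/fintype.subsetP => _ /imsetP[_ /DP[e Ke <-] ->].
    by apply/DP; exists (fun n => e n ^ t') => //; apply: (KrJ e (fun=> t')).
  - have : j.+1 <= j by apply: jmin; apply/asboolP => e Ke n; rewrite leq_eqVlt
      => /predU1P[<-|/(jP e Ke)//]; have : e j \in D by [apply/DP; exists e];
      rewrite [D]D1 inE => /eqP.
    by rewrite ltnn.
  have /DP[e Ke <-] : t \in D by rewrite [D]DT inE.
  exists (fun n => e (j - i + n)); first exact: Krsn.
  rewrite subnK //; split=> // n ltin; apply: jP => //.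
  by rewrite -[X in X < _](subnK leij) ltn_add2l.
have full i e : i <= j -> (forall n, i <= n -> e n = 1) -> Kr e.
  elim: i e => [|i IH] e lei e1.
    by apply: Kr_ext Kr1 => n; rewrite e1.
  have [e' Ke' [e'i e'1]] := full_step i (e i) lei.
  apply: (@Kr_ext (fun n => e' n * ((e' n)^-1 * e n))) => [n|]; first by rewrite mulVKg.
  apply: KrM => //; apply: IH => [|n]; first exact: ltnW.
  rewrite leq_eqVlt => /predU1P[<-|ltin]; first by rewrite e'i mulVg.
  by rewrite e'1 // e1 // invg1 mulg1.
pose dom x := A x /\ iter r.+1 s x = 1.
have dom_end x n : dom x -> j <= n -> rho x n.+1 = 1.
  move=> [Ax sx] lejn; apply: (jP (fun n => rho x n.+1)) => //.
  exists (s x); split; [exact: As|by rewrite -iterSr|].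
  by move=> k; rewrite (she_shift rhoP).
pose pre y := xget 1 [set x | dom x /\ iter r s x = y].
have preP y : theta_set r A y -> dom (pre y) /\ iter r s (pre y) = y.
  by move=> [x [Ax sx xE]]; rewrite /pre; case: xgetP => // /(_ x)[].
(* On [dom] the sequence rho x vanishes after j, because s x is killed by s^r. Two elements of [dom]
   with the same image under s^r differ by an element of ker s^r, whose coordinate j is 1, so the
   choice made by [pre] does not matter. *)
exists (fun y => rho (pre y) j).
have thetaE x : dom x -> rho (pre (iter r s x)) j = rho x j.
  move=> dx; have [Ax sx] := dx.
  have [|[Ap sp] pE] := preP (iter r s x); first by exists x.
  have : rho ((pre (iter r s x))^-1 * x) j = 1.
    apply: (jP (rho ((pre (iter r s x))^-1 * x))) => //.
    exists ((pre (iter r s x))^-1 * x); split=> //.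
      by apply: (subM Asub) => //; apply: (subV Asub).
    by rewrite (iter_endoM sM) (iter_endoV sM) pE mulVg.
  rewrite rhoM ?rhoV //; last exact: (subV Asub).
  exact: mulVg_eq1.
split.
- move=> _ _ [x [Ax sx <-]] [y [Ay sy <-]].
  rewrite -(iter_endoM sM) !thetaE ?rhoM //; split; first exact: (subM Asub).
  by rewrite (iter_endoM sM) sx sy mulg1.
- move=> t; have [x Ax xE] := she_surj rhoP (fun n => if n == j then t else 1).
  (* x has the right coordinate j but need not be killed by s^(r+1). Modulo B, s x agrees with some
     h in ker s^r; the discrepancy h^-1 s x in B has the same image under s^r as some s z with z in
     B, and x z^-1 is killed. *)
  have [h [Ah sh hE]] : Kr (fun n => rho x n.+1).
    apply: (full j) => // n lejn; rewrite xE gtn_eqF //.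
  have [|z Bz zE] := PB (h^-1 * s x).
    apply: eq_rho => // [|n]; first exact: As.
    by rewrite hE (she_shift rhoP).
  have [Az z1] := (she_ker rhoP z).1 Bz.
  have dxz : dom (x * z^-1).
    have AV := subV Asub Az; split; first exact: (subM Asub).
    rewrite (iter_endoM sM) (iter_endoV sM) zE (iter_endoM sM) (iter_endoV sM) sh.
    by rewrite invg1 mul1g iterSr mulgV.
  exists (iter r s (x * z^-1)); first by exists (x * z^-1); case: dxz.
  by rewrite thetaE // rhoM ?rhoV // ?z1 ?xE ?eqxx ?invg1 ?mulg1 //; apply: (subV Asub).
- move=> y; split=> [[x [Bx sx <-]]|[[x [Ax sx <-]]]].
    have [Ax x1] := (she_ker rhoP x).1 Bx; split; first by exists x.
    by rewrite thetaE.
  (* With coordinate j trivial, rho x vanishes from j on, so dividing x by an element h of ker s^r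
     brings it into B without changing s^r x. *)
  rewrite thetaE // => xj; have [h [Ah sh hE]] : Kr (rho x).
    apply: (full j) => // n; rewrite leq_eqVlt => /predU1P[<- //|].
    by case: n => // n; rewrite ltnS => /dom_end; apply.
  exists (h^-1 * x); split.
  - by apply: eq_rho.
  - by rewrite (iter_endoM sM) (iter_endoV sM) sx iterS sh (endo1 sM) invg1 mulg1.
  - by rewrite (iter_endoM sM) (iter_endoV sM) sh invg1 mul1g.
Qed.

End ShiftSeries.

Record shift_series (G : groupType) (s : G -> G) m (T : 'I_m -> finGroupType)
    (H : nat -> set G) : Prop := ShiftSeries {
  shser_sub : forall i, i <= m -> is_subgroup (H i);
  shser_stable : forall i, i <= m -> forall x, H i x -> H i (s x);
  shser_simple : forall i, simple [set: T i];
  shser_epi : forall i : 'I_m, exists rho : G -> nat -> T i, shift_epi s (H i) (H i.+1) rho;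
  shser_last : exists r, forall x, H m x -> iter r s x = 1
}.

Lemma shift_series_theta (G : groupType) (s : G -> G) (sM : {morph s : x y / x * y})
    m (T : 'I_m -> finGroupType) (H : nat -> set G) : shift_series s T H ->
  exists r0, forall r, r0 <= r -> simple_series T (fun i => theta_set s r (H i)).
Proof.
move=> [Hsub Hs Tsimple Hepi [r0 Hlast]]; exists r0 => r ler.
have last1 x : H m x -> iter r s x = 1.
  by move=> /Hlast sx; rewrite -(subnK ler) iterD sx (iter_endo1 sM).
have stab k : k <= m -> iter_stable s r (H (m - k)).
  elim: k => [_ x|k IH ltkm].
    by rewrite subn0 => /last1 ->; exists 1; rewrite ?(iter_endo1 sM) //; apply: (sub1 (Hsub _ _)).
  have ltm : m - k.+1 < m by rewrite ltn_subrL (leq_trans _ ltkm).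
  have [rho] := Hepi (Ordinal ltm); rewrite /= subnSK // => rhoP.
  apply: (shift_iter_stable sM _ _ rhoP); last exact: (IH (ltnW ltkm)).
    by apply: Hsub; rewrite leq_subr.
  by apply: Hs; rewrite leq_subr.
split=> // [i /Hsub|_ [x [/last1 -> _ <-]]|i] //; first exact: theta_set_sub.
have lti := ltn_ord i; have [rho rhoP] := Hepi i.
apply: (theta_epi sM _ _ rhoP) => //; [exact: Hsub (ltnW _)|exact: Hs (ltnW _)|].
by have := stab (m - i.+1) (leq_subr _ _); rewrite subKn.
Qed.

Theorem shift_series_uniq (G : groupType) (s : G -> G) m (T : 'I_m -> finGroupType)
    (H : nat -> set G) m' (T' : 'I_m' -> finGroupType) (H' : nat -> set G) :
  {morph s : x y / x * y} ->
  shift_series s T H -> shift_series s T' H' -> (forall x, H 0 x <-> H' 0 x) ->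
  m = m' /\ exists2 p : 'I_m -> 'I_m', bijective p &
    forall i, [set: T i]%G \isog [set: T' (p i)]%G.
Proof.
move=> sM /(shift_series_theta sM)[r rP] /(shift_series_theta sM)[r' r'P] HH'.
apply: simple_series_uniq (rP _ (leq_maxl r r')) (r'P _ (leq_maxr r r')) _ => x.
by split=> -[y [/HH' Hy sy yE]]; exists y.
Qed.

Local Close Scope group_scope.
Import GRing.Theory.
Local Open Scope ring_scope.

(** * Galois theory inside an ambient field *)

Section DivringOf.
Variables (W : fieldType) (P : set W).
Hypotheses (P1 : P 1) (PB : forall x y, P x -> P y -> P (x - y))
  (PF : forall x y, P x -> P y -> P (x / y)).

Definition divring_pred of P 1 & (forall x y, P x -> P y -> P (x - y)) &
  (forall x y, P x -> P y -> P (x / y)) : {pred W} := fun x => `[< P x >].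
Local Notation S := (divring_pred P1 PB PF).

Fact divring_pred_closed : divring_closed S.
Proof.
split=> [|x y /asboolP Px /asboolP Py|x y /asboolP Px /asboolP Py]; apply/asboolP; auto.
Qed.

HB.instance Definition _ := GRing.isDivringClosed.Build W S divring_pred_closed.

Lemma divring_of : exists M : divringClosed W, forall x, x \in M <-> P x.
Proof. by exists (GRing.DivringClosed.clone W S _) => x; split=> /asboolP. Qed.

End DivringOf.

Lemma minimal_irreducible (F V : fieldType) (iota : {rmorphism F -> V}) x :
  algebraicOver iota x ->
  exists2 p : {poly F}, irreducible_poly p & root (map_poly iota p) x.
Proof.
move=> [p0 p0N0 rp0].
pose good n := `[< exists p : {poly F}, [/\ p != 0, root (map_poly iota p) x & size p = n] >].
have ex_good : exists n, good n by exists (size p0); apply/asboolP; exists p0.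
case: (ex_minnP ex_good) => n /asboolP[p [pN0 rp sz_p]] nmin.
have pmin q : q != 0 -> root (map_poly iota q) x -> (size p <= size q)%N.
  by move=> qN0 rq; rewrite sz_p; apply: nmin; apply/asboolP; exists q.
exists p => //; split.
  rewrite ltnNge; apply/negP => /size1_polyC pE.
  by move: rp pN0; rewrite pE map_polyC rootC fmorph_eq0 polyC_eq0 => ->.
move=> q szq /dvdpP[q' pE].
have qN0 : q != 0 by apply: contraNneq pN0 => q0; rewrite pE q0 mulr0.
have q'N0 : q' != 0 by apply: contraNneq pN0 => q0; rewrite pE q0 mul0r.
move: rp; rewrite pE rmorphM rootM => /orP[] /pmin le.
  have := le q'N0; rewrite pE size_mul //.
  case: (size q) szq (size_poly_eq0 q) => [|[|k]] //; rewrite ?(negPf qN0) //.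
  by rewrite !addnS /= ltnNge leq_addr.
have pq : q %| p by rewrite pE dvdp_mull.
by rewrite -pE -(dvdp_size_eqp pq) eqn_leq (dvdp_leq pN0 pq) le.
Qed.

Section GaloisChar.
Variable W : fieldType.
Implicit Types (F E : divringClosed W).

Lemma insubE F (x : W) : x \in F -> val (insubd (0 : subfield F) x) = x.
Proof. exact: insubdK. Qed.

Lemma polyOver_map F (q : {poly W}) : q \is a polyOver F ->
  exists p : {poly subfield F}, map_poly val p = q.
Proof.
move=> /polyOverP qF; exists (\poly_(i < size q) insubd (0 : subfield F) q`_i).
apply/polyP => i; rewrite coef_map coef_poly; case: ltnP => [_|/(nth_default 0) ->].
  exact: insubE.
exact: rmorph0.
Qed.

Lemma map_polyOver F (p : {poly subfield F}) : map_poly val p \is a polyOver F.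
Proof. by apply/polyOverP => i; rewrite coef_map; exact: subfield_valP. Qed.

(** The working form of [galois_ext]: the polynomial need not be irreducible, so the condition
    passes at once to larger base fields. *)
Definition galois_char F E : Prop :=
  {subset F <= E} /\ forall a, a \in E -> exists rs : seq W,
    [/\ uniq rs, {subset rs <= E}, a \in rs & \prod_(r <- rs) ('X - r%:P) \is a polyOver F].

Lemma irredp_dvd_root (F V : fieldType) (iota : {rmorphism F -> V}) (p q : {poly F}) x :
  irreducible_poly p -> root (map_poly iota p) x -> root (map_poly iota q) x -> p %| q.
Proof.
move=> irr_p rp rq; have [coq|ncoq] := boolP (coprimep p q).
  by have := coprimep_root (etrans (coprimep_map iota p q) coq) rp; rewrite rootE in rq; rewrite rq.
have /(apply_irredp irr_p) : size (gcdp p q) != 1 by move: ncoq; rewrite /coprimep.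
by move=> /(_ (dvdp_gcdl p q))/eqp_dvdl <-; apply: dvdp_gcdr.
Qed.

Lemma galois_minimal F E a : galois_ext F E -> a \in E -> exists rs : seq W,
  [/\ uniq rs, {subset rs <= E}, a \in rs, \prod_(r <- rs) ('X - r%:P) \is a polyOver F &
   forall q, q \is a polyOver F -> root q a -> {in rs, forall r, root q r}].
Proof.
move=> [FE [_ normE] [algE sepE]] aE.
have [p irr_p rpa] := minimal_irreducible (algE a aE).
have [|rs rsE prs] := normE p irr_p; first by exists a.
have sep_p : separable_poly p by apply: sepE => //; exists a.
exists rs; split=> //.
- rewrite -separable_prod_XsubC -(eqp_separable prs).
  by rewrite separable_map.
- by rewrite -root_prod_XsubC -(eqp_root prs).
- have pN0 : map_poly val p != 0 by rewrite map_poly_eq0 irredp_neq0.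
  have -> : \prod_(r <- rs) ('X - r%:P) = (lead_coef (map_poly val p))^-1 *: map_poly val p.
    have pE := eqpfP prs; rewrite (monicP (monic_prod_XsubC _ _ _)) divr1 in pE.
    by rewrite {2}pE scalerA mulVf ?scale1r // lead_coef_eq0.
  rewrite lead_coef_map -fmorphV -map_polyZ; exact: map_polyOver.
- move=> q /polyOver_map[q' <-] rq r rrs.
  have pq := irredp_dvd_root irr_p rpa rq.
  have /root_dvdp : map_poly val p %| map_poly val q' by rewrite dvdp_map.
  by apply; rewrite (eqp_root prs) root_prod_XsubC.
Qed.

Lemma galois_charP F E : galois_ext F E <-> galois_char F E.
Proof.
split=> [FE|[FE charE]].
  split=> [|a aE]; first by case: FE.
  by have [rs [rs1 rs2 rs3 rs4 _]] := galois_minimal FE aE; exists rs.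
have P a : a \in E -> exists rs q, [/\ uniq rs, {subset rs <= E}, a \in rs &
    map_poly (val : subfield F -> W) q = \prod_(r <- rs) ('X - r%:P)].
  by move=> /charE[rs [rs1 rs2 rs3 /polyOver_map[q qE]]]; exists rs, q.
have algE : algebraic_ext F E.
  move=> x /P[rs [q [_ _ xrs qE]]]; exists q.
    by rewrite -(map_poly_eq0 (val : subfield F -> W)) qE monic_neq0 ?monic_prod_XsubC.
  by rewrite qE root_prod_XsubC.
(* An irreducible p with a root in E divides a polynomial with distinct roots, all in E, which makes
   p split and separable at the same time. *)
have dvd p x : irreducible_poly p -> x \in E -> root (map_poly val p) x ->
    exists rs q, [/\ uniq rs, {subset rs <= E}, p %| q &
      map_poly (val : subfield F -> W) q = \prod_(r <- rs) ('X - r%:P)].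
  move=> irr_p /P[rs [q [urs rsE xrs qE]]] rpx; exists rs, q; split=> //.
  by apply: (irredp_dvd_root irr_p rpx); rewrite qE root_prod_XsubC.
split=> //; split=> // p irr_p [x xE rpx]; have [rs [q [urs rsE pq qE]]] := dvd p x irr_p xE rpx.
  have : map_poly val p %| map_poly (val : subfield F -> W) q by rewrite dvdp_map.
  rewrite qE => /(@dvdp_prod_XsubC _ _ rs id)[m pm].
  by exists (mask m rs) => // r /mem_mask/rsE.
apply: dvdp_separable pq _; rewrite -(separable_map (val : subfield F -> W)) qE.
by rewrite separable_prod_XsubC.
Qed.

Lemma galois_tower F F' E : galois_ext F E -> {subset F <= F'} -> {subset F' <= E} ->
  galois_ext F' E.
Proof.
move=> /galois_charP[FE charE] FF' F'E; apply/galois_charP; split=> // a /charE[rs [? ? ? H]].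
by exists rs; split=> //; apply: polyOverS H.
Qed.

End GaloisChar.

Section RmorphismOf.
Variables (A B : pzRingType) (f : A -> B).
Hypotheses (fB : {morph f : x y / x - y}) (f1 : f 1 = 1) (fM : {morph f : x y / x * y}).

Definition rmorphism_fun of {morph f : x y / x - y} & f 1 = 1 & {morph f : x y / x * y} :
  A -> B := f.
Local Notation g := (rmorphism_fun fB f1 fM).

HB.instance Definition _ := GRing.isZmodMorphism.Build A B g fB.
HB.instance Definition _ := GRing.isMonoidMorphism.Build A B g (conj f1 fM).

Lemma rmorphism_of : exists h : {rmorphism A -> B}, h =1 f.
Proof. by exists (GRing.RMorphism.clone A B g _). Qed.

End RmorphismOf.

(** Removing the powers of X from a polynomial that vanishes at x leaves q = h X + c with c nonzero,
    so z^-1 = - h(z) / c at every root z of q. One h serves all conjugates; with it, closure under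
    inverses follows from closure under ring operations. *)
Lemma inverse_polynomial (W : fieldType) (F E : divringClosed W) x :
  galois_ext F E -> x \in E -> x != 0 -> exists q h : {poly W},
    [/\ q \is a polyOver F, h \is a polyOver F, q.[x] = 0 &
      forall z, q.[z] = 0 -> z^-1 = h.[z]].
Proof.
move=> FE xE xN0; have [_ charE] := (galois_charP F E).1 FE.
have [rs [_ _ xrs /polyOverP PF]] := charE x xE.
set P := \prod_(r <- rs) _ in PF.
have [m [q qN0 qE]] := multiplicity_XsubC P 0; rewrite subr0 in qE.
have PN0 : P != 0 by rewrite monic_neq0 ?monic_prod_XsubC.
rewrite PN0 /= in qN0.
have qF i : q`_i \in F by have := PF (i + m)%N; rewrite qE coefMXn ltnNge leq_addl /= addnK.
have qx : q.[x] = 0.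
  have : root P x by rewrite root_prod_XsubC.
  rewrite qE rootM => /orP[/rootP //|/rootP].
  by rewrite hornerXn => /eqP; rewrite expf_eq0 (negPf xN0) andbF.
pose h := \poly_(i < size q) q`_i.+1.
have hF : h \is a polyOver F.
  by apply/polyOverP => i; rewrite coef_poly; case: ifP => // _; exact: rpred0.
have qhE : q = h * 'X + (q`_0)%:P.
  apply/polyP => -[|i]; rewrite coefD coefMX coefC /= ?add0r // addr0 coef_poly.
  by case: ltnP => // /leqW/(nth_default 0).
have cN0 : q`_0 != 0 by move: qN0; rewrite rootE horner_coef0.
exists q, (- (q`_0)^-1 *: h); split=> // [||z]; first exact/polyOverP.
  by apply: polyOverZ => //; rewrite rpredN rpredV.
rewrite {1}qhE !hornerE => /eqP; rewrite addr_eq0 => /eqP hz.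
have zN0 : z != 0.
  by apply: contra_neq cN0 => z0; apply: oppr_inj; rewrite -hz z0 mulr0 oppr0.
by apply: (mulIf zN0); rewrite mulVf // -mulrA hz mulrN mulNr opprK mulVf.
Qed.

(** * Extension of partial embeddings to automorphisms *)

Section PartialAutomorphisms.
Variables (W : fieldType) (F E : divringClosed W).
Hypothesis FE : galois_ext F E.
Implicit Types (R : set (W * W)) (x y : W).

(* Graphs of embeddings into E, over F, of intermediate fields. *)
Record pgraph R : Prop := PGraph {
  pg_base : forall c, c \in F -> R (c, c);
  pg_in : forall x y, R (x, y) -> x \in E /\ y \in E;
  pg_sub : forall x y x' y', R (x, y) -> R (x', y') -> R (x - x', y - y');
  pg_mul : forall x y x' y', R (x, y) -> R (x', y') -> R (x * x', y * y');
  pg_inv : forall x y, R (x, y) -> R (x^-1, y^-1);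
  pg_fun : forall y, R (0, y) -> y = 0
}.

Definition ppoly R (u v : {poly W}) : Prop := forall i, R (u`_i, v`_i).

Section Pgraph.
Variable R : set (W * W).
Hypothesis Rp : pgraph R.

Lemma pg_zero : R (0, 0).
Proof. by apply: (pg_base Rp); exact: rpred0. Qed.

Lemma pg_add x y x' y' : R (x, y) -> R (x', y') -> R (x + x', y + y').
Proof.
move=> Rx Rx'; rewrite -[x']opprK -[y']opprK; apply: (pg_sub Rp) => //.
by rewrite -[- x']add0r -[- y']add0r; apply: (pg_sub Rp) => //; apply: pg_zero.
Qed.

Lemma pg_eq x y y' : R (x, y) -> R (x, y') -> y = y'.
Proof.
move=> Rxy Rxy'; apply/eqP; rewrite -subr_eq0; apply/eqP; apply: (pg_fun Rp).
by rewrite -(subrr x); apply: (pg_sub Rp).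
Qed.

Lemma ppoly_base p : p \is a polyOver F -> ppoly R p p.
Proof. by move=> /polyOverP pF i; apply: (pg_base Rp). Qed.

Lemma ppoly_sub u v u' v' : ppoly R u v -> ppoly R u' v' -> ppoly R (u - u') (v - v').
Proof. by move=> Ru Ru' i; rewrite !coefB; apply: (pg_sub Rp). Qed.

Lemma ppoly_mul u v u' v' : ppoly R u v -> ppoly R u' v' -> ppoly R (u * u') (v * v').
Proof.
move=> Ru Ru' i; rewrite !coefM; apply: (big_ind2 (fun x y => R (x, y))) => [|x y x' y'|j _].
- exact: pg_zero.
- exact: pg_add.
- exact: (pg_mul Rp).
Qed.

Lemma ppolyC x y : R (x, y) -> ppoly R x%:P y%:P.
Proof. by move=> Rx i; rewrite !coefC; case: eqP => // _; apply: pg_zero. Qed.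

Lemma ppoly_in u v : ppoly R u v -> u \is a polyOver E /\ v \is a polyOver E.
Proof. by move=> Ru; split; apply/polyOverP => i; have [] := pg_in Rp (Ru i). Qed.

End Pgraph.

(** The extension of the embedding R by a |-> b: v is the image of the polynomial u under R. *)
Definition gadj R a b : set (W * W) :=
  fun xy => exists u v, [/\ ppoly R u v, xy.1 = u.[a] & xy.2 = v.[b]].

Lemma gadj_pgraph R a b : pgraph R -> a \in E -> b \in E ->
  (forall u v, ppoly R u v -> u.[a] = 0 -> v.[b] = 0) ->
  [/\ pgraph (gadj R a b), forall xy, R xy -> gadj R a b xy & gadj R a b (a, b)].
Proof.
move=> Rp aE bE ab; set S := gadj R a b.
have SR xy : R xy -> S xy.
  case: xy => x y Rx; exists x%:P, y%:P; rewrite !hornerC; split=> //; exact: ppolyC.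
have Sab : S (a, b).
  exists 'X, 'X; rewrite !hornerX; split=> //.
  by apply: (ppoly_base Rp); exact: polyOverX.
have S0 : S (0, 0) by apply: SR; apply: pg_zero.
have Sin x y : S (x, y) -> x \in E /\ y \in E.
  by move=> [u [v [/(ppoly_in Rp)[uE vE] /= -> ->]]]; split; apply: rpred_horner.
have Sdiff x y x' y' : S (x, y) -> S (x', y') -> S (x - x', y - y').
  move=> [u [v [Ru /= -> ->]]] [u' [v' [Ru' /= -> ->]]].
  by exists (u - u'), (v - v'); rewrite /= !hornerE; split=> //; apply: ppoly_sub.
have Smul x y x' y' : S (x, y) -> S (x', y') -> S (x * x', y * y').
  move=> [u [v [Ru /= -> ->]]] [u' [v' [Ru' /= -> ->]]].
  by exists (u * u'), (v * v'); rewrite /= !hornerM; split=> //; apply: ppoly_mul.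
have Sfun y : S (0, y) -> y = 0 by move=> [u [v [Ru /= u0 ->]]]; apply: ab Ru _.
have Sadd x y x' y' : S (x, y) -> S (x', y') -> S (x + x', y + y').
  move=> Sx Sx'; rewrite -[x']opprK -[y']opprK; apply: (Sdiff) => //.
  by rewrite -[- x']add0r -[- y']add0r; apply: (Sdiff _ _ _ _ S0).
have Sbase c : c \in F -> S (c, c) by move=> /(pg_base Rp)/SR.
have Sexp x y n : S (x, y) -> S (x ^+ n, y ^+ n).
  by move=> Sx; elim: n => [|n IH]; rewrite ?exprS; [apply: Sbase; apply: rpred1|apply: Smul].
have Shorner f x y : f \is a polyOver F -> S (x, y) -> S (f.[x], f.[y]).
  move=> /polyOverP fF Sx; rewrite !horner_coef.
  apply: (big_ind2 (fun x y => S (x, y))) => // i _.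
  by apply: Smul; [exact: Sbase|exact: Sexp].
split=> //; split=> // x y Sx.
have [x0|xN0] := eqVneq x 0.
  by move: Sx; rewrite x0 => /Sfun ->; rewrite invr0.
have [q [h [qF hF qx inv]]] := inverse_polynomial FE (Sin _ _ Sx).1 xN0.
have qy : q.[y] = 0 by apply: Sfun; rewrite -qx; apply: Shorner.
by rewrite (inv x) // (inv y) //; apply: Shorner.
Qed.

(** Let p be the minimal polynomial of a over the domain of R. It divides a polynomial over F that
    splits in E and is fixed by the embedding, so the image of p has a root b in E, and a |-> b is
    admissible. *)
Lemma pgraph_step R a : pgraph R -> a \in E -> exists b S,
  [/\ pgraph S, forall xy, R xy -> S xy & S (a, b)].
Proof.
move=> Rp aE.
have [|||D DP] := @divring_of W (fun x => exists y, R (x, y)).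
- by exists 1; apply: (pg_base Rp); apply: rpred1.
- by move=> x x' [y Ry] [y' Ry']; exists (y - y'); apply: (pg_sub Rp).
- by move=> x x' [y Ry] [y' Ry']; exists (y / y'); apply: (pg_mul Rp) => //; apply: (pg_inv Rp).
pose phi0 (x : subfield D) : W := xget 0 [set y | R (val x, y)].
have phi0P (x : subfield D) : R (val x, phi0 x).
  by rewrite /phi0; case: xgetP => // nex; have [y /nex] := (DP _).1 (subfield_valP x).
have phi0E (x : subfield D) y : R (val x, y) -> phi0 x = y by apply: (pg_eq Rp).
have [|||phi phiE] := @rmorphism_of (subfield D) W phi0.
- by move=> x y; apply: phi0E; apply: (pg_sub Rp).
- by apply: phi0E; apply: (pg_base Rp); apply: rpred1.
- by move=> x y; apply: phi0E; apply: (pg_mul Rp).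
have FD : {subset F <= D} by move=> c cF; apply/DP; exists c; apply: (pg_base Rp).
have [_ charE] := (galois_charP F E).1 FE.
have [rs [urs rsE ars PF]] := charE a aE.
have [P' P'E] := polyOver_map (polyOverS FD PF).
have phiP' : map_poly phi P' = \prod_(r <- rs) ('X - r%:P).
  apply/polyP => i; rewrite coef_map /= phiE; apply: phi0E.
  have -> : val P'`_i = (\prod_(r <- rs) ('X - r%:P))`_i by rewrite -P'E coef_map.
  by apply: (pg_base Rp); apply/polyOverP.
have [|p irr_p rpa] := @minimal_irreducible _ _ (val : subfield D -> W) a.
  exists P'; last by rewrite P'E root_prod_XsubC.
  by rewrite -(map_poly_eq0 (val : subfield D -> W)) P'E monic_neq0 ?monic_prod_XsubC.
have pP' : p %| P' by apply: (irredp_dvd_root irr_p rpa); rewrite P'E root_prod_XsubC.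
have : map_poly phi p %| map_poly phi P' by rewrite dvdp_map.
rewrite phiP' => /(@dvdp_prod_XsubC _ _ rs id)[m pm].
case mrsE : (mask m rs) pm => [|b l] pm.
  have := irr_p.1; rewrite -(size_map_poly phi) (eqp_size pm) big_nil size_poly1.
  by rewrite ltnn.
have brs : b \in rs by apply: (@mem_mask _ b m); rewrite mrsE mem_head.
have rpb : root (map_poly phi p) b by rewrite (eqp_root pm) root_prod_XsubC mem_head.
have [|||Sp RS Sab] := @gadj_pgraph R a b Rp.
- by [].
- exact: rsE.
- move=> u v Ruv ua.
  have [|u' u'E] := @polyOver_map W D u.
    by apply/polyOverP => i; apply/DP; exists v`_i.
  have vE : v = map_poly phi u'.
    apply/polyP => i; rewrite coef_map /= phiE; symmetry; apply: phi0E.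
    by have -> : val u'`_i = u`_i by rewrite -u'E coef_map.
  have pu : p %| u' by apply: (irredp_dvd_root irr_p rpa); rewrite u'E; apply/rootP.
  have /root_dvdp : map_poly phi p %| map_poly phi u' by rewrite dvdp_map.
  by move=> /(_ b rpb)/rootP; rewrite vE.
by exists b, (gadj R a b).
Qed.

Lemma pgraph_total R0 : pgraph R0 -> exists R, [/\ pgraph R, forall xy, R0 xy -> R xy &
  forall a, a \in E -> exists b, R (a, b)].
Proof.
(* Adding R0 to every X makes the empty chain admissible in Zorn's lemma. *)
move=> R0p; pose P (X : set (W * W)) := pgraph (fun xy => X xy \/ R0 xy).
have [C FP totC|A [AP Amax]] := @Zorn_bigcup _ P.
  have pick x y x' y' : (\bigcup_(X in C) X)%classic (x, y) \/ R0 (x, y) ->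
      (\bigcup_(X in C) X)%classic (x', y') \/ R0 (x', y') ->
      (R0 (x, y) /\ R0 (x', y')) \/
      exists2 X, C X & (X (x, y) \/ R0 (x, y)) /\ (X (x', y') \/ R0 (x', y')).
    case=> [[X CX Xx]|Rx] [[X' CX' Xx']|Rx']; last by left.
    - right; have [XX'|X'X] := totC X X' CX CX'.
        by exists X' => //; split; left; [apply: XX'|].
      by exists X => //; split; left; [|apply: X'X].
    - by right; exists X => //; split; [left|right].
    - by right; exists X' => //; split; [right|left].
  have up X xy : C X -> X xy \/ R0 xy -> (\bigcup_(X in C) X)%classic xy \/ R0 xy.
    by move=> CX [Xxy|]; [left; exists X|right].
  split.
  - by move=> c cF; right; apply: (pg_base R0p).
  - move=> x y H; have [[Rx _]|[X CX [Xx _]]] := pick _ _ _ _ H H; first exact: (pg_in R0p Rx).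
    exact: (pg_in (FP _ CX) Xx).
  - move=> x y x' y' H H'; have [[Rx Rx']|[X CX [Xx Xx']]] := pick _ _ _ _ H H'.
      by right; apply: (pg_sub R0p).
    by apply: (up X) => //; apply: (pg_sub (FP _ CX)).
  - move=> x y x' y' H H'; have [[Rx Rx']|[X CX [Xx Xx']]] := pick _ _ _ _ H H'.
      by right; apply: (pg_mul R0p).
    by apply: (up X) => //; apply: (pg_mul (FP _ CX)).
  - move=> x y H; have [[Rx _]|[X CX [Xx _]]] := pick _ _ _ _ H H; first by right; apply: (pg_inv R0p).
    by apply: (up X) => //; apply: (pg_inv (FP _ CX)).
  - move=> y H; have [[Rx _]|[X CX [Xx _]]] := pick _ _ _ _ H H; first exact: (pg_fun R0p).
    exact: (pg_fun (FP _ CX)).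
exists (fun xy => A xy \/ R0 xy); split=> // [xy ?|a aE]; first by right.
have [b [S [Sp RS Sab]]] := pgraph_step AP aE.
exists b; apply: contrapT => nRab; apply: (Amax S).
  split=> [xy Axy|SA]; first by apply: RS; left.
  by apply: nRab; left; apply: SA.
suff -> : P S = pgraph S by [].
rewrite /P; congr pgraph; apply/funext => xy; apply/propext.
by split=> [[//|R0xy]|]; [apply: RS; right|left].
Qed.

End PartialAutomorphisms.

Section GaloisAction.
Variable W : fieldType.
Implicit Types (F E : divringClosed W).

Fact gal_zmod F E (g : gal F E) : {morph g : x y / x - y}.
Proof. by move=> x y; apply: (addIr (g y)); rewrite -gal_add !subrK. Qed.
Fact gal_monoid F E (g : gal F E) : monoid_morphism g.
Proof.
split; last exact: gal_mul.
by apply: gal_fix; exact: rpred1.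
Qed.
HB.instance Definition _ F E (g : gal F E) :=
  GRing.isZmodMorphism.Build _ _ (gal_fun g) (gal_zmod g).
HB.instance Definition _ F E (g : gal F E) :=
  GRing.isMonoidMorphism.Build _ _ (gal_fun g) (gal_monoid g).

(* The value is 0 outside E. *)
Definition ga F E (g : gal F E) (x : W) : W := val (g (insubd 0 x)).

Section Action.
Variables F E : divringClosed W.
Implicit Types (g h : gal F E) (x y : W).

Lemma gaE g (x : subfield E) : val (g x) = ga g (val x).
Proof. by rewrite /ga valKd. Qed.

Lemma ga_in g x : ga g x \in E.
Proof. exact: subfield_valP. Qed.

Lemma gaB g : {in E &, {morph ga g : x y / x - y}}.
Proof.
move=> x y xE yE; rewrite -[x]/(val (Subfield xE)) -[y]/(val (Subfield yE)).
by rewrite -raddfB -!gaE !raddfB.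
Qed.

Lemma gaM g : {in E &, {morph ga g : x y / x * y}}.
Proof.
move=> x y xE yE; rewrite -[x]/(val (Subfield xE)) -[y]/(val (Subfield yE)).
by rewrite -rmorphM -!gaE !rmorphM.
Qed.

Lemma gaV g : {in E, {morph ga g : x / x^-1}}.
Proof.
move=> x xE; rewrite -[x]/(val (Subfield xE)).
by rewrite -fmorphV -!gaE !fmorphV.
Qed.

Lemma ga0 g : ga g 0 = 0.
Proof. by rewrite -[0](rmorph0 (val : subfield E -> W)) -gaE !rmorph0. Qed.

Lemma ga1 g : ga g 1 = 1.
Proof. by rewrite -[1](rmorph1 (val : subfield E -> W)) -gaE !rmorph1. Qed.

Lemma ga_fix g x : {subset F <= E} -> x \in F -> ga g x = x.
Proof.
by move=> FE xF; rewrite -[x]/(val (Subfield (FE _ xF))) -gaE gal_fix.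
Qed.

Lemma ga_mul g h x : ga (g * h)%g x = ga g (ga h x).
Proof. by rewrite [in RHS]/ga valKd. Qed.

Lemma ga_one x : x \in E -> ga (1%g : gal F E) x = x.
Proof. by move=> xE; rewrite -[x]/(val (Subfield xE)) -gaE. Qed.

Lemma gaK g x : x \in E -> ga g^-1%g (ga g x) = x.
Proof. by move=> xE; rewrite -ga_mul mulVg ga_one. Qed.

Lemma gaVK g x : x \in E -> ga g (ga g^-1%g x) = x.
Proof. by move=> xE; rewrite -ga_mul mulgV ga_one. Qed.

Lemma ga_ext g h : (forall x, x \in E -> ga g x = ga h x) -> g = h.
Proof.
move=> gh; apply: gal_eq => x; apply: val_inj; rewrite !gaE; apply: gh.
exact: subfield_valP.
Qed.

Lemma ga_sum g (I : finType) (f : I -> W) : (forall i, f i \in E) ->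
  ga g (\sum_i f i) = \sum_i ga g (f i).
Proof.
move=> fE; pose f' i := Subfield (fE i).
have -> : \sum_i f i = val (\sum_i f' i) by rewrite raddf_sum.
by rewrite -gaE !raddf_sum; apply: eq_bigr => i _; exact: gaE.
Qed.

Lemma ga_root g (P : {poly W}) x : P \is a polyOver E ->
  (forall i, ga g P`_i = P`_i) -> x \in E -> root P x -> root P (ga g x).
Proof.
move=> /polyOver_map[P' <-] Pfix xE; rewrite -[x]/(val (Subfield xE)) -gaE.
rewrite !fmorph_root => rP; have := rmorph_root g rP.
suff -> : map_poly g P' = P' by [].
apply/polyP => i; apply: val_inj; have := Pfix i.
by rewrite !coef_map /= gaE.
Qed.

End Action.

Lemma gal_of_endo F E (f : W -> W) : galois_ext F E ->
  (forall x, x \in E -> f x \in E) -> {in E &, {morph f : x y / x - y}} ->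
  {in E &, {morph f : x y / x * y}} -> (forall c, c \in F -> f c = c) ->
  exists g : gal F E, forall x, x \in E -> ga g x = f x.
Proof.
move=> galFE fE fB fM fF; have [FE charE] := (galois_charP F E).1 galFE.
pose f0 (x : subfield E) : subfield E := Subfield (fE _ (subfield_valP x)).
have [|||h hE] := @rmorphism_of _ _ f0.
- by move=> x y; apply: val_inj; apply: fB; exact: subfield_valP.
- by apply: val_inj; apply: fF; exact: rpred1.
- by move=> x y; apply: val_inj; apply: fM; exact: subfield_valP.
have hF (x : subfield E) : val x \in F -> h x = x.
  by move=> xF; rewrite hE; apply: val_inj; apply: fF.
(* h is injective and maps the finite set of roots of a polynomial over F into itself, hence onto
   itself. *)
have hsurj y : exists x, h x = y.
  have [rs [urs rsE yrs PF]] := charE (val y) (subfield_valP y).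
  set P := \prod_(r <- rs) _ in PF.
  pose rs' := [seq insubd (0 : subfield E) r | r <- rs].
  have rs'E : map val rs' = rs.
    by rewrite -map_comp -[RHS]map_id; apply/eq_in_map => r /rsE; apply: insubE.
  have urs' : uniq rs' by rewrite -(map_inj_uniq val_inj) rs'E.
  have [P' P'E] := polyOver_map (polyOverS FE PF).
  have rootP' (x : subfield E) : root P' x = (x \in rs').
    by rewrite -(fmorph_root (val : subfield E -> W)) P'E root_prod_XsubC -rs'E
      mem_map //; exact: val_inj.
  have hP' : map_poly h P' = P'.
    apply/polyP => i; rewrite coef_map /= hF //.
    have -> : val P'`_i = P`_i by rewrite -P'E coef_map.
    exact/polyOverP.
  have sub : {subset map h rs' <= rs'}.
    by move=> _ /mapP[x xrs ->]; rewrite -rootP' -hP' fmorph_root rootP'.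
  have uh : uniq (map h rs') by rewrite map_inj_uniq //; exact: fmorph_inj.
  have [_ eqm] := uniq_min_size uh sub (eq_leq (esym (size_map h rs'))).
  have : y \in rs' by rewrite -rs'E mem_map in yrs => //; exact: val_inj.
  by rewrite -eqm => /mapP[x _ ->]; exists x.
have /choice[k kP] := hsurj.
have hbij : bijective h.
  by exists k => // x; apply: (fmorph_inj h); rewrite kP.
exists (Gal (rmorphD h) (rmorphM h) hbij hF) => x xE.
by rewrite -[x]/(val (Subfield xE)) -gaE /= hE.
Qed.

Lemma gal_of_pgraph F E R0 : galois_ext F E -> pgraph F E R0 ->
  exists g : gal F E, forall x y, R0 (x, y) -> ga g x = y.
Proof.
move=> galFE R0p; have [R [Rp R0R Rtot]] := pgraph_total galFE R0p.
pose f x := xget 0 [set y | R (x, y)].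
have fP x : x \in E -> R (x, f x).
  by rewrite /f => /Rtot[y Rxy]; case: xgetP => // /(_ y).
have fR x y : x \in E -> R (x, y) -> f x = y by move=> /fP; apply: (pg_eq Rp).
have [||||g gE] := @gal_of_endo F E f galFE.
- by move=> x /fP/(pg_in Rp)[].
- move=> x y xE yE; apply: fR; first exact: rpredB.
  by apply: (pg_sub Rp); apply: fP.
- move=> x y xE yE; apply: fR; first exact: rpredM.
  by apply: (pg_mul Rp); apply: fP.
- move=> c cF; have /(pg_in Rp)[cE _] := pg_base Rp cF.
  by apply: fR => //; apply: (pg_base Rp).
exists g => x y /R0R Rxy; have [xE _] := pg_in Rp Rxy.
by rewrite gE // (fR x y).
Qed.

Lemma gal_fixed F E a : galois_ext F E -> a \in E ->
  (forall g : gal F E, ga g a = a) -> a \in F.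
Proof.
move=> galFE aE fix_a; have [FE _ _] := galFE.
have [rs [urs rsE ars PF minP]] := galois_minimal galFE aE.
apply: contrapT => aF.
have [b brs bNa] : exists2 b, b \in rs & b != a.
  apply: contrapT => nb; apply: aF.
  have rsa : rs = [:: a].
    apply/perm_small_eq => //; apply: uniq_perm => // x; rewrite inE.
    apply/idP/eqP => [xrs|->//]; apply: contrapT => /eqP xNa; apply: nb.
    by exists x.
  move/polyOverP: PF => /(_ 0%N); rewrite rsa big_seq1 coefB coefX coefC sub0r.
  by rewrite rpredN.
pose D : set (W * W) := fun xy => xy.1 = xy.2 /\ xy.1 \in F.
have Dp : pgraph F E D.
  split=> [c //|x y [/= -> yF]|x y x' y' [/= -> yF] [/= -> y'F]|
           x y x' y' [/= -> yF] [/= -> y'F]|x y [/= -> yF]|y [/= <-]] //.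
  - by have := FE _ yF.
  - by split=> //=; apply: rpredB.
  - by split=> //=; apply: rpredM.
  - by split=> //=; rewrite rpredV.
have [||Sp _ Sab] := @gadj_pgraph W F E galFE D a b Dp aE.
- exact: rsE.
- move=> u v Duv ua; have uv : u = v by apply/polyP => i; have [] := Duv i.
  have uF : u \is a polyOver F by apply/polyOverP => i; have [] := Duv i.
  by rewrite -uv; apply/rootP; apply: (minP _ uF _ _ brs); apply/rootP.
have [g gP] := gal_of_pgraph galFE Sp.
by move: bNa; rewrite -(gP _ _ Sab) fix_a eqxx.
Qed.

Lemma gal_restrict K L F E (g : gal K L) : galois_ext F E -> {subset E <= L} ->
  (forall x, x \in F -> ga g x = x) ->
  exists h : gal F E, forall x, x \in E -> ga h x = ga g x.
Proof.
move=> galFE EL gF; have [FE charE] := (galois_charP F E).1 galFE.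
have FL : {subset F <= L} by move=> x /FE/EL.
apply: gal_of_endo => //.
- move=> x xE; have [rs [_ rsE xrs PF]] := charE x xE.
  apply: rsE; rewrite -root_prod_XsubC; apply: ga_root.
  + exact: polyOverS PF.
  + by move=> i; apply: gF; apply/polyOverP.
  + exact: EL.
  + by rewrite root_prod_XsubC.
- by move=> x y xE yE; apply: gaB; apply: EL.
- by move=> x y xE yE; apply: gaM; apply: EL.
Qed.

Lemma gal_widen K F L (g : gal F L) : galois_ext K L -> {subset K <= F} -> {subset F <= L} ->
  exists h : gal K L, forall x, x \in L -> ga h x = ga g x.
Proof.
move=> galKL KF FL; apply: gal_of_endo => //.
- by move=> x _; apply: ga_in.
- exact: gaB.
- exact: gaM.
- by move=> c /KF cF; apply: ga_fix.
Qed.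

Lemma gal_extend K L F E (h : gal F E) : galois_ext K L -> {subset K <= F} ->
  {subset F <= E} -> {subset E <= L} ->
  exists g : gal K L, forall x, x \in E -> ga g x = ga h x.
Proof.
move=> galKL KF FE EL; have FL : {subset F <= L} by move=> x /FE/EL.
have galFL : galois_ext F L by apply: galois_tower galKL _ _.
pose R0 : set (W * W) := fun xy => xy.1 \in E /\ ga h xy.1 = xy.2.
have [|g gP] := @gal_of_pgraph F L R0 galFL.
  split=> [c cF|x y [/= xE <-]|x y x' y' [/= xE <-] [/= x'E <-]|
           x y x' y' [/= xE <-] [/= x'E <-]|x y [/= xE <-]|y [/= _ <-]].
  - by split=> /=; [exact: FE|exact: ga_fix].
  - by split; apply: EL => //; apply: ga_in.
  - by split=> /=; [exact: rpredB|exact: gaB].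
  - by split=> /=; [exact: rpredM|exact: gaM].
  - by split=> /=; [rewrite rpredV|exact: gaV].
  - exact: ga0.
have [g' g'E] := gal_widen g galKL KF FL.
by exists g' => x xE; rewrite g'E ?EL // (gP x (ga h x)).
Qed.

Lemma fixed_field_exists F E (H : set (gal F E)) : exists M : divringClosed W,
  forall x, x \in M <-> x \in E /\ forall h, H h -> ga h x = x.
Proof.
apply: divring_of.
- by split=> [|h _]; [exact: rpred1|exact: ga1].
- move=> x y [xE Hx] [yE Hy]; split=> [|h Hh]; first exact: rpredB.
  by rewrite gaB // Hx // Hy.
- move=> x y [xE Hx] [yE Hy]; split=> [|h Hh]; first exact: rpred_div.
  by rewrite gaM ?rpredV // gaV // Hx // Hy.
Qed.

Definition fixed_field F E (H : set (gal F E)) : divringClosed W :=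
  projT1 (cid (fixed_field_exists H)).

Lemma fixed_fieldP F E (H : set (gal F E)) x :
  x \in fixed_field H <-> x \in E /\ forall h, H h -> ga h x = x.
Proof. exact: (projT2 (cid (fixed_field_exists H))). Qed.

Lemma finite_listing (A : choiceType) (X : set A) (Q : finType) (q : A -> Q) :
  (forall x y, X x -> X y -> q x = q y -> x = y) ->
  exists l : seq A, uniq l /\ forall x, x \in l <-> X x.
Proof.
move=> qX; have [[x0 Xx0]|nX] := pselect (exists x, X x); last first.
  by exists [::]; split=> // x; split=> // Xx; case: nX; exists x.
exists (undup [seq xget x0 [set x | X x /\ q x = c] | c <- enum Q]).
rewrite undup_uniq; split=> // x; rewrite mem_undup; split=> [/mapP[c _ ->]|Xx].
  by case: xgetP => // y _ [].
apply/mapP; exists (q x); first by rewrite mem_enum.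
by case: xgetP => [y _ [Xy qy]|/(_ x)[]//]; apply: qX.
Qed.

Lemma gal_conjugates F E a : galois_ext F E -> a \in E -> exists rs : seq W,
  [/\ {subset rs <= E}, a \in rs & forall g : gal F E, {in rs, forall x, ga g x \in rs}].
Proof.
move=> /galois_charP[FE charE] aE; have [rs [_ rsE ars PF]] := charE a aE.
exists rs; split=> // g x xrs; rewrite -root_prod_XsubC; apply: ga_root.
- exact: polyOverS PF.
- by move=> i; apply: ga_fix => //; apply/polyOverP.
- exact: rsE.
- by rewrite root_prod_XsubC.
Qed.

Lemma gal_conjugates_seq F E (l : seq W) : galois_ext F E -> {subset l <= E} ->
  exists B : seq W, [/\ uniq B, {subset l <= B}, {subset B <= E} &
    forall g : gal F E, {in B, forall x, ga g x \in B}].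
Proof.
move=> galFE lE.
suff [B [lB BE gB]] : exists B : seq W, [/\ {subset l <= B}, {subset B <= E} &
    forall g : gal F E, {in B, forall x, ga g x \in B}].
  exists (undup B); split=> [|x /lB|x|g x]; rewrite ?undup_uniq ?mem_undup //.
    exact: BE.
  exact: gB.
elim: l lE => [|a l IH] lE; first by exists [::].
have [|B [lB BE gB]] := IH; first by move=> x xl; apply: lE; rewrite inE xl orbT.
have [rs [rsE ars grs]] := gal_conjugates galFE (lE a (mem_head _ _)).
exists (rs ++ B); split=> [x|x|g x].
- by rewrite inE mem_cat => /predU1P[->|/lB ->]; rewrite ?ars ?orbT.
- by rewrite mem_cat => /orP[/rsE|/BE].
- by rewrite !mem_cat => /orP[/grs->|/gB->]; rewrite ?orbT.
Qed.

(* The tuple l is coded by a polynomial A over E; the product of the 'X - q%:P over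
   the H-orbit of A has coefficients over the fixed field of H, so g permutes it. *)
Lemma gal_orbit F E (H : set (gal F E)) (g : gal F E) (l : seq W) :
  galois_ext F E -> is_subgroup H -> (forall x, x \in fixed_field H -> ga g x = x) ->
  {subset l <= E} -> exists2 h, H h & {in l, forall x, ga h x = ga g x}.
Proof.
move=> galFE Hsub gfix lE.
have [B [uB lB BE gB]] := gal_conjugates_seq galFE lE.
pose l' := [seq insubd (0 : subfield E) x | x <- l].
have l'E : map val l' = l.
  by rewrite -map_comp -[RHS]map_id; apply/eq_in_map => r /lE; apply: insubE.
pose A := Poly l'.
pose orb (q : {poly subfield E}) := exists2 h, H h & map_poly h A = q.
pose code (q : {poly subfield E}) : {ffun 'I_(size l) -> 'I_(size B).+1} :=
  [ffun i : 'I_(size l) => inord (index (val q`_i) B)].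
have coefA h i : (map_poly (gal_fun h) A)`_i = h (l'`_i) by rewrite coef_map coef_Poly.
have [O [uO OP]] : exists O : seq {poly subfield E}, uniq O /\ forall q, q \in O <-> orb q.
  apply: (@finite_listing _ orb _ code) => _ _ [h _ <-] [k _ <-] /ffunP codeE.
  apply/polyP => i; rewrite !coefA; have [lti|gei] := ltnP i (size l); last first.
    by rewrite nth_default ?rmorph0 // size_map.
  have := codeE (Ordinal lti); rewrite !ffunE /= !coefA.
  have inB (k' : gal F E) : val (k' l'`_i) \in B.
    rewrite gaE; apply: gB; apply: lB; rewrite -l'E; apply: map_f; apply: mem_nth.
    by rewrite size_map.
  move=> /(congr1 (@nat_of_ord _)); rewrite !inordK ?ltnS ?index_size // => /(congr1 (nth 0 B)).
  by rewrite (nth_index 0 (inB h)) (nth_index 0 (inB k)) => /val_inj.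
pose big : {poly {poly subfield E}} := \prod_(q <- O) ('X - q%:P).
have map_big (h : gal F E) :
    map_poly (map_poly h) big = \prod_(q <- [seq map_poly h q | q <- O]) ('X - q%:P).
  rewrite /big rmorph_prod big_map; apply: eq_bigr => q _ /=.
  by rewrite rmorphB /= map_polyX map_polyC.
have permO h : H h -> perm_eq [seq map_poly (gal_fun h) q | q <- O] O.
  move=> Hh; have inj : injective (map_poly (gal_fun h)) by apply: map_poly_inj.
  have sub : {subset [seq map_poly (gal_fun h) q | q <- O] <= O}.
    move=> _ /mapP[q /OP[k Hk <-] ->]; apply/OP; exists (h * k)%g.
      exact: (subM Hsub).
    by apply/polyP => i; rewrite !coef_map.
  have [|eqs eqm] := uniq_min_size _ sub (eq_leq (esym (size_map _ _))).
    by rewrite map_inj_uniq.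
  by apply: uniq_perm; rewrite ?map_inj_uniq.
have bigH h : H h -> map_poly (map_poly (gal_fun h)) big = big.
  by move=> /permO pO; rewrite map_big; apply: perm_big.
have bigg : map_poly (map_poly (gal_fun g)) big = big.
  apply/polyP => i; apply/polyP => j; rewrite !coef_map /=; apply: val_inj.
  rewrite gaE; apply: gfix; apply/fixed_fieldP; split; first exact: subfield_valP.
  move=> h /bigH hbig; rewrite -gaE; congr val.
  by rewrite -[in RHS]hbig !coef_map.
have : root big A.
  rewrite root_prod_XsubC; apply/OP; exists 1%g; first exact: (sub1 Hsub).
  by apply/polyP => i; rewrite coef_map.
move=> /(rmorph_root (map_poly (gal_fun g))); rewrite bigg root_prod_XsubC.
move=> /OP[h Hh hA]; exists h => // x xl.
have xE := lE x xl; rewrite -[x]/(val (Subfield xE)) -!gaE; congr val.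
have xl' : Subfield xE \in l' by rewrite -(mem_map val_inj) l'E.
by rewrite -(nth_index 0 xl') -!coefA hA.
Qed.

End GaloisAction.

Definition stab (W : fieldType) (F E : divringClosed W) (X : {pred W}) : set (gal F E) :=
  fun g => {in X, forall x, ga g x = x}.
Arguments stab {W} F E X.

(** * The endomorphism of the Galois group and its levels *)

Section SigmaAction.
Variables (W : fieldType) (s : {rmorphism W -> W}).
Implicit Types (K L : sigmaSubfield s).

Lemma iter_rmorphism n : exists t : {rmorphism W -> W}, t =1 iter n s.
Proof.
elim: n => [|n [t tE]]; first by exists idfun.
by exists (s \o t : {rmorphism W -> W}) => x /=; rewrite tE.
Qed.

Lemma iterRM n : {morph iter n s : x y / x * y}.
Proof. by have [t tE] := iter_rmorphism n; move=> x y; rewrite -!tE rmorphM. Qed.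

Lemma iter_inj n : injective (iter n s).
Proof.
by have [t tE] := iter_rmorphism n; move=> x y; rewrite -!tE => /fmorph_inj.
Qed.

Lemma sfield_iter K n x : x \in sfield K -> iter n s x \in sfield K.
Proof. by elim: n => //= n IH /IH/sfieldP. Qed.

Section Pair.
Variables K L : sigmaSubfield s.
Hypothesis KL : galois_ext K L.
Let subKL : {subset K <= L}. Proof. by case: KL. Qed.
Implicit Types g h : gal K L.

(** g maps s L into itself: if x is a root of P over K, then g (s x) is a root of the image of P
    under s, and the roots of that are the s r with r in L a root of P. The injectivity of s
    transports g back to L. *)
Lemma gal_sigma_exists g : exists h : gal K L, forall x, x \in sfield L -> s (ga h x) = ga g (s x).
Proof.
have [_ charE] := (galois_charP K L).1 KL.
have /choice[f fP] : forall x, exists y, x \in sfield L -> y \in sfield L /\ s y = ga g (s x).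
  move=> x; have [xL|xnL] := boolP (x \in sfield L); last by exists 0.
  have [rs [_ rsL xrs PK]] := charE x xL.
  set P := \prod_(r <- rs) _ in PK.
  have PsE : map_poly s P = \prod_(r <- [seq s r | r <- rs]) ('X - r%:P).
    rewrite /P rmorph_prod big_map; apply: eq_bigr => r _.
    by rewrite rmorphB /= map_polyX map_polyC.
  have PsK i : (map_poly s P)`_i \in sfield K.
    by rewrite coef_map; apply: sfieldP; apply/polyOverP.
  have : root (map_poly s P) (ga g (s x)).
    apply: ga_root; last by rewrite PsE root_prod_XsubC map_f.
    - by apply/polyOverP => i; apply: subKL.
    - by move=> i; apply: ga_fix.
    - exact: sfieldP.
  by rewrite PsE root_prod_XsubC => /mapP[y /rsL yL ->]; exists y.
have fL x : x \in sfield L -> f x \in sfield L by move=> /fP[].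
have sf x : x \in sfield L -> s (f x) = ga g (s x) by move=> /fP[].
have [||||h hE] := @gal_of_endo W K L f KL; last by exists h => x xL; rewrite hE // sf.
- exact: fL.
- move=> x y xL yL; apply: (fmorph_inj s); rewrite sf ?rpredB // !rmorphB gaB ?sf //; exact: sfieldP.
- move=> x y xL yL; apply: (fmorph_inj s); rewrite sf ?rpredM // !rmorphM gaM ?sf //; exact: sfieldP.
- move=> c cK; apply: (fmorph_inj s); rewrite sf ?subKL // ga_fix //; exact: sfieldP.
Qed.

Lemma gal_sigmaP g x : x \in sfield L -> s (ga (gal_sigma g) x) = ga g (s x).
Proof.
move=> xL; rewrite /gal_sigma; case: xgetP => [h _ hP|nex].
  have -> : ga h x = val (h (Subfield xL)) by rewrite gaE.
  have -> : ga g (s x) = val (g (sigma_on (Subfield xL))) by rewrite gaE.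
  exact: congr1 (hP (Subfield xL)).
have [h hP] := gal_sigma_exists g; case: (nex h) => y; apply: val_inj.
rewrite [RHS]gaE -[RHS]/(ga g (s (val y))) -hP ?subfield_valP //.
by congr (s _); rewrite -gaE.
Qed.

Lemma gal_sigma_uniq g h : (forall x, x \in sfield L -> s (ga h x) = ga g (s x)) -> gal_sigma g = h.
Proof.
by move=> hP; apply: ga_ext => x xL; apply: (fmorph_inj s); rewrite hP ?gal_sigmaP.
Qed.

Lemma gal_sigmaM : {morph (@gal_sigma W s K L) : g h / (g * h)%g}.
Proof.
move=> g h; apply: gal_sigma_uniq => x xL.
by rewrite !ga_mul gal_sigmaP ?ga_in // gal_sigmaP.
Qed.

Lemma iter_gal_sigmaP n g x : x \in sfield L ->
  iter n s (ga (iter n (@gal_sigma W s K L) g) x) = ga g (iter n s x).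
Proof.
move=> xL; elim: n g => [|n IH] g //.
by rewrite [iter n.+1 (@gal_sigma _ _ _ _) g]iterSr iterS IH gal_sigmaP ?sfield_iter.
Qed.

Lemma stab_sigma n g x : x \in sfield L ->
  ga (iter n (@gal_sigma W s K L) g) x = x <-> ga g (iter n s x) = iter n s x.
Proof.
move=> xL; rewrite -(iter_gal_sigmaP n g xL); split=> [->//|].
exact: iter_inj.
Qed.

Lemma stab_sub X : {subset X <= sfield L} -> is_subgroup (stab K L X).
Proof.
move=> XL; split=> [x /XL/ga_one->|g h Hg Hh x xX|g Hg x xX] //.
  by rewrite ga_mul Hh // Hg.
by rewrite -[in LHS](Hg x xX) gaK // XL.
Qed.

End Pair.

(* U is meant to be the stabilizer of a finite set of sigma-generators that is
   closed under conjugation. *)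
Record generating K L (U : set (gal K L)) : Prop := Generating {
  gen_exp : expansive (@gal_sigma W s K L) U;
  gen_fix : forall x, x \in sfield L ->
    exists n, forall g, level (@gal_sigma W s K L) U n g -> ga g x = x;
  gen_level : forall n, exists2 l : seq W, {subset l <= sfield L} &
    forall g, level (@gal_sigma W s K L) U n g <-> stab K L (mem l) g
}.

Lemma generating_exists K L : {subset K <= L} -> galois_ext K L -> sigma_finitely_generated K L ->
  exists U : set (gal K L), generating U.
Proof.
move=> KLs KL [A LA].
have memL x : x \in sfield L <-> forall M : divringClosed W, {subset K <= M} ->
    (forall n a, a \in A -> iter n s a \in M) -> x \in M.
  rewrite LA; split=> [/asboolP H M KM AM|H].
    by apply: H => // _ [n _ [a aA <-]]; apply: AM.
  by apply/asboolP => M KM AM; apply: H => // n a aA; apply: AM; exists n => //; exists a.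
have AL : {subset A <= sfield L} by move=> a aA; apply/memL => M _ /(_ 0%N a aA).
(* Closing the generators under conjugation makes the stabilizer U normal. *)
have [B [uB AB BL gB]] := gal_conjugates_seq KL AL.
pose sg := @gal_sigma W s K L.
pose U := stab K L (mem B).
have levelP n g : level sg U n g <-> forall i x, (i < n)%N -> x \in B -> ga g (iter i s x) = iter i s x.
  split=> [Ug i x lti xB|Ug i lti x xB].
    by apply/(stab_sigma KL) => //; [exact: BL|exact: Ug].
  by apply/(stab_sigma KL); [exact: BL|exact: Ug].
(* The elements fixed by some level form a subfield that contains K and all s^n a, hence all of
   L. *)
have fixL x : x \in sfield L -> exists n, forall g, level sg U n g -> ga g x = x.
  pose P y := y \in sfield L /\ exists n, forall g, level sg U n g -> ga g y = y.
  have le_level m n g : (m <= n)%N -> level sg U n g -> level sg U m g by apply: level_le.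
  have [||| M MP] := @divring_of W P.
  - by split; [exact: rpred1|exists 0%N => g _; exact: ga1].
  - move=> y z [yL [n nP]] [zL [m mP]]; split; first exact: rpredB.
    exists (maxn n m) => g Ug; rewrite gaB // nP ?mP //.
      exact: le_level (leq_maxr n m) Ug.
    exact: le_level (leq_maxl n m) Ug.
  - move=> y z [yL [n nP]] [zL [m mP]]; split; first exact: rpred_div.
    exists (maxn n m) => g Ug; rewrite gaM ?rpredV // gaV // nP ?mP //.
      exact: le_level (leq_maxr n m) Ug.
    exact: le_level (leq_maxl n m) Ug.
  move=> /memL xM; have /MP[_ //] : x \in M.
  apply: xM => [y yK|n a aA]; apply/MP; split.
  - exact: KLs.
  - by exists 0%N => g _; exact: ga_fix.
  - by apply: sfield_iter; apply: AL.
  - by exists n.+1 => g /levelP Ug; apply: Ug; rewrite ?AB.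
exists U; split=> //; last first.
  move=> n; exists [seq iter i s x | i <- iota 0 n, x <- B].
    by move=> _ /allpairsP[[i x] /= [_ xB ->]]; apply: sfield_iter; apply: BL.
  move=> g; split=> [/levelP Ug _ /allpairsP[[i x] /= [ii xB ->]]|Ug].
    by apply: Ug => //; move: ii; rewrite mem_iota.
  apply/levelP => i x lti xB; apply: Ug; apply/allpairsP; exists (i, x).
  by rewrite mem_iota.
have subB : is_subgroup U by apply: stab_sub.
split.
- exact: gal_sigmaM.
- exact: subB.
- move=> g h Ug x xB; rewrite /conjg !ga_mul Ug ?gaK ?BL //; exact: gB.
- exists {ffun seq_sub B -> seq_sub B}, (fun g => [ffun x => SeqSub (gB g _ (ssvalP x))]).
  move=> g h /ffunP gh x xB; have := gh (SeqSub xB); rewrite !ffunE => /(congr1 val) /= ghx.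
  by rewrite ga_mul -ghx gaK // BL.
- move=> g Ug; apply: ga_ext => x xL; have [n nP] := fixL x xL.
  by rewrite nP // ga_one.
- move=> y yP; have le_level m n g : (m <= n)%N -> level sg U n g -> level sg U m g.
    by apply: level_le.
  (* N x is a level that fixes x; beyond it y m x is constant in m, so the limit automorphism is x
     |-> y (N x) x. *)
  have /choice[N NP] : forall x, exists n, x \in sfield L -> forall g, level sg U n g -> ga g x = x.
    move=> x; have [xL|] := boolP (x \in sfield L); last by exists 0%N.
    by have [n nP] := fixL x xL; exists n.
  have steps n k : level sg U n ((y n)^-1 * y (n + k)%N)%g.
    have lsub : is_subgroup (level sg U n).
      split=> [|g h /levelP Ug /levelP Uh|g /levelP Ug]; apply/levelP => i x lti xB;
        have ixL : iter i s x \in sfield L by apply: sfield_iter; apply: BL.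
      + exact: ga_one.
      + by rewrite ga_mul Uh // Ug.
      + by rewrite -{1}(Ug i x) // gaK.
    elim: k => [|k IH]; first by rewrite addn0 mulVg; apply: (sub1 lsub).
    rewrite addnS -(mulVKg (y (n + k)%N) (y (n + k).+1)) mulgA.
    by apply: (subM lsub) => //; apply: le_level (yP _); rewrite leq_addr.
  have stable x m : x \in sfield L -> (N x <= m)%N -> ga (y m) x = ga (y (N x)) x.
    move=> xL /subnKC <-; rewrite -[y (N x + _)%N](mulVKg (y (N x))) ga_mul.
    by rewrite (NP x xL).
  have [||||z zP] := @gal_of_endo W K L (fun x => ga (y (N x)) x) KL.
  + by move=> x _; apply: ga_in.
  + move=> a b aL bL /=; pose m := maxn (N (a - b)) (maxn (N a) (N b)).
    rewrite -(stable (a - b) m) ?rpredB ?leq_maxl // -(stable a m) //; last first.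
      by rewrite /m !leq_max leqnn !orbT.
    rewrite -(stable b m) //; last by rewrite /m !leq_max leqnn !orbT.
    by rewrite gaB.
  + move=> a b aL bL /=; pose m := maxn (N (a * b)) (maxn (N a) (N b)).
    rewrite -(stable (a * b) m) ?rpredM ?leq_maxl // -(stable a m) //; last first.
      by rewrite /m !leq_max leqnn !orbT.
    rewrite -(stable b m) //; last by rewrite /m !leq_max leqnn !orbT.
    by rewrite gaM.
  + by move=> c cK; apply: ga_fix.
  exists z => n; apply/levelP => i x lti xB.
  have ixL : iter i s x \in sfield L by apply: sfield_iter; apply: BL.
  rewrite ga_mul zP // -(stable _ (maxn (N (iter i s x)) n)) ?leq_maxl // -ga_mul.
  have /subnKC <- := leq_maxr (N (iter i s x)) n.
  by have /levelP := steps n (maxn (N (iter i s x)) n - n)%N; apply.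
Qed.

(** Each level is the stabilizer of a finite list, on which g agrees with an element of H by
    [gal_orbit]; hence g is in the closure of H. *)
Lemma fix_closed K L (U H : set (gal K L)) : galois_ext K L -> generating U ->
  is_subgroup H -> closed_set (@gal_sigma W s K L) U H ->
  forall g, (forall x, x \in fixed_field H -> ga g x = x) -> H g.
Proof.
move=> KL [_ _ lev] Hsub Hcl g gfix; apply: Hcl => n; have [l lL lP] := lev n.
have [h Hh hg] := gal_orbit KL Hsub gfix lL.
by exists h => //; apply/lP => x xl; rewrite ga_mul -hg // gaK // lL.
Qed.

End SigmaAction.

(** * Bases, linear independence and sigma-separability *)

Section Independence.
Variable W : fieldType.
Implicit Types (F E M : divringClosed W).

Lemma subfieldM E (x y : subfield E) : subfield_val (x * y) = subfield_val x * subfield_val y.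
Proof. by []. Qed.

Lemma subfield_sum E (I : finType) (f : I -> subfield E) :
  subfield_val (\sum_i f i) = \sum_i subfield_val (f i).
Proof. exact: (raddf_sum (val : subfield E -> W)). Qed.

Lemma subfield_insub E x : x \in E -> subfield_val (insubd (0 : subfield E) x) = x.
Proof. exact: insubE. Qed.

Lemma lin_indepP F (I : finType) (b : I -> W) :
  lin_indep F b <-> forall c : I -> W, (forall i, c i \in F) ->
    \sum_i c i * b i = 0 -> forall i, c i = 0.
Proof.
split=> [ind c cF sum0 i|ind c sum0 i].
  have := ind (fun i => Subfield (cF i)) sum0 i.
  by move=> /(congr1 val).
by apply: val_inj; apply: (ind (fun i => val (c i))) => // j; exact: subfield_valP.
Qed.

Lemma basis_exists F (X : {pred W}) (I : finType) (b : I -> W) x :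
  is_basis F X b -> x \in X -> exists2 c : I -> W, (forall i, c i \in F) & x = \sum_i c i * b i.
Proof.
move=> [_ _ span] /span[c ->]; exists (fun i => val (c i)) => // i; exact: subfield_valP.
Qed.

Lemma basisP F (X : {pred W}) (I : finType) (b : I -> W) :
  (forall i, b i \in X) -> lin_indep F b ->
  (forall x, x \in X -> exists2 c : I -> W, (forall i, c i \in F) & x = \sum_i c i * b i) ->
  is_basis F X b.
Proof.
move=> bX ind span; split=> // x /span[c cF ->].
by exists (fun i => Subfield (cF i)).
Qed.

(* Dedekind's argument, by induction on the size of the support of c. *)
Lemma dedekind F E (I : finType) (b c : I -> W) : galois_ext F E ->
  (forall i, b i \in E) -> lin_indep F b -> (forall i, c i \in E) ->
  (forall h : gal F E, \sum_i c i * ga h (b i) = 0) -> forall i, c i = 0.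
Proof.
move=> galFE bE /lin_indepP ind; have [n] := ubnP #|[pred i | c i != 0]|.
elim: n c => // n IH c; rewrite ltnS => len cE sum0 i; apply/eqP; apply: contraT => ciN0.
pose d j := c j / c i.
have dE j : d j \in E by apply: rpred_div.
have dsum (h : gal F E) : \sum_j d j * ga h (b j) = 0.
  have := congr1 (fun z => z / c i) (sum0 h); rewrite mul0r mulr_suml => E0; rewrite -[RHS]E0.
  by apply: eq_bigr => j _; rewrite /d mulrAC.
have dfix (g : gal F E) j : ga g (d j) = d j.
  apply/eqP; rewrite -subr_eq0; apply/eqP; move: j.
  apply: IH => [|j|h]; first last.
  - have E1 : \sum_j ga g (d j) * ga h (b j) = 0.
      have := congr1 (ga g) (dsum (g^-1 * h)%g); rewrite ga0 ga_sum => [E0|j].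
        rewrite -[RHS]E0; apply: eq_bigr => j _.
        by rewrite gaM ?ga_in // -ga_mul mulVKg.
      by apply: rpredM => //; apply: ga_in.
    under eq_bigr => j _ do rewrite mulrBl.
    by rewrite sumrB E1 dsum subrr.
  - by apply: rpredB => //; apply: ga_in.
  apply: leq_trans len; apply: proper_card; apply/properP; split.
    apply/fintype.subsetP => j; rewrite !inE; apply: contraNN => /eqP cj.
    by rewrite /d cj mul0r ga0 subrr.
  exists i; rewrite !inE // /d divff // ga1 subrr eqxx //.
have := ind d (fun j => gal_fixed galFE (dE j) (fun g => dfix g j)).
move=> /(_ _ i); rewrite /d divff // => H; move: ciN0.
have /eqP : 1 = 0 :> W.
  apply: H; rewrite -[RHS](dsum 1%g); apply: eq_bigr => j _.
  by rewrite ga_one.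
by rewrite oner_eq0.
Qed.

Lemma cokermx_col (V : fieldType) m n (A : 'M[V]_(m, n)) : (\rank A < n)%N ->
  exists2 c : 'I_n -> V, exists j, c j != 0 &
    forall v : 'rV_n, (v <= A)%MS -> \sum_j v 0 j * c j = 0.
Proof.
move=> ltr; have /matrix0Pn[j [k ck]] : cokermx A != 0.
  by rewrite -mxrank_eq0 mxrank_coker -lt0n subn_gt0.
exists (fun j => cokermx A j k); first by exists j.
move=> v; rewrite submxE => /eqP/matrixP/(_ 0 k); rewrite !mxE => E0; rewrite -[RHS]E0.
by apply: eq_bigr.
Qed.

(** The Galois group may be infinite, so finitely many f i are chosen to make the rank maximal.
    Every further row of conjugates then lies in the row space, and a rank below d would give a
    relation contradicting [dedekind]. *)
Lemma galois_matrix F E d (b : 'I_d -> W) : galois_ext F E ->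
  (forall i, b i \in E) -> lin_indep F b ->
  exists n (f : 'I_n -> gal F E) (B : 'M[subfield E]_(d, n)),
    B *m (\matrix_(i, j) (insubd (0 : subfield E) (ga (f i) (b j)))) = 1%:M.
Proof.
move=> galFE bE ind.
pose M n (f : 'I_n -> gal F E) := \matrix_(i, j) (insubd (0 : subfield E) (ga (f i) (b j))).
pose good r := `[< exists n (f : 'I_n -> gal F E), \rank (M n f) = r >].
have ex_good : exists r, good r.
  by exists (\rank (M 0%N (fun=> 1%g))); apply/asboolP; exists 0%N, (fun=> 1%g).
have good_le r : good r -> (r <= d)%N by move=> /asboolP[n [f <-]]; apply: rank_leq_col.
case: (ex_maxnP ex_good good_le) => r /asboolP[n [f fr]] rmax.
exists n, f; apply/row_fullP; rewrite /row_full -/(M n f) eqn_leq rank_leq_col /=.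
rewrite leqNgt; apply/negP => /cokermx_col[c [j cj] cP].
suff: subfield_val (c j) = 0 by move/(@val_inj _ _ _ (c j) 0)/eqP; rewrite (negPf cj).
apply: (dedekind (F := F) (E := E) (b := b) (c := fun j => subfield_val (c j))) => // [i|h].
  exact: subfield_valP.
pose v : 'rV_d := \row_j (insubd (0 : subfield E) (ga h (b j))).
have : (v <= M n f)%MS.
  pose f' (i : 'I_(n + 1)) := if fintype.split i is inl i' then f i' else h.
  have f'E : M (n + 1)%N f' = col_mx (M n f) v.
    apply/matrixP => i k; rewrite !mxE /f'.
    by case: fintype.splitP => [i' _|i' _]; rewrite !mxE.
  have := rmax (\rank (M _ f')); rewrite f'E -fr => H.
  have le : (\rank (col_mx (M n f) v) <= \rank (M n f))%N.
    by apply: H; apply/asboolP; exists (n + 1)%N, f'; rewrite f'E.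
  have sub : (M n f <= col_mx (M n f) v)%MS by rewrite -addsmxE addsmxSl.
  have : (col_mx (M n f) v <= M n f)%MS.
    by rewrite -(geq_leqif (mxrank_leqif_sup sub)).
  by apply: submx_trans; rewrite -addsmxE addsmxSr.
move=> /cP/(congr1 (@subfield_val _ _)); rewrite subfield_sum => sum0; rewrite -[RHS]sum0.
apply: eq_bigr => k _; rewrite mxE subfieldM mulrC; congr (_ * _).
by rewrite subfield_insub // ga_in.
Qed.

(** The coefficients c lie anywhere in W, so Dedekind's argument cannot be repeated; instead t is
    applied to the left inverse supplied by [galois_matrix]. *)
Lemma twisted_independence F E d (b c : 'I_d -> W) (t : {rmorphism W -> W}) : galois_ext F E ->
  (forall i, b i \in E) -> lin_indep F b ->
  (forall h : gal F E, \sum_i c i * t (ga h (b i)) = 0) -> forall i, c i = 0.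
Proof.
move=> galFE bE ind sum0; have [n [f [B BM]]] := galois_matrix galFE bE ind.
pose tv := t \o (val : subfield E -> W) : {rmorphism subfield E -> W}.
have /(congr1 (fun A => A *m \col_i c i)) := congr1 (map_mx tv) BM.
rewrite map_mxM map_mx1 mul1mx -mulmxA.
set v := map_mx tv (\matrix_(i, j) _) *m _.
have -> : v = 0.
  apply/matrixP => i k; rewrite !mxE -[RHS](sum0 (f i)); apply: eq_bigr => j _.
  by rewrite !mxE /= subfield_insub ?ga_in // mulrC.
by rewrite mulmx0 => /matrixP H i; have := H i 0; rewrite !mxE.
Qed.

Definition extend_family d (b : 'I_d -> W) x (i : 'I_d.+1) : W :=
  if unlift ord0 i is Some j then b j else x.

Lemma span_of_dependent F d (b : 'I_d -> W) x :
  lin_indep F b -> ~ lin_indep F (extend_family b x) ->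
  exists2 c : 'I_d -> W, (forall i, c i \in F) & x = \sum_i c i * b i.
Proof.
move=> bi nb.
have [c [cF sum0 [i ci]]] : exists c : 'I_d.+1 -> W, [/\ forall i, c i \in F,
    \sum_i c i * extend_family b x i = 0 & exists i, c i != 0].
  apply: contrapT => nc; apply: nb; apply/lin_indepP => c cF sum0 i; apply/eqP; apply: contraT => ci.
  by case: nc; exists c; split=> //; exists i.
move: sum0; rewrite big_ord_recl {1}/extend_family unlift_none.
under eq_bigr => j _ do rewrite /extend_family liftK.
have [c0|c0] := eqVneq (c ord0) 0.
  rewrite c0 mul0r add0r => sum0.
  have c1 := (lin_indepP F b).1 bi (fun j => c (lift ord0 j)) (fun j => cF _) sum0.
  by move: ci; case: (unliftP ord0 i) => [j ->|->]; rewrite ?c1 ?c0 eqxx.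
move=> /eqP; rewrite addr_eq0 => /eqP cx.
exists (fun j => - (c ord0)^-1 * c (lift ord0 j)) => [j|].
  by apply: rpredM => //; rewrite rpredN rpredV.
under eq_bigr => j _ do rewrite -mulrA.
by rewrite -mulr_sumr mulNr -mulrN -cx mulKf.
Qed.

Lemma bounded_finite_ext F M n : {subset F <= M} ->
  (forall d (b : 'I_d -> W), (forall i, b i \in M) -> lin_indep F b -> (d <= n)%N) ->
  finite_ext F M.
Proof.
move=> FM bound.
pose good d := `[< exists b : 'I_d -> W, (forall i, b i \in M) /\ lin_indep F b >].
have ex_good : exists d, good d.
  by exists 0%N; apply/asboolP; exists (fun=> 0); split=> [[]|c _ []].
have good_le d : good d -> (d <= n)%N by move=> /asboolP[b [bM bi]]; apply: bound bi.
case: (ex_maxnP ex_good good_le) => d /asboolP[b [bM bi]] dmax.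
exists d, b; apply: basisP => // x xM.
apply: span_of_dependent => //; move=> bi'; have := dmax d.+1; rewrite ltnn => H.
suff : false by []; apply: H; apply/asboolP; exists (extend_family b x); split=> // i.
by rewrite /extend_family; case: unlift.
Qed.

(** One representative for each code gives all the rows of conjugates of b; with fewer rows than
    columns there is a relation between the columns, against [dedekind]. *)
Lemma lin_indep_bound F E M (Q : finType) (q : gal F E -> Q) d (b : 'I_d -> W) :
  galois_ext F E -> {subset M <= E} ->
  (forall g h, q g = q h -> {in M, forall x, ga g x = ga h x}) ->
  (forall i, b i \in M) -> lin_indep F b -> (d <= #|Q|)%N.
Proof.
move=> galFE ME qP bM ind; rewrite leqNgt; apply/negP => ltQd.
pose rep (c : Q) := xget (1%g : gal F E) [set g | q g = c].
pose A : 'M[subfield E]_(#|Q|, d) := \matrix_(i, j) insubd 0 (ga (rep (enum_val i)) (b j)).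
have /cokermx_col[c [j cj] cP] : (\rank A < d)%N by apply: leq_ltn_trans ltQd; apply: rank_leq_row.
have bE i : b i \in E by apply: ME.
suff: subfield_val (c j) = 0 by move/(@val_inj _ _ _ (c j) 0)/eqP; rewrite (negPf cj).
apply: (dedekind (F := F) (E := E) (b := b) (c := fun j => subfield_val (c j))) => // [i|h].
  exact: subfield_valP.
have /cP/(congr1 (@subfield_val _ _)) := row_sub (enum_rank (q h)) A.
rewrite subfield_sum => sum0; rewrite -[RHS]sum0.
apply: eq_bigr => k _; rewrite !mxE subfieldM mulrC subfield_insub ?ga_in // enum_rankK.
congr (_ * _); apply: qP; last exact: bM.
by rewrite /rep; case: xgetP => // /(_ h)[].
Qed.

Lemma basis_size F (X : {pred W}) d d' (b : 'I_d -> W) (b' : 'I_d' -> W) :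
  is_basis F X b -> (forall i, b' i \in X) -> lin_indep F b' -> (d' <= d)%N.
Proof.
move=> [bX bi span] b'X b'i.
have /choice[c cP] : forall i, exists c : 'I_d -> subfield F, b' i = \sum_j val (c j) * b j.
  by move=> i; apply: span.
rewrite leqNgt; apply/negP => ltd.
have /cokermx_col[e [j ej] eP] : (\rank (\matrix_(i < d, j < d') c j i) < d')%N.
  by apply: leq_ltn_trans ltd; apply: rank_leq_row.
have := b'i e; suff -> : \sum_i val (e i) * b' i = 0.
  by move=> /(_ erefl j)/eqP; rewrite (negPf ej).
under eq_bigr => i _ do rewrite cP mulr_sumr.
rewrite exchange_big /= big1 // => k _.
have E0 := eP _ (row_sub k (\matrix_(i < d, j < d') c j i)).
have := congr1 (fun x : subfield F => subfield_val x * b k) E0.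
rewrite /= subfield_sum mul0r mulr_suml => sum0; rewrite -[RHS]sum0.
by apply: eq_bigr => i _; rewrite !mxE subfieldM mulrA; congr (_ * _); rewrite mulrC.
Qed.

Lemma indep_full_basis F (X : {pred W}) d (b b' : 'I_d -> W) :
  is_basis F X b -> (forall i, b' i \in X) -> lin_indep F b' -> is_basis F X b'.
Proof.
move=> bX b'X b'i; apply: basisP => // x xX.
apply: span_of_dependent => // bi; have : (d.+1 <= d)%N; last by rewrite ltnn.
by apply: (basis_size bX _ bi) => i; rewrite /extend_family; case: unlift.
Qed.

End Independence.

(** * Tensor products over a finite basis and sigma-separability *)

Local Open Scope quotient_scope.

Section TensorCong.
Variables (R A B : comNzRingType) (f : {rmorphism R -> A}) (g : {rmorphism R -> B}).
Local Notation cong := (@tensor_cong R A B f g).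

Lemma cong_zeror a : cong [:: (a, 0)] [::].
Proof.
apply: TensorTrans (TensorZero _ _ 1).
have := TensorScale f g 0 a 1; rewrite !rmorph0 !mul0r.
exact: TensorSym.
Qed.

Lemma cong_cons p l l' : cong l l' -> cong (p :: l) (p :: l').
Proof. by move=> ll'; rewrite -(cat1s p l) -(cat1s p l'); apply: TensorCat ll'; apply: TensorRefl. Qed.

Lemma cong_sum (I : Type) (r : seq I) (a : I -> A) c :
  cong [:: (\sum_(i <- r) a i, c)] [seq (a i, c) | i <- r].
Proof.
elim: r => [|i r IH]; first by rewrite big_nil; apply: TensorZero.
rewrite big_cons; apply: TensorTrans (TensorAddl _ _ _ _ _) _.
exact: cong_cons.
Qed.

Lemma cong_map (I : Type) (r : seq I) (p p' : I -> A * B) :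
  (forall i, cong [:: p i] [:: p' i]) -> cong [seq p i | i <- r] [seq p' i | i <- r].
Proof.
move=> pp'; elim: r => [|i r IH]; first exact: TensorRefl.
by rewrite /= -cat1s -(cat1s (p' i)); apply: TensorCat.
Qed.

Lemma cong_merge (I : Type) (r : seq I) (a : I -> A) (x y : I -> B) :
  cong ([seq (a i, x i) | i <- r] ++ [seq (a i, y i) | i <- r])
       [seq (a i, x i + y i) | i <- r].
Proof.
elim: r => [|i r IH]; first exact: TensorRefl.
rewrite /=; set X := map _ r in IH *; set Y := map _ r in IH *.
apply: (@TensorTrans _ _ _ _ _ _ ([:: (a i, x i); (a i, y i)] ++ (X ++ Y))).
  apply: cong_cons; apply: TensorTrans (TensorCatC _ _ _ _) _.
  by rewrite /=; apply: cong_cons; apply: TensorCatC.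
rewrite -(cat1s (_, x i + y i)); apply: TensorCat => //.
by apply: TensorSym; apply: TensorAddr.
Qed.

Lemma cong_pi l l' : \pi_(tensor f g) l = \pi_(tensor f g) l' <-> cong l l'.
Proof.
split=> [/eqmodP/asboolP//|ll']; apply/eqmodP; exact/asboolP.
Qed.

Variables (I : finType) (b : I -> A) (coord : A -> I -> R).
Hypothesis coordP : forall a, a = \sum_i f (coord a i) * b i.
Hypothesis coord_uniq : forall a c, a = \sum_i f (c i) * b i -> forall i, coord a i = c i.

(** The component along [b i] of the class of l: the tensor product is free over B on the b i, by
    [tensor_eqP]. *)
Definition tensor_coord (l : seq (A * B)) (i : I) : B := \sum_(p <- l) g (coord p.1 i) * p.2.

Lemma tensor_coord_cong l l' i : cong l l' -> tensor_coord l i = tensor_coord l' i.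
Proof.
have coord0 : coord 0 i = 0.
  apply: (coord_uniq (c := fun=> 0)); rewrite big1 // => j _.
  by rewrite rmorph0 mul0r.
have coordD a a' : coord (a + a') i = coord a i + coord a' i.
  apply: (coord_uniq (c := fun i => coord a i + coord a' i)).
  by rewrite {1}(coordP a) {1}(coordP a') -big_split; apply: eq_bigr => j _; rewrite rmorphD mulrDl.
have coordZ r a : coord (f r * a) i = r * coord a i.
  apply: (coord_uniq (c := fun i => r * coord a i)).
  by rewrite {1}(coordP a) mulr_sumr; apply: eq_bigr => j _; rewrite rmorphM mulrA.
rewrite /tensor_coord; 
elim=> {l l'} [s|s t _ ->|s t u _ -> _ ->|s s' t t' _ sE _ tE|s t|c|a a' c|a c c'|r a c] //.
- by rewrite !big_cat sE tE.
- by rewrite !big_cat /= addrC.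
- by rewrite big_seq1 big_nil coord0 rmorph0 mul0r.
- by rewrite !big_cons !big_nil !addr0 /= coordD rmorphD mulrDl.
- by rewrite !big_cons !big_nil !addr0 /= mulrDr.
- by rewrite !big_seq1 /= coordZ rmorphM mulrA [g r * _]mulrC.
Qed.

Lemma tensor_normal_form l : cong l [seq (b i, tensor_coord l i) | i <- enum I].
Proof.
elim: l => [|[a c] l IH].
  have E0 i : tensor_coord [::] i = 0 by rewrite /tensor_coord big_nil.
  apply: TensorSym; elim: (enum I) => [|i r IHr]; first exact: TensorRefl.
  rewrite /= E0 -cat1s -[X in cong _ X]cat0s; apply: TensorCat => //.
  exact: cong_zeror.
have E : [seq (b i, tensor_coord ((a, c) :: l) i) | i <- enum I] =
         [seq (b i, g (coord a i) * c + tensor_coord l i) | i <- enum I].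
  by apply: eq_map => i; rewrite /tensor_coord big_cons.
rewrite E; apply: TensorTrans (cong_merge _ _ _ _).
rewrite -cat1s; apply: TensorCat => //.
have aE : a = \sum_(i <- enum I) f (coord a i) * b i by rewrite big_enum -coordP.
rewrite {1}aE; apply: TensorTrans (cong_sum _ _ _) _.
by apply: cong_map => i; apply: TensorScale.
Qed.

Lemma tensor_eqP l l' : cong l l' <-> forall i, tensor_coord l i = tensor_coord l' i.
Proof.
split=> [ll' i|ll']; first exact: tensor_coord_cong.
apply: TensorTrans (tensor_normal_form l) _; apply: TensorSym.
apply: TensorTrans (tensor_normal_form l') _.
have -> : [seq (b i, tensor_coord l' i) | i <- enum I] = [seq (b i, tensor_coord l i) | i <- enum I].
  by apply: eq_map => i; rewrite ll'.
exact: TensorRefl.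
Qed.

Lemma tensor_coord_basis (r : seq I) (x : I -> B) i : uniq r -> i \in r ->
  tensor_coord [seq (b j, x j) | j <- r] i = x i.
Proof.
move=> ur ir; rewrite /tensor_coord big_map /=.
have coordb j k : coord (b j) k = (k == j)%:R.
  apply: (coord_uniq (c := fun k => (k == j)%:R)).
  rewrite (bigD1 j) //= eqxx rmorph1 mul1r big1 ?addr0 // => k' /negPf ->.
  by rewrite rmorph0 mul0r.
rewrite (bigD1_seq i) //= coordb eqxx rmorph1 mul1r big1 ?addr0 // => j ji.
by rewrite coordb eq_sym (negPf ji) rmorph0 mul0r.
Qed.

End TensorCong.

Section SigmaSeparable.
Variables (W : fieldType) (s : {rmorphism W -> W}).

Fact sigma_on_zmod (E : sigmaSubfield s) : {morph (@sigma_on W s E) : x y / x - y}.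
Proof. by move=> x y; apply: val_inj; rewrite /= rmorphB. Qed.
Fact sigma_on_monoid (E : sigmaSubfield s) : monoid_morphism (@sigma_on W s E).
Proof.
by split=> [|x y]; apply: val_inj; rewrite /= ?rmorph1 ?rmorphM.
Qed.
HB.instance Definition _ E := GRing.isZmodMorphism.Build _ _ (@sigma_on W s E) (@sigma_on_zmod E).
HB.instance Definition _ E := GRing.isMonoidMorphism.Build _ _ (@sigma_on W s E) (@sigma_on_monoid E).

Variables (K M : sigmaSubfield s).
Hypothesis KM : {subset K <= M}.

Let inclE (x : subfield K) : subfield_val (@Defs.incl W K M x) = subfield_val x.
Proof. by rewrite subfield_insub // KM //; exact: subfield_valP. Qed.

Let incl_rmorphism : exists h : {rmorphism subfield K -> subfield M}, h = @Defs.incl W K M :> (_ -> _).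
Proof.
have [|||h hE] := @rmorphism_of (subfield K) (subfield M) (@Defs.incl W K M).
- by move=> x y; apply: val_inj; rewrite /= !inclE.
- by apply: val_inj; rewrite /= inclE.
- by move=> x y; apply: val_inj; rewrite /= !inclE.
by exists h; apply/funext.
Qed.

Lemma basis_coord d (b : 'I_d -> W) (bM : forall i, b i \in sfield M)
    (f : {rmorphism subfield K -> subfield M}) : f = @Defs.incl W K M :> (_ -> _) ->
  is_basis K M b ->
  exists coord : subfield M -> 'I_d -> subfield K,
   (forall a, a = \sum_i f (coord a i) * Subfield (bM i)) /\
   (forall a c, a = \sum_i f (c i) * Subfield (bM i) -> forall i, coord a i = c i).
Proof.
move=> fE [_ ind span].
have valE (c : 'I_d -> subfield K) :
    subfield_val (\sum_i f (c i) * Subfield (bM i)) = \sum_i val (c i) * b i.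
  rewrite subfield_sum; apply: eq_bigr => i _.
  by rewrite subfieldM fE inclE.
have /choice[coord coordP] : forall a : subfield M, exists c : 'I_d -> subfield K,
    a = \sum_i f (c i) * Subfield (bM i).
  move=> a; have [c cE] := span _ (subfield_valP a); exists c.
  by apply: val_inj; rewrite [RHS]valE.
exists coord; split=> // a c aE i; apply/eqP; rewrite -subr_eq0; apply/eqP; move: i.
apply: ind; under eq_bigr => i _ do rewrite rmorphB mulrBl.
by rewrite sumrB -!valE -coordP -aE subrr.
Qed.

(** If the s (b i) are independent they form a basis, and in the bases b and s b the map on the
    tensor product is s' on each coordinate, hence injective. The converse takes a particular base
    change. *)
Lemma sigma_separable_basis d (b : 'I_d -> W) : is_basis K M b ->
  sigma_separable K M <-> lin_indep K (fun i => s (b i)).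
Proof.
move=> bas; have [bM ind span] := bas; have [f fE] := incl_rmorphism.
have [coord [coordP coord_uniq]] := basis_coord bM fE bas.
have f_sigma r : sigma_on (f r) = f (sigma_on r).
  by rewrite fE; apply: val_inj; rewrite /= !inclE.
rewrite /sigma_separable -fE; split=> [sep|sind].
- move=> c sum0; pose l := [seq (Subfield (bM i), c i) | i <- enum 'I_d].
  (* K' is K viewed as an extension of K through s. There s (c i) on the right is the scalar c i, so
     the sum of the tensors of b i and c i is sent to the tensor of the sum of the c i s (b i),
     which is 0, with 1. *)
  pose sK : {rmorphism subfield K -> subfield K} := @sigma_on W s K.
  have /(_ (\pi l) (\pi [::])) inj := sep _ sK sK (fun=> erefl).
  have piE : \pi_(tensor f sK) l = \pi [::].
    apply: inj.
    rewrite !(@tensor_mapE _ _ _ f sK (@sigma_on W s K) (@sigma_on W s M : {rmorphism _ -> _}) sK) //.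
    apply/cong_pi; rewrite /l -map_comp /=.
    apply: (@TensorTrans _ _ _ _ _ _ [seq (f (c i) * sigma_on (Subfield (bM i)), 1) | i <- enum 'I_d]).
      apply: cong_map => i; apply: TensorSym.
      by have := TensorScale f sK (c i) (sigma_on (Subfield (bM i))) 1; rewrite mulr1.
    apply: TensorTrans (TensorSym (cong_sum f sK (enum 'I_d) 
      (fun i => f (c i) * sigma_on (Subfield (bM i))) 1)) _.
    have -> : \sum_(i <- enum 'I_d) f (c i) * sigma_on (Subfield (bM i)) = 0.
      rewrite big_enum /=; apply: val_inj; rewrite [LHS]subfield_sum -[RHS]sum0.
      by apply: eq_bigr => i _; rewrite subfieldM fE inclE.
    exact: TensorZero.
  move: piE => /cong_pi/(tensor_coord_cong coordP coord_uniq) cE i.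
  have := cE i; rewrite /l (tensor_coord_basis _ coord_uniq) ?enum_uniq ?mem_enum //.
  by rewrite /tensor_coord big_nil.
- move=> K' s' i is' x y.
  have sbM j : s (b j) \in sfield M by apply: sfieldP.
  have sbas := indep_full_basis bas sbM sind.
  have [coord' [coordP' coord_uniq']] := basis_coord sbM fE sbas.
  have normal l : @tensor_cong _ _ _ f i [seq (sigma_on p.1, s' p.2) | p <- l]
      [seq (Subfield (sbM j), s' (tensor_coord i coord l j)) | j <- enum 'I_d].
    have /cong_pi/(congr1 (@tensor_map _ _ _ f i (@sigma_on W s M) s')) :=
      tensor_normal_form i coordP l.
    rewrite !(@tensor_mapE _ _ _ f i (@sigma_on W s K) (@sigma_on W s M : {rmorphism _ -> _}) s') //.
    move=> /cong_pi H; apply: TensorTrans H _; rewrite -map_comp.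
    have -> : [seq (Subfield (sbM j), s' (tensor_coord i coord l j)) | j <- enum 'I_d] =
      [seq ((fun p => (sigma_on p.1, s' p.2)) \o
        (fun j => (Subfield (bM j), tensor_coord i coord l j))) j | j <- enum 'I_d].
      by apply: eq_map => j /=; congr (_, _); apply: val_inj.
    exact: TensorRefl.
  rewrite -[x]reprK -[y]reprK.
  rewrite !(@tensor_mapE _ _ _ f i (@sigma_on W s K) (@sigma_on W s M : {rmorphism _ -> _}) s') //.
  move=> /cong_pi H; apply/cong_pi/(tensor_eqP i coordP coord_uniq) => j.
  have H' := TensorTrans (TensorSym (normal (repr x))) (TensorTrans H (normal (repr y))).
  have := tensor_coord_cong coordP' coord_uniq' j H'.
  rewrite !(tensor_coord_basis _ coord_uniq') ?enum_uniq ?mem_enum //.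
  exact: fmorph_inj.
Qed.

End SigmaSeparable.

Local Close Scope quotient_scope.

(** * The Galois correspondence *)

Section Correspondence.
Variable W : fieldType.
Implicit Types (F E K L M : divringClosed W).

Lemma gal_agree_mul F E K L (X : {pred W}) (g g' : gal K L) (h h' : gal F E) :
  (forall x, x \in X -> ga h' x \in X) ->
  {in X, ga g =1 ga h} -> {in X, ga g' =1 ga h'} -> {in X, ga (g * g')%g =1 ga (h * h')%g}.
Proof. by move=> hX gh gh' x xX; rewrite !ga_mul gh' // gh // hX. Qed.

Lemma stab_fixed K L M x : galois_ext K L -> {subset K <= M} -> {subset M <= L} ->
  x \in L -> (forall g, stab K L M g -> ga g x = x) -> x \in M.
Proof.
move=> KL KM ML xL xfix; have ML' := galois_tower KL KM ML.
apply: (gal_fixed ML' xL) => g; have [g' g'E] := gal_widen g KL KM ML.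
by rewrite -g'E // xfix // => y yM; rewrite g'E ?ML // ga_fix.
Qed.

Lemma fixed_field_base F E (H : set (gal F E)) : {subset F <= E} -> {subset F <= fixed_field H}.
Proof. by move=> FE x xF; apply/fixed_fieldP; split=> [|h _]; [exact: FE|exact: ga_fix]. Qed.

Lemma fixed_field_sub F E (H : set (gal F E)) : {subset fixed_field H <= E}.
Proof. by move=> x /fixed_fieldP[]. Qed.

(** The last hypothesis on H is closedness in the Krull topology. *)
Lemma stab_fixed_field F E (H : set (gal F E)) : galois_ext F E -> is_subgroup H ->
  (forall g : gal F E,
     (forall l : seq W, {subset l <= E} -> exists2 h, H h & {in l, ga h =1 ga g}) -> H g) ->
  forall g, stab F E (fixed_field H) g <-> H g.
Proof.
move=> FE Hsub Hcl g; split=> [gfix|Hg x /fixed_fieldP[_]]; last exact.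
by apply: Hcl => l lE; apply: gal_orbit.
Qed.

Lemma fixed_field_galois F E (H : set (gal F E)) : galois_ext F E ->
  (forall h g, H h -> H (h ^ g)%g) -> galois_ext F (fixed_field H).
Proof.
move=> FE Hnorm; have [FEs _ _] := FE; apply/galois_charP; split; first exact: fixed_field_base.
move=> a aM; have aE := fixed_field_sub aM.
have [B [uB aB BE gB]] : exists B : seq W, [/\ uniq B, a \in B, {subset B <= E} &
    forall g : gal F E, {in B, forall x, ga g x \in B}].
  have [|B [uB lB BE gB]] := gal_conjugates_seq (l := [:: a]) FE.
    by move=> x; rewrite inE => /eqP ->.
  by exists B; split=> //; apply: lB; rewrite mem_head.
pose rs := [seq x <- B | `[< exists g : gal F E, ga g a = x >]].
have rsP x : x \in rs <-> exists g : gal F E, ga g a = x.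
  rewrite mem_filter; split=> [/andP[/asboolP]//|[g gx]]; apply/andP; split.
    by apply/asboolP; exists g.
  by rewrite -gx; apply: gB.
exists rs; split.
- exact: filter_uniq.
- move=> x /rsP[g <-]; apply/fixed_fieldP; split; first exact: ga_in.
  move=> h Hh; have /fixed_fieldP[_ afix] := aM.
  have := afix _ (Hnorm h g Hh); rewrite /conjg !ga_mul => /(congr1 (ga g)).
  by rewrite gaVK // !ga_in.
- by apply/rsP; exists 1%g; rewrite ga_one.
- have rsE : {subset rs <= E} by move=> x; rewrite mem_filter => /andP[_ /BE].
  pose rs' := [seq insubd (0 : subfield E) r | r <- rs].
  have rs'E : map val rs' = rs.
    by rewrite -map_comp -[RHS]map_id; apply/eq_in_map => r /rsE; apply: insubE.
  pose P := \prod_(r <- rs') ('X - r%:P).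
  have PE : map_poly (val : subfield E -> W) P = \prod_(r <- rs) ('X - r%:P).
    by rewrite -rs'E big_map map_prod_XsubC.
  apply/polyOverP => i; rewrite -PE coef_map; apply: (gal_fixed FE); first exact: subfield_valP.
  move=> g; rewrite -gaE; congr val.
  have gP : map_poly (gal_fun g) P = P.
    have -> : map_poly (gal_fun g) P = \prod_(r <- map g rs') ('X - r%:P).
      by rewrite /P map_prod_XsubC big_map.
    have urs' : uniq rs' by rewrite -(map_inj_uniq val_inj) rs'E filter_uniq.
    have sub : {subset map g rs' <= rs'}.
      move=> _ /mapP[x xrs ->]; rewrite -(mem_map val_inj) rs'E gaE; apply/rsP.
      have : val x \in rs by rewrite -rs'E mem_map //; exact: val_inj.
      by move=> /rsP[h <-]; exists (g * h)%g; rewrite ga_mul.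
    have ug : uniq (map g rs') by rewrite map_inj_uniq //; exact: bij_inj (gal_bij g).
    have [_ eqm] := uniq_min_size ug sub (eq_leq (esym (size_map _ _))).
    by apply: perm_big; apply: uniq_perm.
  by rewrite -[in RHS]gP coef_map.
Qed.

End Correspondence.

Section Separable.
Variables (W : fieldType) (s : {rmorphism W -> W}).
Implicit Types (K L M : sigmaSubfield s).

Lemma fixed_sigma K L (H : set (gal K L)) : galois_ext K L ->
  (forall g, H g -> H (gal_sigma g)) -> exists M : sigmaSubfield s, sfield M = fixed_field H.
Proof.
move=> KL Hs; suff stab : forall x, x \in fixed_field H -> s x \in fixed_field H.
  by exists (SigmaSubfield stab).
move=> x /fixed_fieldP[xL xfix]; apply/fixed_fieldP; split; first exact: sfieldP.
by move=> h Hh; rewrite -gal_sigmaP // xfix //; apply: Hs.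
Qed.

Lemma finite_ext_open K L (U : set (gal K L)) (M : divringClosed W) n :
  galois_ext K L -> generating U ->
  {subset K <= M} -> {subset M <= L} ->
  (forall g, level (@gal_sigma W s K L) U n g -> stab K L M g) -> finite_ext K M.
Proof.
move=> KL [Uexp _ _] KM ML UM; have [Q [q qP]] := level_fin Uexp n.
apply: (@bounded_finite_ext _ K M #|Q|) => // d b bM ind.
apply: (lin_indep_bound (q := q) KL ML) => // g h /qP/UM gh x xM.
by rewrite -[in LHS](gh x xM) -ga_mul mulVKg.
Qed.

Lemma open_finite_ext K L (U : set (gal K L)) (M : divringClosed W) : galois_ext K L -> generating U ->
  {subset M <= L} -> finite_ext K M ->
  exists n, forall g, level (@gal_sigma W s K L) U n g -> stab K L M g.
Proof.
move=> KL [Uexp Ufix _] ML [d [b bas]]; have [bM _ _] := bas; have [KLs _ _] := KL.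
have /choice[N NP] : forall i, exists n, forall g, level (@gal_sigma W s K L) U n g -> ga g (b i) = b i.
  by move=> i; apply: Ufix; apply: ML.
exists (\max_i N i) => g Ug x xM; have [c cK ->] := basis_exists bas xM.
rewrite ga_sum => [|i]; last by apply: rpredM; [exact: KLs|exact: ML].
apply: eq_bigr => i _; rewrite (gaM g (KLs _ (cK i)) (ML _ (bM i))) (ga_fix g KLs (cK i)) NP //.
by apply: level_le Ug; apply: leq_bigmax.
Qed.

Lemma basis_fixed K L (M : divringClosed W) d (b : 'I_d -> W) (g : gal K L) :
  {subset K <= L} -> {subset M <= L} -> is_basis K M b -> (forall i, ga g (b i) = b i) -> stab K L M g.
Proof.
move=> KLs ML bas gb x xM; have [bM _ _] := bas; have [c cK ->] := basis_exists bas xM.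
rewrite ga_sum => [|i]; last by apply: rpredM; [exact: KLs|exact: ML].
by apply: eq_bigr => i _; rewrite (gaM g (KLs _ (cK i)) (ML _ (bM i))) (ga_fix g KLs (cK i)) gb.
Qed.

(** If the s (b i) form a basis, g fixes M as soon as it fixes them, that is, as soon as g^s fixes
    M. Conversely, g |-> g^s is injective modulo the stabilizer of M, of finite index, hence
    surjective; applying suitable g to a relation between the s (b i) gives the same relation
    between the s (h (b i)) for every h, and [twisted_independence] concludes. *)
Lemma sigma_separable_stab K L (U : set (gal K L)) M : galois_ext K L -> generating U ->
  {subset K <= M} -> {subset M <= L} -> finite_ext K M ->
  sigma_separable K M <-> forall g, stab K L M (gal_sigma g) -> stab K L M g.
Proof.
move=> KL Ugen KM ML finM; have [d [b bas]] := finM; have [bM ind _] := bas.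
have [KLs _ _] := KL; have bL i : b i \in sfield L by apply: ML.
rewrite (sigma_separable_basis KM bas); split=> [sind g sg|stabM].
  have sbas := indep_full_basis bas (fun i => sfieldP (bM i)) sind.
  apply: basis_fixed KLs ML sbas _ => i.
  by rewrite -gal_sigmaP // sg.
have [n nP] := open_finite_ext KL Ugen ML finM.
have [Uexp _ _] := Ugen; have [Q [q qP]] := level_fin Uexp n.
have surj h : exists g, stab K L M ((gal_sigma g)^-1 * h)%g.
  have [||||g _ gh] := 
    @pigeonhole_surj _ Q q setT (fun x y => stab K L M (x^-1 * y)%g) (@gal_sigma W s K L) _ _ _ h.
  - by move=> x y _ _ /qP/nP.
  - by [].
  - move=> x y _ _ H; apply: stabM; rewrite gal_sigmaM //.
    by rewrite (endoV (gal_sigmaM KL)).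
  - by [].
  by exists g.
apply/lin_indepP => c cK sum0.
apply: (twisted_independence (t := s) KL bL ind) => h.
have [g gh] := surj h; have := congr1 (ga g) sum0; rewrite ga0 ga_sum => [E0|i]; last first.
  by apply: rpredM; [exact: KLs|apply: sfieldP; exact: bL].
rewrite -[RHS]E0; apply: eq_bigr => i _.
rewrite (gaM g (KLs _ (cK i)) (sfieldP (bL i))) (ga_fix g KLs (cK i)).
rewrite -gal_sigmaP //; congr (_ * s _).
by rewrite -[in RHS](gh (b i) (bM i)) -ga_mul mulVKg.
Qed.

End Separable.

Local Open Scope classical_set_scope.

(** * Extensions whose Galois group is a full shift *)

Section KrullTopology.
Import finmap.

Lemma gal_openE (W : fieldType) (F E : divringClosed W) (A : set (gal F E)) :
  open A <-> exists2 D : set (set (gal F E)), D `<=` finI_from (@krull_coset W F E) id &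
    \bigcup_(B in D) B = A.
Proof. by []. Qed.

Lemma krull_coset_open (W : fieldType) (F E : divringClosed W) (B : set (gal F E)) :
  krull_coset B -> open B.
Proof.
move=> kB; apply/gal_openE; exists [set B]; last by rewrite bigcup_set1.
move=> _ ->; exists [fset B]%fset; first by move=> C /fset1P ->; apply/mem_set.
apply/seteqP; split=> g; first by apply; rewrite /= fset11.
by move=> Bg C /= /fset1P ->.
Qed.

Lemma continuous_to_gal (W : fieldType) (F E : divringClosed W) (X : topologicalType)
    (f : X -> gal F E) : (forall B, krull_coset B -> open (f @^-1` B)) -> continuous f.
Proof.
move=> fB; apply/continuousP => _ /gal_openE[D DB <-].
rewrite preimage_bigcup; apply: bigcup_open => _ /DB[/= D' D'B <-].
rewrite openE => x /= xD'; rewrite /interior.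
have -> : f @^-1` (\bigcap_(i in [set` D']) i) = \bigcap_(i in [set` D']) (f @^-1` i) by [].
apply: filter_bigI => B BD'; apply: open_nbhs_nbhs; split; last exact: xD'.
by apply: fB; apply/set_mem/D'B.
Qed.

End KrullTopology.

Lemma continuous_to_shift (X : topologicalType) (T : finGroupType) (f : X -> full_shift T) :
  (forall x n, nbhs x [set y | f y n = f x n]) -> continuous f.
Proof.
move=> fn x; apply/pointwise_cvgP => n; apply/discrete_cvg.
exact: fn.
Qed.

Lemma cylinder_open (T : finGroupType) (t : full_shift T) k (A : set (full_shift T)) :
  (forall u : full_shift T, (forall i, (i < k)%N -> u i = t i) -> A u) -> nbhs t A.
Proof.
elim: k A => [|k IH] A Ak; first by apply: filterS (filterT : nbhs t setT) => u _; apply: Ak.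
have tk : nbhs t ((@proj nat (fun=> discrete_topology T) k) @^-1` [set t k]).
  by apply: proj_continuous; apply: discrete_set1.
have tA : nbhs t [set u : full_shift T | u k = t k -> A u].
  apply: IH => u ut uk; apply: Ak => i; rewrite ltnS leq_eqVlt => /predU1P[->//|/ut//].
by apply: filterS (filterI tk tA) => u [uk]; apply.
Qed.

Local Close Scope classical_set_scope.

Section ShiftGal.
Variables (W : fieldType) (s : {rmorphism W -> W}) (F E : sigmaSubfield s).

(* chi is the coordinate 0 of an isomorphism of gal F E with the full shift on T. *)
Record shiftgal (T : finGroupType) (chi : gal F E -> T) : Prop := ShiftGal {
  shg_M : forall g h, chi (g * h)%g = (chi g * chi h)%g;
  shg_open : exists2 l : seq W, {subset l <= sfield E} &
    forall g, stab F E (mem l) g -> chi g = 1%g;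
  shg_surj : forall t : nat -> T, exists g, forall i, chi (iter i (@gal_sigma W s F E) g) = t i;
  shg_sep : forall x, x \in sfield E -> exists k, forall g,
    (forall i, (i < k)%N -> chi (iter i (@gal_sigma W s F E) g) = 1%g) -> ga g x = x
}.

Hypothesis FE : galois_ext F E.
Variables (T : finGroupType) (chi : gal F E -> T).
Hypothesis chiP : shiftgal chi.
Local Notation sg := (@gal_sigma W s F E).
Let sgM : {morph sg : g h / (g * h)%g} := gal_sigmaM FE.
Let FEs : {subset F <= E}. Proof. by case: FE. Qed.

Let chi1 : chi 1%g = 1%g.
Proof. by apply: (mulgI (chi 1%g)); rewrite -(shg_M chiP) !mulg1. Qed.
Let chiV g : chi g^-1%g = (chi g)^-1%g.
Proof. by apply: (mulgI (chi g)); rewrite -(shg_M chiP) !mulgV chi1. Qed.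
Let chi_iterM i g h : chi (iter i sg (g * h)%g) = (chi (iter i sg g) * chi (iter i sg h))%g.
Proof. by rewrite (iter_endoM sgM) (shg_M chiP). Qed.
Let chi_iterV i g : chi (iter i sg g^-1%g) = (chi (iter i sg g))^-1%g.
Proof. by rewrite (iter_endoV sgM) chiV. Qed.
Let chi_iter1 i : chi (iter i sg 1%g) = 1%g.
Proof. by rewrite (iter_endo1 sgM) chi1. Qed.

Lemma shg_eq g h : (forall i, chi (iter i sg g) = chi (iter i sg h)) -> g = h.
Proof.
move=> gh; apply: mulVg_eq1; apply: ga_ext => x xE; rewrite ga_one //.
have [k kP] := shg_sep chiP xE; apply: kP => i _.
by rewrite chi_iterM chi_iterV gh mulVg.
Qed.

Lemma shg_sigma_surj n h : exists g, iter n sg g = h.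
Proof.
have [g gP] := shg_surj chiP (fun i => if (i < n)%N then 1%g else chi (iter (i - n) sg h)).
exists g; apply: shg_eq => i; rewrite -iterD gP addnC ltnNge leq_addr /=.
by rewrite addnC addnK.
Qed.

(** The product of the subgroups P i inside the full shift. *)
Definition shg_sub (P : nat -> {group T}) : set (gal F E) :=
  fun g => forall i, chi (iter i sg g) \in P i.

Lemma shg_sub_subgroup P : is_subgroup (shg_sub P).
Proof.
split=> [i|g h Pg Ph i|g Pg i]; first by rewrite chi_iter1 group1.
  by rewrite chi_iterM groupM.
by rewrite chi_iterV groupV.
Qed.

Lemma shg_sub_norm (P : nat -> {group T}) : (forall i, P i <| [set: T])%g ->
  forall h g, shg_sub P h -> shg_sub P (h ^ g)%g.
Proof.
move=> Pn h g Ph i; rewrite /conjg !chi_iterM chi_iterV -conjgE.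
by rewrite memJ_norm //; have /andP[_ /fintype.subsetP] := Pn i; apply; rewrite inE.
Qed.

Lemma shg_sub_stab P g : stab F E (fixed_field (shg_sub P)) g <-> shg_sub P g.
Proof.
apply: (stab_fixed_field FE (shg_sub_subgroup P)) => {}g app i.
have [l lE lP] := shg_open chiP.
have [|h Ph hg] := app [seq iter i s x | x <- l].
  by move=> _ /mapP[x /lE xE ->]; apply: sfield_iter.
have : chi (iter i sg (h^-1 * g)%g) = 1%g.
  apply: lP => x xl; apply/(stab_sigma FE); first exact: lE.
  rewrite ga_mul -hg ?map_f // gaK //; apply: sfield_iter; exact: lE.
by rewrite chi_iterM chi_iterV => /mulVg_eq1 <-; apply: Ph.
Qed.

Definition level_groups n (i : nat) : {group T} := if i == n then 1%G else [set: T]%G.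
(** The fixed field of the kernel of the n-th coordinate, so that its Galois group over F is T;
    [level_field 0] is the field M of the definition of [benign]. *)
Definition level_field n : divringClosed W := fixed_field (shg_sub (level_groups n)).

Lemma level_fieldP n g : stab F E (level_field n) g <-> chi (iter n sg g) = 1%g.
Proof.
rewrite /level_field shg_sub_stab; split=> [/(_ n)|gn i]; rewrite /level_groups.
  by rewrite eqxx => /set1gP.
by case: eqP => [->|_]; rewrite ?inE // gn.
Qed.

Lemma level_field_sub n : {subset level_field n <= E}.
Proof. exact: fixed_field_sub. Qed.

Lemma level_field_base n : {subset F <= level_field n}.
Proof. exact: fixed_field_base. Qed.

Lemma level_field_agree n g h x : chi (iter n sg g) = chi (iter n sg h) ->
  x \in level_field n -> ga g x = ga h x.
Proof.
move=> gh xn; have xE := level_field_sub xn.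
have /level_fieldP/(_ x xn) : chi (iter n sg (g^-1 * h)%g) = 1%g.
  by rewrite chi_iterM chi_iterV gh mulVg.
by rewrite ga_mul => /(congr1 (ga g)); rewrite gaVK ?ga_in.
Qed.

Lemma level_field_iter n x : x \in level_field 0 -> iter n s x \in level_field n.
Proof.
move=> x0; have xE := level_field_sub x0.
apply/fixed_fieldP; split; first exact: sfield_iter.
move=> h /(shg_sub_stab _)/level_fieldP hn; apply/(stab_sigma FE) => //.
exact: ((level_fieldP 0 (iter n sg h)).2 hn _ x0).
Qed.

Lemma level_field_galois n : galois_ext F (level_field n).
Proof.
apply: (fixed_field_galois FE); apply: shg_sub_norm => i; rewrite /level_groups.
by case: eqP => _; [exact: normal1|exact: normal_refl].
Qed.

Lemma level_field_finite n : finite_ext F (level_field n).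
Proof.
apply: (@bounded_finite_ext _ F (level_field n) #|T|); first exact: level_field_base.
move=> d b bM ind; apply: (lin_indep_bound (q := fun g => chi (iter n sg g)) FE _ _ bM ind).
  exact: level_field_sub.
by move=> g h gh x xn; apply: level_field_agree gh xn.
Qed.

Lemma adjoin_iter_sub n : {subset adjoin_iter s F (level_field 0) n <= level_field n}.
Proof.
move=> x /asboolP; apply; first exact: level_field_base.
by move=> _ [y /= y0 <-]; apply: level_field_iter.
Qed.

Lemma shg_generated : sfield E =i sigma_adjoin s F [set x | x \in level_field 0].
Proof.
move=> x; apply/idP/asboolP => [xE M FM AM|]; last first.
  apply=> [|_ [n _ [y /= y0 <-]]]; first exact: FEs.
  by apply: sfield_iter; exact: level_field_sub y0.
have [||| X XP] := @divring_of W (fun y => y \in M /\ y \in sfield E).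
- by split; apply: rpred1.
- by move=> y z [yM yE] [zM zE]; split; apply: rpredB.
- by move=> y z [yM yE] [zM zE]; split; apply: rpred_div.
suff : x \in X by move/XP => [].
apply: (stab_fixed FE) => //.
- by move=> y yF; apply/XP; split; [exact: FM|exact: FEs].
- by move=> y /XP[].
move=> g gX; have [k kP] := shg_sep chiP xE; apply: kP => i _.
rewrite -[chi _]/(chi (iter 0 sg (iter i sg g))); apply/level_fieldP => y y0.
have yE := level_field_sub y0.
apply/(stab_sigma FE) => //; apply: gX; apply/XP; split; last exact: sfield_iter.
by apply: AM; exists i => //; exists y.
Qed.

(** Every h is the n-th iterate under s of some g, because a full shift is surjective. Applying g to
    a relation between the s^n (b i) replaces b i by h (b i), and [twisted_independence] applies. *)
Lemma level_field_basis n d (b : 'I_d -> W) : is_basis F (level_field 0) b ->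
  is_basis F (adjoin_iter s F (level_field 0) n) (fun i => iter n s (b i)).
Proof.
move=> bas; have [b0 ind span] := bas.
have bE i : b i \in sfield E by apply: level_field_sub.
have [t tE] := iter_rmorphism s n.
have sFF c : c \in sfield F -> iter n s c \in sfield F by apply: sfield_iter.
have iind : lin_indep F (fun i => iter n s (b i)).
  apply/lin_indepP => c cF sum0; apply: (twisted_independence (t := t) FE bE ind) => h.
  have [g gh] := shg_sigma_surj n h.
  have sE i : iter n s (b i) \in sfield E by apply: sfield_iter.
  have := congr1 (ga g) sum0; rewrite ga0 ga_sum => [E0|i]; last first.
    by apply: rpredM => //; apply: FEs.
  rewrite -[RHS]E0; apply: eq_bigr => i _.
  rewrite (gaM g (FEs (cF i)) (sE i)) (ga_fix g FEs (cF i)) tE -gh.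
  by rewrite (iter_gal_sigmaP FE).
apply: basisP => // [i|x xA].
  by apply/asboolP => M _ AM; apply: AM; exists (b i) => //; exact: b0.
(* The span S is closed under products because the products of the b i are again combinations of
   them, and under inverses by [inverse_polynomial]; so it is a field and contains the
   adjunction. *)
pose S y := exists2 c : 'I_d -> W, (forall i, c i \in sfield F) & y = \sum_i c i * iter n s (b i).
have S0 : S 0 by exists (fun=> 0) => [i|]; [exact: rpred0|rewrite big1 // => i _; rewrite mul0r].
have SB y z : S y -> S z -> S (y - z).
  move=> [c cF ->] [c' c'F ->]; exists (fun i => c i - c' i) => [i|]; first exact: rpredB.
  by rewrite -sumrB; apply: eq_bigr => i _; rewrite mulrBl.
have SZ a y : a \in sfield F -> S y -> S (a * y).
  move=> aF [c cF ->]; exists (fun i => a * c i) => [i|]; first exact: rpredM.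
  by rewrite mulr_sumr; apply: eq_bigr => i _; rewrite mulrA.
have SD y z : S y -> S z -> S (y + z).
  move=> Sy Sz; have -> : y + z = y - (-1 * z) by rewrite mulN1r opprK.
  by apply: (SB) => //; apply: SZ => //; rewrite rpredN rpred1.
have Sum (I : finType) (f : I -> W) : (forall i, S (f i)) -> S (\sum_i f i).
  by move=> Sf; apply: (big_ind S) => // i _.
have SM0 y : y \in level_field 0 -> S (iter n s y).
  move=> /(basis_exists bas)[c cF ->]; exists (fun i => iter n s (c i)) => [i|]; first exact: sFF.
  by rewrite -tE rmorph_sum; apply: eq_bigr => i _; rewrite rmorphM !tE.
have SM y z : S y -> S z -> S (y * z).
  move=> [c cF ->] [c' c'F ->]; rewrite mulr_suml; apply: (Sum) => i.
  rewrite mulr_sumr; apply: (Sum) => j; rewrite mulrACA.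
  by apply: SZ; [exact: rpredM|rewrite -iterRM; apply: SM0; exact: rpredM].
have SF a : a \in sfield F -> S a.
  move=> aF; rewrite -[a]mulr1; apply: SZ => //.
  by have := SM0 1 (rpred1 _); rewrite -tE rmorph1.
have SE y : S y -> y \in sfield E.
  by move=> [c cF ->]; apply: rpred_sum => i _; apply: rpredM; [exact: FEs|exact: sfield_iter].
have Sh (h : {poly W}) y : h \is a polyOver (sfield F) -> S y -> S h.[y].
  move=> /polyOverP hF Sy; rewrite horner_coef; apply: (Sum) => i; apply: SZ => //.
  by elim: (val i) => [|k IH]; rewrite ?exprS; [apply: SF; apply: rpred1|apply: SM].
have SV y : S y -> S y^-1.
  move=> Sy; have [->|yN0] := eqVneq y 0; first by rewrite invr0.
  have [q [h [_ hF qy inv]]] := inverse_polynomial FE (SE y Sy) yN0.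
  by rewrite inv //; apply: Sh.
have [||| M MP] := @divring_of W S.
- by apply: SF; apply: rpred1.
- exact: SB.
- by move=> y z Sy Sz; apply: SM => //; apply: SV.
apply/MP; move/asboolP: xA; apply=> [a aF|_ [y /= y0 <-]]; apply/MP; first exact: SF.
exact: SM0.
Qed.

Lemma level_field_degree n d :
  has_degree F (adjoin_iter s F (level_field 0) n) d <-> has_degree F (level_field 0) d.
Proof.
split=> [[b bas]|[b bas]]; last by exists (fun i => iter n s (b i)); apply: level_field_basis.
have [d' [b' bas']] := level_field_finite 0.
have bas'' := level_field_basis n bas'.
suff -> : d = d' by exists b'.
apply/eqP; rewrite eqn_leq; have [bA bi _] := bas; have [bA' bi' _] := bas''.
by rewrite (basis_size bas'' bA bi) (basis_size bas bA' bi').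
Qed.

(** The h t represent all restrictions of automorphisms to [level_field n], so [dedekind] gives the
    matrix of the h t (b j) full column rank; B is a left inverse. *)
Lemma level_field_dual n d (b : 'I_d -> W) (h : T -> gal F E) :
  (forall t, chi (iter n sg (h t)) = t) -> (forall i, b i \in level_field n) -> lin_indep F b ->
  exists B : 'I_d -> T -> W, forall i j, \sum_t B i t * ga (h t) (b j) = (i == j)%:R.
Proof.
move=> hP bn ind; have bE i : b i \in sfield E by apply: level_field_sub (bn i).
pose A : 'M[subfield E]_(#|T|, d) := \matrix_(i, j) insubd 0 (ga (h (enum_val i)) (b j)).
have /row_fullP[B BA] : row_full A.
  rewrite /row_full eqn_leq rank_leq_col /= leqNgt; apply/negP.
  move=> /cokermx_col[c [j cj] cP].
  suff: subfield_val (c j) = 0 by move/(@val_inj _ _ _ (c j) 0)/eqP; rewrite (negPf cj).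
  apply: (dedekind (F := F) (E := E) (b := b) (c := fun j => subfield_val (c j))) => // [i|k].
    exact: subfield_valP.
  have /cP/(congr1 (@subfield_val _ _)) := row_sub (enum_rank (chi (iter n sg k))) A.
  rewrite subfield_sum => sum0; rewrite -[RHS]sum0.
  apply: eq_bigr => i _; rewrite !mxE subfieldM mulrC subfield_insub ?ga_in // enum_rankK.
  by congr (_ * _); apply: level_field_agree (bn i); rewrite hP.
exists (fun i t => subfield_val (B i (enum_rank t))) => i j.
have /matrixP/(_ i j)/(congr1 (@subfield_val _ _)) := BA.
rewrite !mxE subfield_sum => BAij.
have -> : (i == j)%:R = subfield_val ((i == j)%:R : subfield E) :> W by case: (i == j).
rewrite -BAij [RHS](reindex (@enum_rank T)) /=; last exact: onW_bij (@enum_rank_bij T).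
by apply: eq_bigr => t _; rewrite !mxE ?subfieldM subfield_insub ?ga_in // enum_rankK.
Qed.

(** The coordinates of an automorphism can be prescribed independently ([glue]), so one relation
    between the products yields a relation for each way of conjugating the factors separately. *)
Lemma level_field_disjoint : lin_disjoint_family F (adjoin_iter s F (level_field 0)).
Proof.
move=> k e einj d b bA bind; apply/lin_indepP => c cF sum0 f0.
have bn j i : b j i \in level_field (e j) by apply: adjoin_iter_sub.
have bE j i : b j i \in sfield E by apply: level_field_sub (bn j i).
have /choice[h hP] : forall j : 'I_k, exists h : T -> gal F E, forall t, chi (iter (e j) sg (h t)) = t.
  move=> j; have /choice[h hP] : forall t, exists g, chi (iter (e j) sg g) = t.
    by move=> t; have [g gP] := shg_surj chiP (fun=> t); exists g.
  by exists h.
have [B BP] : exists B : forall j, 'I_(d j) -> T -> W,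
    forall j i i', \sum_t B j i t * ga (h j t) (b j i') = (i == i')%:R.
  have BP j := level_field_dual (hP j) (bn j) (bind j).
  by exists (fun j => projT1 (cid (BP j))) => j; exact: (projT2 (cid (BP j))).
have glue (r : {ffun 'I_k -> T}) : exists g, forall j, chi (iter (e j) sg g) = r j.
  have [g gP] := shg_surj chiP (fun n => if [pick j | e j == n] is Some j then r j else 1%g).
  exists g => j; rewrite gP; case: pickP => [j' /eqP/einj -> //|/(_ j)].
  by rewrite eqxx.
have sumr (r : {ffun 'I_k -> T}) : \sum_f c f * \prod_j ga (h j (r j)) (b j (f j)) = 0.
  have [g gP] := glue r; have := congr1 (ga g) sum0; rewrite ga0 ga_sum => [E0|f]; last first.
    by apply: rpredM; [exact: FEs|apply: rpred_prod => j _].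
  rewrite -[RHS]E0; apply: eq_bigr => f _.
  have pE : \prod_j b j (f j) \in sfield E by apply: rpred_prod.
  rewrite (gaM g (FEs (cF f)) pE) (ga_fix g FEs (cF f)); congr (_ * _).
  have ga_prod (l : seq 'I_k) : ga g (\prod_(j <- l) b j (f j)) = \prod_(j <- l) ga g (b j (f j)).
    elim: l => [|j l IH]; first by rewrite !big_nil ga1.
    by rewrite !big_cons gaM ?IH //; apply: rpred_prod.
  rewrite ga_prod; apply: eq_bigr => j _.
  by apply: level_field_agree (bn j (f j)); rewrite hP gP.
(* Summed against the products of the dual families, the relations factor over j and only c f0
   survives. *)
have : \sum_(r : {ffun 'I_k -> T}) (\prod_j B j (f0 j) (r j)) *
    (\sum_f c f * \prod_j ga (h j (r j)) (b j (f j))) = 0.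
  by rewrite big1 // => r _; rewrite sumr mulr0.
under eq_bigr => r _ do rewrite mulr_sumr.
rewrite exchange_big /= => sum1; rewrite -[RHS]sum1.
have term f : \sum_(r : {ffun 'I_k -> T}) (\prod_j B j (f0 j) (r j)) *
    (c f * \prod_j ga (h j (r j)) (b j (f j))) = c f * (f0 == f)%:R.
  under eq_bigr => r _ do rewrite mulrCA -big_split.
  rewrite -mulr_sumr -(bigA_distr_bigA (fun j t => B j (f0 j) t * ga (h j t) (b j (f j)))) /=.
  congr (_ * _); under eq_bigr => j _ do rewrite BP.
  have [->|f0f] := eqVneq f0 f; first by rewrite big1 // => j _; rewrite eqxx.
  have [j fj] : exists j, f0 j != f j.
    apply/existsP; apply: contraNT f0f; rewrite negb_exists => /forallP H.
    by apply/eqP/ffunP => j; apply/eqP; have := H j; rewrite negbK.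
  by rewrite (bigD1 j) //= (negPf fj) mul0r.
under eq_bigr => f _ do rewrite term.
rewrite (bigD1 f0) //= eqxx mulr1 big1 ?addr0 // => f ff0.
by rewrite eq_sym (negPf ff0) mulr0.
Qed.

Theorem shiftgal_benign : benign F E.
Proof.
split=> //; exists (level_field 0); split.
- by split; [exact: level_field_base|exact: level_field_sub].
- by split; [exact: level_field_galois|exact: level_field_finite].
- exact: shg_generated.
- exact: level_field_degree.
- exact: level_field_disjoint.
Qed.

Theorem shiftgal_full_shift : gal_isog_full_shift F E T.
Proof.
pose phi (g : gal F E) : full_shift T := fun n => chi (iter n sg g).
have /choice[psi psiP] : forall t : full_shift T, exists g, phi g = t.
  by move=> t; have [g gP] := shg_surj chiP t; exists g; apply/funext.
have phiK : cancel phi psi.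
  by move=> g; apply: shg_eq => i; have := congr1 (fun u => u i) (psiP (phi g)).
exists phi, psi; split=> //.
- split.
    apply: continuous_to_shift => g n.
    pose B : set (gal F E) := [set h | forall x, val x \in level_field n -> h x = g x]%classic.
    have nB : nbhs g B.
      apply: open_nbhs_nbhs; split=> //; apply: krull_coset_open; exists g, (level_field n).
      by split=> //; [exact: level_field_sub|exact: level_field_galois|exact: level_field_finite].
    apply: filterS nB => h hB /=; rewrite /phi; symmetry; apply: mulVg_eq1.
    rewrite -chi_iterV -chi_iterM; apply/level_fieldP => x xn; have xE := level_field_sub xn.
    have /(congr1 val) := hB (Subfield xE) xn; rewrite !gaE /= => hgx.
    by rewrite ga_mul hgx gaK.
  apply: continuous_to_gal => _ [g [M [ME galM [d [b bas]] ->]]].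
  have [bM _ _] := bas.
  rewrite openE => t /= tB; rewrite /interior.
  have /choice[k kP] : forall i, exists k, forall g,
      (forall i, (i < k)%N -> chi (iter i sg g) = 1%g) -> ga g (b i) = b i.
    by move=> i; apply: (shg_sep chiP); apply: ME.
  apply: (cylinder_open (k := \max_i k i)) => u ut /= x xM; rewrite -(tB x xM).
  have /(_ (val x) xM) : stab F E M ((psi t)^-1 * psi u)%g.
    apply: (basis_fixed FEs ME bas) => i; apply: kP => j ltj.
    rewrite chi_iterM chi_iterV -[chi (iter j sg (psi t))]/(phi (psi t) j).
    rewrite -[chi (iter j sg (psi u))]/(phi (psi u) j) !psiP ut ?mulVg //.
    by apply: leq_trans ltj _; apply: leq_bigmax.
  rewrite ga_mul => /(congr1 (ga (psi t))); rewrite gaVK ?ga_in // -!gaE.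
  exact: val_inj.
- by move=> g h n; apply: chi_iterM.
- by move=> g n; rewrite /phi -iterSr.
Qed.

End ShiftGal.

Section Agree.
Variables (W : fieldType) (s : {rmorphism W -> W}).
Implicit Types (K L F E : sigmaSubfield s).

Lemma agree_sigma K L F E (X : {pred W}) (g : gal K L) (h : gal F E) n :
  galois_ext K L -> galois_ext F E -> {subset X <= sfield L} -> {subset X <= sfield E} ->
  (forall x, x \in X -> s x \in X) -> {in X, ga g =1 ga h} ->
  {in X, ga (iter n (@gal_sigma W s K L) g) =1 ga (iter n (@gal_sigma W s F E) h)}.
Proof.
move=> KL FE XL XE sX gh; elim: n => [|n IH] x xX; first exact: gh.
apply: (fmorph_inj s); rewrite /= (gal_sigmaP KL) ?XL // (gal_sigmaP FE) ?XE //.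
exact/IH/sX.
Qed.

End Agree.

(** * Splitting a full shift along a normal subgroup of its alphabet *)

Section Split.
Variables (W : fieldType) (s : {rmorphism W -> W}) (F E : sigmaSubfield s).
Hypothesis FE : galois_ext F E.
Variables (T : finGroupType) (chi : gal F E -> T).
Hypothesis chiP : shiftgal chi.
Variable D : {group T}.
Hypothesis nD : (D <| [set: T])%g.
Variable F1 : sigmaSubfield s.
Hypothesis F1E : sfield F1 = fixed_field (shg_sub chi (fun=> D)).
Local Notation sg := (@gal_sigma W s F E).
Let sgM : {morph sg : g h / (g * h)%g} := gal_sigmaM FE.
Let FEs : {subset F <= E}. Proof. by case: FE. Qed.

Lemma split_stab g : stab F E F1 g <-> forall i, chi (iter i sg g) \in D.
Proof. by rewrite F1E; exact: shg_sub_stab. Qed.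

Lemma split_base : {subset F <= F1}.
Proof. by rewrite F1E; exact: fixed_field_base. Qed.

Lemma split_sub : {subset F1 <= E}.
Proof. by rewrite F1E; exact: fixed_field_sub. Qed.

Lemma split_galois : galois_ext F F1.
Proof.
by rewrite F1E; apply: (fixed_field_galois FE); apply: (shg_sub_norm FE chiP) => i.
Qed.

Lemma split_galois_top : galois_ext F1 E.
Proof. exact: galois_tower FE split_base split_sub. Qed.

Let chi1 : chi 1%g = 1%g.
Proof. by apply: (mulgI (chi 1%g)); rewrite -(shg_M chiP) !mulg1. Qed.
Let chiV g : chi g^-1%g = (chi g)^-1%g.
Proof. by apply: (mulgI (chi g)); rewrite -(shg_M chiP) !mulgV chi1. Qed.
Let nDT t : t \in ('N(D))%g.
Proof. by have /andP[_ /fintype.subsetP] := nD; apply; rewrite inE. Qed.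

Let ext_ex (h : gal F F1) : exists g : gal F E, {in sfield F1, ga g =1 ga h}.
Proof. by have [g gP] := gal_extend h FE (fun x xF => xF) split_base split_sub; exists g. Qed.
Let ext (h : gal F F1) : gal F E := projT1 (cid (ext_ex h)).
Let extP h : {in sfield F1, ga (ext h) =1 ga h} := projT2 (cid (ext_ex h)).
Let restr_ex (g : gal F E) : exists h : gal F F1, {in sfield F1, ga h =1 ga g}.
Proof.
have [|h hP] := @gal_restrict W F E F F1 g split_galois split_sub; last by exists h.
by move=> x xF; apply: ga_fix.
Qed.

Let chiq (h : gal F F1) : coset_of D := coset D (chi (ext h)).
Let chiqE g h : {in sfield F1, ga g =1 ga h} -> chiq h = coset D (chi g).
Proof.
move=> gh; have /split_stab/(_ 0%N) /= : stab F E F1 (g^-1 * ext h)%g.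
  by move=> x xF; rewrite ga_mul extP // -gh // gaK // split_sub.
by rewrite (shg_M chiP) chiV => gD; rewrite -(coset_kerr (chi g) gD) mulKVg.
Qed.
Let chiq_iter g h i : {in sfield F1, ga g =1 ga h} ->
  chiq (iter i (@gal_sigma W s F F1) h) = coset D (chi (iter i sg g)).
Proof.
move=> gh; apply: chiqE; apply: agree_sigma => //; first exact: split_galois.
  exact: split_sub.
by move=> x; apply: sfieldP.
Qed.

Lemma shiftgal_quotient : exists chi' : gal F F1 -> coset_of D, shiftgal chi'.
Proof.
exists chiq; split.
- move=> g h; rewrite (@chiqE (ext g * ext h)%g).
    by rewrite (shg_M chiP) morphM ?nDT.
  by apply: gal_agree_mul => //; move=> x _; apply: ga_in.
(* The list must consist of elements of F1, which l need not do. It is replaced by a basis of the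
   fixed field of the open subgroup of all g with chi g in D; this field lies in F1 and is finite
   over F. *)
- have [l lE lP] := shg_open chiP.
  pose H : set (gal F E) := fun g => chi g \in D.
  have subH : is_subgroup H.
    split=> [|g h Hg Hh|g Hg]; first by rewrite /H chi1 group1.
      by rewrite /H (shg_M chiP) groupM.
    by rewrite /H chiV groupV.
  have HF1 : {subset fixed_field H <= F1}.
    move=> x /fixed_fieldP[xE xfix]; rewrite F1E; apply/fixed_fieldP; split=> // h hD.
    by apply: xfix; exact: (hD 0%N).
  have stabH g : stab F E (fixed_field H) g <-> H g.
    apply: (stab_fixed_field FE subH) => {}g app; have [h Hh hg] := app l lE.
    have : chi (h^-1 * g)%g = 1%g.
      by apply: lP => x xl; rewrite ga_mul -hg // gaK // lE.
    by rewrite (shg_M chiP) chiV /H => /mulVg_eq1 <-.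
  have [d [b bas]] : finite_ext F (fixed_field H).
    apply: (@bounded_finite_ext _ F (fixed_field H) #|T|); first exact: fixed_field_base.
    move=> d b bH ind; apply: (lin_indep_bound (q := chi) FE _ _ bH ind) => [|g h gh x xH].
      exact: fixed_field_sub.
    have /stabH/(_ x xH) : H (g^-1 * h)%g by rewrite /H (shg_M chiP) chiV gh mulVg.
    by rewrite ga_mul => /(congr1 (ga g)); rewrite gaVK ?ga_in.
  have [bH _ _] := bas; exists [seq b i | i <- enum 'I_d].
    by move=> _ /mapP[i _ ->]; apply: HF1.
  move=> h hb; rewrite (@chiqE (ext h)); last exact: extP.
  apply/coset_id; apply/stabH.
  apply: (basis_fixed FEs (fun x xH => split_sub (HF1 x xH)) bas) => i.
  by rewrite extP ?HF1 //; apply: hb; apply: map_f; rewrite mem_enum.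
- move=> t; have [g gP] := shg_surj chiP (fun i => fingroup.repr (set_of_coset (t i))).
  have [h hP] := restr_ex g; exists h => i.
  by rewrite (chiq_iter (g := g)) ?gP ?coset_reprK // => x xF; rewrite hP.
- move=> x xF1; have [k kP] := shg_sep chiP (split_sub xF1); exists k => h hk.
  (* The first k coordinates of [ext h] are only known to be in D. Dividing by g', which has the
     same first k coordinates and fixes F1, makes them trivial without changing the action on F1. *)
  have [g' g'P] := shg_surj chiP (fun i => if (i < k)%N then chi (iter i sg (ext h)) else 1%g).
  have g'D : stab F E F1 g'.
    apply/split_stab => i; rewrite g'P; case: ifP => // ltik.
    have := hk i ltik; rewrite (chiq_iter (g := ext h)); last exact: extP.
    by move=> /coset_idr; apply.
  have : ga (g'^-1 * ext h)%g x = x.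
    apply: kP => i ltik; rewrite (iter_endoM sgM) (iter_endoV sgM) (shg_M chiP) chiV g'P ltik.
    by rewrite mulVg.
  rewrite ga_mul extP // => /(congr1 (ga g')); rewrite gaVK; last by apply: split_sub; exact: ga_in.
  by rewrite g'D.
Qed.

Let wid_ex (h : gal F1 E) : exists g : gal F E, {in sfield E, ga g =1 ga h}.
Proof. by have [g gP] := gal_widen h FE split_base split_sub; exists g. Qed.
Let wid (h : gal F1 E) : gal F E := projT1 (cid (wid_ex h)).
Let widP h : {in sfield E, ga (wid h) =1 ga h} := projT2 (cid (wid_ex h)).
Let wid_eq g h : {in sfield E, ga g =1 ga h} -> wid h = g.
Proof. by move=> gh; apply: ga_ext => x xE; rewrite widP // gh. Qed.
Let wid_iter i h : wid (iter i (@gal_sigma W s F1 E) h) = iter i sg (wid h).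
Proof.
apply: wid_eq; apply: agree_sigma => //; first exact: split_galois_top.
by move=> x; apply: sfieldP.
Qed.
Let wid_stab h : stab F E F1 (wid h).
Proof. by move=> x xF; rewrite widP ?split_sub // ga_fix //; exact: split_sub. Qed.

Lemma shiftgal_sub : exists chi' : gal F1 E -> subg_of D, shiftgal chi'.
Proof.
have widD h : chi (wid h) \in D by have /split_stab/(_ 0%N) := wid_stab h.
have valD h : sgval (subg D (chi (wid h))) = chi (wid h) by rewrite subgK.
exists (fun h => subg D (chi (wid h))); split.
- move=> g h; apply: val_inj; rewrite /= !valD -(shg_M chiP); congr chi.
  by apply: wid_eq; apply: gal_agree_mul; [move=> x _; exact: ga_in|exact: widP|exact: widP].
- have [l lE lP] := shg_open chiP; exists l => // h hl; apply: val_inj; rewrite /= valD.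
  by apply: lP => x xl; rewrite widP ?lE // hl.
- move=> t; have [g gP] := shg_surj chiP (fun i => sgval (t i)).
  have gD : stab F E F1 g by apply/split_stab => i; rewrite gP; exact: subgP.
  have [|h hP] := @gal_restrict W F E F1 E g split_galois_top (fun x xE => xE).
    by move=> x xF; apply: gD.
  exists h => i; apply: val_inj; rewrite /= valD wid_iter -(gP i); congr (chi (iter i _ _)).
  by apply: wid_eq => x xE; rewrite hP.
- move=> x xE; have [k kP] := shg_sep chiP xE; exists k => h hk.
  rewrite -widP //; apply: kP => i /hk/(congr1 val).
  by rewrite /= valD wid_iter.
Qed.

End Split.

Section Chains.
Variables (W : fieldType) (s : {rmorphism W -> W}).
Implicit Types (K L F E : sigmaSubfield s).

Inductive shift_chain K : sigmaSubfield s -> Prop :=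
| ShiftChainNil : shift_chain K K
| ShiftChainStep F E (T : finGroupType) : shift_chain K F ->
    {subset F <= E} -> benign F E -> simple [set: T] -> gal_isog_full_shift F E T ->
    shift_chain K E.

(** Induction on the order of T: the lower step has the simple group T / D, and the upper one has
    the smaller group D. The top field is E only up to [=i], because for T = 1 the field F is
    returned. *)
Lemma shift_chain_refine K F E (T : finGroupType) (chi : gal F E -> T) :
  galois_ext F E -> shiftgal chi -> shift_chain K F ->
  exists2 E', shift_chain K E' & sfield E' =i sfield E.
Proof.
have [n] := ubnP #|T|; elim: n T F chi => // n IH T F chi; rewrite ltnS => leT FE chiP KF.
have [T1|ntT] := eqVneq [set: T] 1%g.
  have [FEs _ _] := FE; exists F => // x; apply/idP/idP => [/FEs//|xE].
  apply: (gal_fixed FE xE) => g; have [k kP] := shg_sep chiP xE; apply: kP => i _.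
  by apply/set1gP; rewrite -T1 inE.
have [D maxD] := ex_maxnormal_ntrivg ntT.
have nD := maxnormal_normal maxD.
have [|F1 F1E] := @fixed_sigma W s F E (shg_sub chi (fun=> D)) FE.
  by move=> g Dg i; rewrite -iterSr; exact: (Dg i.+1).
have [chi1 chi1P] := shiftgal_quotient FE chiP nD F1E.
have [chi2 chi2P] := shiftgal_sub FE chiP F1E.
have FF1 := split_galois FE chiP nD F1E.
have F1E' := split_galois_top FE F1E.
apply: (IH _ F1 chi2) => //.
  apply: leq_trans leT; rewrite -[#|subg_of D|]cardsT -(card_isog (isog_subg D)).
  by rewrite -[#|T|]cardsT; apply: proper_card; exact: maxnormal_proper maxD.
apply: (ShiftChainStep KF) (split_base FE F1E) (shiftgal_benign FF1 chi1P) _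
  (shiftgal_full_shift FF1 chi1P).
have -> : [set: coset_of D] = ([set: T] / D)%g.
  apply/setP => u; rewrite inE; apply/esym; have [x Nx ->] := cosetP u.
  by apply: mem_quotient; rewrite inE.
by rewrite quotient_simple.
Qed.

End Chains.

(** * Existence of the chain *)

Lemma open_closed (G : groupType) (s : G -> G) (U P : set G) :
  is_subgroup P -> open_set s U P -> closed_set s U P.
Proof.
move=> Psub [n nP] x /(_ n)[h Ph /nP Phx].
by rewrite -[x](mulKVg h); apply: (subM Psub).
Qed.

Section Quotients.
Variables (W : fieldType) (s : {rmorphism W -> W}).
Implicit Types (K L F E M : sigmaSubfield s).

(** With n from [closed_quotient_level], the fixed field of the open subgroup P = N U_n is finite
    over K, and a basis of it generates M: an automorphism g that fixes all the s^k (b i) has all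
    its iterates under s in P, so g is in N. *)
Lemma quotient_finitely_generated K L (U N : set (gal K L)) M : galois_ext K L -> generating U ->
  is_subgroup N -> closed_set (@gal_sigma W s K L) U N -> (forall x, N x -> N (gal_sigma x)) ->
  sfield M = fixed_field N -> sigma_finitely_generated K M.
Proof.
move=> KL Ugen Nsub Ncl Nst MN; have [Uexp _ _] := Ugen; have [KLs _ _] := KL.
have [n nP] := closed_quotient_level Uexp Nsub Ncl Nst.
pose sg := @gal_sigma W s K L.
have Usub := level_sub Uexp n.
pose P : set (gal K L) := fun x => exists2 h, N h & level sg U n (h^-1 * x)%g.
have Psub : is_subgroup P.
  split=> [|x y [h Nh hx] [k Nk ky]|x [h Nh hx]].
  - by exists 1%g; [exact: (sub1 Nsub)|rewrite invg1 mulg1; exact: (sub1 Usub)].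
  - exists (h * k)%g; first exact: (subM Nsub).
    have -> : ((h * k)^-1 * (x * y) = (h^-1 * x) ^ k * (k^-1 * y))%g.
      by rewrite /conjg invMg !mulgA mulgK.
    by apply: (subM Usub) => //; exact: (level_norm Uexp).
  - exists h^-1%g; first exact: (subV Nsub).
    have -> : (h^-1^-1 * x^-1 = ((h^-1 * x)^-1) ^ h^-1)%g.
      by rewrite /conjg invMg !invgK !mulgA mulgK.
    by apply: (level_norm Uexp); exact: (subV Usub).
have Pcl : closed_set sg U P.
  apply: open_closed => //; exists n => x xn; exists 1%g; first exact: (sub1 Nsub).
  by rewrite invg1 mul1g.
have stabP := fix_closed KL Ugen Psub Pcl.
have KM : {subset K <= fixed_field P} by exact: fixed_field_base.
have ML := @fixed_field_sub W K L P.
have [d [b bas]] : finite_ext K (fixed_field P).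
  apply: (finite_ext_open (n := n) KL Ugen KM ML) => g gn x /fixed_fieldP[_]; apply.
  by exists 1%g; [exact: (sub1 Nsub)|rewrite invg1 mul1g].
have [bP _ _] := bas.
have PM : {subset fixed_field P <= sfield M}.
  move=> x /fixed_fieldP[xL xfix]; rewrite MN; apply/fixed_fieldP; split=> // h Nh.
  by apply: xfix; exists h => //; rewrite mulVg; exact: (sub1 Usub).
have KsM : {subset K <= sfield M} by rewrite MN; exact: fixed_field_base.
exists (codom b) => x; apply/idP/asboolP => [xM D KD bD|].
  have xL : x \in sfield L by move: xM; rewrite MN => /fixed_field_sub.
  have [|||M1 M1P] := @divring_of W (fun y => y \in sfield L /\ y \in D).
  - by rewrite !rpred1.
  - by move=> y z [yL yD] [zL zD]; rewrite !rpredB.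
  - by move=> y z [yL yD] [zL zD]; rewrite !rpred_div.
  have /M1P[] // : x \in M1.
  apply: (stab_fixed KL _ _ xL) => [y yK|y /M1P[]//|g gM1].
    by apply/M1P; rewrite KLs ?KD.
  move: xM; rewrite MN => /fixed_fieldP[_]; apply; apply: nP => k.
  apply: stabP; apply: (basis_fixed KLs ML bas) => i.
  apply/(stab_sigma KL); first exact: ML.
  apply: gM1; apply/M1P; split; first by apply: sfield_iter; exact: ML.
  by apply: bD; exists k => //; exists (b i) => //=; exact: codom_f.
move=> /(_ (sfield M) KsM); apply=> _ [k _ [_ /= /codomP[i ->] <-]].
by apply: sfield_iter; apply: PM.
Qed.

Definition sigma_surjective K L := forall h : gal K L, exists g, gal_sigma g = h.

(** Finiteness of M expressed as openness of its stabilizer, a form that is transported by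
    restricting automorphisms when K or L changes. *)
Definition open_field K L M := exists2 l : seq W, {subset l <= sfield L} &
  forall g, stab K L (mem l) g -> stab K L M g.

(* By [sigma_separable_stab], this says that pi_0 of L/K is K. *)
Definition sigma_connected K L := forall M : sigmaSubfield s,
  {subset K <= M} -> {subset M <= L} -> open_field K L M ->
  (forall g, stab K L M (gal_sigma g) -> stab K L M g) -> {subset M <= K}.

Lemma gal_restrict_sigma K L F E (g : gal K L) : galois_ext K L -> galois_ext F E ->
  {subset E <= L} -> {in F, forall x, ga g x = x} ->
  exists2 h : gal F E, {in E, ga h =1 ga g} & {in E, ga (gal_sigma h) =1 ga (gal_sigma g)}.
Proof.
move=> KL FE EL gF; have [h hg] := gal_restrict FE EL gF; exists h => //.
by apply: (agree_sigma 1 FE KL) => // x; exact: sfieldP.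
Qed.

Lemma connected_sub K L E : galois_ext K L -> galois_ext K E -> {subset E <= L} ->
  sigma_connected K L -> sigma_connected K E.
Proof.
move=> KL KE EL con M KM ME [l lE lM] Ms; have [KLs _ _] := KL.
have ML : {subset M <= L} by move=> x /ME/EL.
have restr (g : gal K L) := gal_restrict_sigma (g := g) KL KE EL (fun x xK => ga_fix g KLs xK).
apply: con => //.
  exists l => [x /lE/EL//|g gl x xM]; have [h hg _] := restr g.
  by rewrite -hg ?ME // lM // => y yl; rewrite hg ?lE // gl.
move=> g sgM x xM; have [h hg shg] := restr g; rewrite -hg ?ME //; apply: Ms xM => y yM.
by rewrite shg ?ME // sgM.
Qed.

(** Surjectivity is assumed only up to the action on E, since in [connected_chain] it holds only
    modulo ker s^j. *)
Lemma surjective_sub K L E : galois_ext K L -> galois_ext K E -> {subset E <= L} ->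
  (forall h : gal K L, exists g : gal K L, {in E, ga (gal_sigma g) =1 ga h}) -> sigma_surjective K E.
Proof.
move=> KL KE EL surj h; have [KLs _ _] := KL; have [KEs _ _] := KE.
have [h' h'h] := gal_extend h KL (fun x xK => xK) KEs EL.
have [g gh'] := surj h'.
have [g' _ sg'] := gal_restrict_sigma (g := g) KL KE EL (fun x xK => ga_fix g KLs xK).
by exists g'; apply: ga_ext => x xE; rewrite sg' // gh' // h'h.
Qed.

Lemma connected_shift_connected K L (U : set (gal K L)) : galois_ext K L -> generating U ->
  sigma_connected K L -> shift_connected (@gal_sigma W s K L) U.
Proof.
move=> KL Ugen con H Hsub Hop Hs; have [KLs _ _] := KL; have [_ _ lev] := Ugen.
have stabH : forall g, (forall x, x \in fixed_field H -> ga g x = x) -> H g.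
  exact: fix_closed KL Ugen Hsub (open_closed Hsub Hop).
have [|M MH] := fixed_sigma (H := H) KL; first by move=> g /Hs.
have HM g : stab K L M g <-> H g.
  by rewrite MH; split=> [gfix|Hg x /fixed_fieldP[_]]; [exact: stabH|apply].
move=> g; apply/HM => x xM; apply: (ga_fix g KLs); move: x xM; apply: con.
- by rewrite MH; exact: fixed_field_base.
- by rewrite MH; exact: fixed_field_sub.
- have [n nH] := Hop; have [l lL lP] := lev n; exists l => // h /lP/nH Hh; exact/HM.
- by move=> h /HM/Hs/HM.
Qed.

Lemma shift_subgroup_one (G : groupType) (sg : G -> G) (U : set G) (T : finGroupType)
    (N : set G) (chi : G -> T) : expansive sg U -> shift_subgroup sg U N chi ->
  forall x, N x -> (forall i, chi (iter i sg x) = 1%g) -> x = 1%g.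
Proof.
move=> Uexp NP x Nx chix; apply: (exp_sep Uexp) => n.
by have [k kP] := shs_sep NP n; apply: kP.
Qed.

Lemma shift_subgroup_eq (G : groupType) (sg : G -> G) (U : set G) (T : finGroupType)
    (N : set G) (chi : G -> T) : expansive sg U -> shift_subgroup sg U N chi ->
  forall x y, N x -> N y -> (forall i, chi (iter i sg x) = chi (iter i sg y)) -> x = y.
Proof.
move=> Uexp NP x y Nx Ny xy; have Nsub := shs_sub NP; have sgM := expM Uexp.
have Nit z i : N z -> N (iter i sg z) by elim: i => //= i IH /IH/(shs_stable NP).
have chiE z w i : N z -> N w -> chi (iter i sg (z * w)%g) = (chi (iter i sg z) * chi (iter i sg w))%g.
  by move=> Nz Nw; rewrite (iter_endoM sgM) (shs_M NP) //; apply: Nit.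
have chi1 : chi 1%g = 1%g.
  by apply: (mulgI (chi 1%g)); rewrite -(shs_M NP) ?mulg1 //; exact: (sub1 Nsub).
have NV := subV Nsub Nx.
apply: mulVg_eq1; apply: (shift_subgroup_one Uexp NP) => [|i]; first exact: (subM Nsub).
by rewrite chiE // -xy -chiE // mulVg (iter_endo1 sgM).
Qed.

End Quotients.

Section Existence.
Variables (W : fieldType) (s : {rmorphism W -> W}).
Implicit Types (K L F E M : sigmaSubfield s).

Lemma shiftgal_of_subgroup K L E (U N : set (gal K L)) (T : finGroupType) (chi : gal K L -> T) :
  galois_ext K L -> generating U -> shift_subgroup (@gal_sigma W s K L) U N chi ->
  {subset K <= E} -> {subset E <= L} -> sfield E =i fixed_field N ->
  exists chi' : gal E L -> T, shiftgal chi'.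
Proof.
move=> KL Ugen NP KE EL EN; have [Uexp Ufix lev] := Ugen.
have ELg := galois_tower KL KE EL; have sgM := gal_sigmaM KL.
have stabN g : stab K L E g <-> N g.
  split=> [gE|Ng x]; last by rewrite EN => /fixed_fieldP[_]; apply.
  apply: (fix_closed KL Ugen (shs_sub NP) (shs_closed NP)) => x xN.
  by apply: gE; rewrite EN.
have wid_ex (h : gal E L) : exists g : gal K L, {in sfield L, ga g =1 ga h}.
  by have [g gP] := gal_widen h KL KE EL; exists g.
have /choice[wid widP] := wid_ex.
have widN h : N (wid h).
  by apply/stabN => x xE; rewrite widP ?EL // ga_fix.
have wid_eq (g : gal K L) (h : gal E L) : {in sfield L, ga g =1 ga h} -> wid h = g.
  by move=> gh; apply: ga_ext => x xL; rewrite widP // gh.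
have wid_iter i h : wid (iter i (@gal_sigma W s E L) h) = iter i (@gal_sigma W s K L) (wid h).
  apply: wid_eq; apply: agree_sigma => //.
  by move=> x; exact: sfieldP.
exists (chi \o wid); split=> /=.
- move=> g h; rewrite -(shs_M NP) //; congr chi; apply: wid_eq.
  by apply: gal_agree_mul; [move=> x _; exact: ga_in|exact: widP|exact: widP].
- have [n nP] := shs_open NP; have [l lL lP] := lev n; exists l => // h hl.
  by apply: nP => //; apply/lP => x xl; rewrite widP ?lL // hl.
- move=> t; have [g Ng gP] := shs_surj NP t.
  have [|h hP] := @gal_restrict W K L E L g ELg (fun x xL => xL); first exact/stabN.
  exists h => i; rewrite wid_iter -(gP i); congr (chi (iter i _ _)).
  by apply: wid_eq => x xL; rewrite hP.
- move=> x xL; have [n nP] := Ufix x xL; have [k kP] := shs_sep NP n; exists k => h hk.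
  by rewrite -widP //; apply: nP; apply: kP => // i /hk; rewrite wid_iter.
Qed.

Lemma connected_shift_chain K k L (r : seq (gal K L)) : galois_ext K L ->
  sigma_finitely_generated K L -> sigma_connected K L -> sigma_surjective K L ->
  (size r <= k)%N -> (forall g : gal K L, gal_sigma g = 1%g -> g \in r) ->
  exists2 E, shift_chain K E & sfield E =i sfield L.
Proof.
elim: k L r => [|k IH] L r KL fgL con surj.
  rewrite leqn0 => /nilP-> /(_ 1%g (endo1 (gal_sigmaM KL))).
  by rewrite in_nil.
move=> szr kerr; have [KLs _ _] := KL.
have [U Ugen] := generating_exists KLs KL fgL; have [Uexp _ _] := Ugen.
have [nt|triv] := pselect (exists x : gal K L, x <> 1%g); last first.
  exists K; first exact: ShiftChainNil.
  move=> x; apply/idP/idP => [/KLs//|xL]; apply: (gal_fixed KL xL) => g.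
  have -> : g = 1%g by apply: contrapT => g1; apply: triv; exists g.
  exact: ga_one.
have shc := connected_shift_connected KL Ugen con.
have [T [N [chi [[t t1] NP]]]] := exists_shift_subgroup Uexp shc surj nt.
have [Nsub Nnorm Ncl Nst NM _ Nsurj _] := NP.
have [M MN] := fixed_sigma KL Nst.
have ML : {subset M <= L} by rewrite MN; exact: fixed_field_sub.
have KsM : {subset K <= M} by rewrite MN; exact: fixed_field_base.
have KM : galois_ext K M by rewrite MN; exact: fixed_field_galois.
have stabN g : (forall x, x \in sfield M -> ga g x = x) -> N g.
  by rewrite MN; exact: fix_closed KL Ugen Nsub Ncl g.
have sgM : {morph (@gal_sigma W s K L) : g h / (g * h)%g} := gal_sigmaM KL.
have rst_ex (g : gal K L) : exists h : gal K M, {in M, ga h =1 ga g}.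
  have [h hP _] := gal_restrict_sigma (g := g) KL KM ML (fun x xK => ga_fix g KLs xK).
  by exists h.
have /choice[rst rstP] := rst_ex.
have rst_eq (g : gal K L) h : N (g^-1 * h)%g -> rst g = rst h.
  move=> Ngh; apply: ga_ext => x xM; rewrite !rstP //.
  move: (xM); rewrite MN => /fixed_fieldP[_ /(_ _ Ngh)]; rewrite ga_mul => ghx.
  by rewrite -{1}ghx gaVK // ga_in.
have [a [Na aker a1]] : exists a, [/\ N a, gal_sigma a = 1%g & a != 1%g].
  have [a Na aP] := Nsurj (fun i => if i is 0%N then t else 1%g).
  exists a; split=> //.
    by apply: (shift_subgroup_one Uexp NP) => [|i]; [exact: Nst|rewrite -iterSr aP].
  apply/eqP => aE; have := aP 0%N; rewrite /= aE => chi1; move: t1; rewrite -chi1.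
  rewrite (_ : chi 1%g = 1%g) ?eqxx //; apply: (mulgI (chi 1%g)).
  by rewrite -NM ?mulg1 //; exact: (sub1 Nsub).
have Nlift x : N x -> exists2 y, N y & gal_sigma y = x.
  move=> Nx; have [y Ny yP] := Nsurj (fun i =>
    if i is i'.+1 then chi (iter i' (@gal_sigma W s K L) x) else 1%g).
  exists y => //; apply: (shift_subgroup_eq Uexp NP) => // [|i]; first exact: Nst.
  by rewrite -iterSr yP.
have [|||||E chainE EM] := IH M [seq rst g | g <- r & g != a] KM.
- exact: quotient_finitely_generated KL Ugen Nsub Ncl Nst MN.
- exact: connected_sub KL KM ML con.
- by apply: surjective_sub KL KM ML _ => h; have [g <-] := surj h; exists g.
- rewrite size_map size_filter -ltnS; apply: leq_trans szr.
  rewrite -(count_predC (predC1 a) r) -[X in (X < _)%N]addn0 ltn_add2l -has_count.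
  by apply/hasP; exists a; [exact: kerr|rewrite /= negbK].
- move=> h h1; have [g gh] := gal_extend h KL (fun x xK => xK) KsM ML.
  have sg_N : N (gal_sigma g).
    apply: stabN => x xM; have /(_ x xM) <- := agree_sigma 1 KM KL (fun x xM => xM) ML
      (fun x => @sfieldP _ _ M x) (fun x xM => esym (gh x xM)).
    by rewrite /= h1 ga_one.
  have [y Ny yg] := Nlift _ sg_N.
  have hE : h = rst (g * y^-1)%g.
    apply: ga_ext => x xM; rewrite rstP // ga_mul.
    have /fixed_fieldP[_ /(_ _ (subV Nsub Ny)) ->] : x \in fixed_field N by rewrite -MN.
    by rewrite gh.
  have kery : gal_sigma (g * y^-1)%g = 1%g by rewrite sgM (endoV sgM) yg mulgV.
  have [ga_eq|ga_neq] := eqVneq (g * y^-1)%g a.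
    rewrite hE ga_eq (_ : rst a = rst 1%g); last first.
      by apply: rst_eq; rewrite mulg1; exact: (subV Nsub).
    apply: map_f; rewrite mem_filter eq_sym a1 /=; apply: kerr.
    exact: endo1 sgM.
  by rewrite hE; apply: map_f; rewrite mem_filter ga_neq kerr.
have EL : {subset E <= L} by move=> x; rewrite EM => /ML.
have KE : {subset K <= E} by move=> x /KsM; rewrite EM.
have EN : sfield E =i fixed_field N by move=> x; rewrite EM MN.
have [chi' chi'P] := shiftgal_of_subgroup KL Ugen NP KE EL EN.
exact: shift_chain_refine (galois_tower KL KE EL) chi'P chainE.
Qed.

Lemma shift_chain_indexed K E : shift_chain K E ->
  exists m (C : nat -> sigmaSubfield s) (G : nat -> finGroupType),
  [/\ C 0%N = K, C m = E & forall i, (i < m)%N ->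
    [/\ {subset C i <= C i.+1}, benign (C i) (C i.+1), simple [set: G i] &
        gal_isog_full_shift (C i) (C i.+1) (G i)]].
Proof.
elim=> [|F E' T chF [m [C [G [C0 Cm step]]]] FE ben simT iso].
  (* Without steps, any finite group serves as default value. *)
  by exists 0%N, (fun=> K), (fun=> {perm bool} : finGroupType).
exists m.+1, (fun i => if (i <= m)%N then C i else E'), (fun i => if (i < m)%N then G i else T).
split=> //; first by rewrite ltnn.
move=> i; rewrite ltnS leq_eqVlt => /orP[/eqP ->|ltim].
  by rewrite eqxx ltnn Cm.
by rewrite ltim orbT; exact: step.
Qed.

End Existence.

Lemma generating_list_open (W : fieldType) (s : {rmorphism W -> W}) (K L : sigmaSubfield s)
    (U : set (gal K L)) (l : seq W) : generating U -> {subset l <= sfield L} ->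
  exists n, forall g, level (@gal_sigma W s K L) U n g -> stab K L (mem l) g.
Proof.
move=> [_ Ufix _]; elim: l => [|x l IH] lL; first by exists 0%N.
have [|n nP] := IH; first by move=> y yl; apply: lL; rewrite in_cons yl orbT.
have [m mP] := Ufix x (lL x (mem_head _ _)); exists (maxn m n) => g Ug y.
rewrite in_cons => /predU1P[->|]; first by apply: mP; exact: level_le (leq_maxl _ _) Ug.
by apply: nP; exact: level_le (leq_maxr _ _) Ug.
Qed.

Section Top.
Variables (W : fieldType) (s : {rmorphism W -> W}) (K L : sigmaSubfield s).
Hypotheses (KL : galois_ext K L) (fgL : sigma_finitely_generated K L).
Let KLs : {subset K <= L}. Proof. by case: KL. Qed.
Local Notation sg := (@gal_sigma W s K L).

Lemma sigma_finitely_generated_over F : {subset K <= sfield F} -> {subset sfield F <= sfield L} ->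
  sigma_finitely_generated (F : sigmaSubfield s) L.
Proof.
move=> KF FL; have [A LA] := fgL; exists A => x; apply/idP/asboolP.
  rewrite LA => /asboolP xA M FM AM; apply: xA => // y /KF; exact: FM.
move=> /(_ (sfield L) FL); apply=> _ [n _ [a /= aA <-]]; apply: sfield_iter.
by rewrite LA; apply/asboolP => M _; apply; exists 0%N => //; exists a.
Qed.

Lemma pi0_stab (U : set (gal K L)) M : generating U ->
  {subset K <= sfield M} -> {subset sfield M <= sfield L} ->
  finite_ext K M -> sigma_separable K M ->
  forall g, stab K L M (sg g) <-> stab K L M g.
Proof.
move=> Ugen KM ML finM /(sigma_separable_stab KL Ugen KM ML finM) sepM g; split; first exact: sepM.
by move=> gM x xM; apply/(stab_sigma KL 1 g (ML x xM)); apply: gM; exact: sfieldP.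
Qed.

(** L1 is the fixed field of G0, which is open by [stable_open_bound]; [sigma_separable_stab]
    translates finite sigma-separable fields into open H with s^-1 H = H. For connectedness of L
    over L1, an M to be excluded has a stabilizer in the whole group that is again such an H: if g^s
    fixes M, then g^s and hence g are in G0, so the condition over L1 applies to g. *)
Lemma pi0_exists : exists L1 : sigmaSubfield s,
  [/\ {subset K <= L1}, {subset L1 <= L}, [set x | x \in L1]%classic = pi0_sigma K L &
      sigma_connected L1 L].
Proof.
have [U Ugen] := generating_exists KLs KL fgL; have [Uexp _ lev] := Ugen.
have [n0 [_ n0P]] := stable_open_bound Uexp.
pose inv_open (H : set (gal K L)) := [/\ is_subgroup H, open_set sg U H & forall g, H (sg g) <-> H g].
pose G0 : set (gal K L) := fun g => forall H, inv_open H -> H g.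
have G0sub : is_subgroup G0.
  split=> [H [Hs _ _]|x y Gx Gy H HH|x Gx H HH]; first exact: (sub1 Hs).
    by have [Hs _ _] := HH; apply: (subM Hs); [exact: Gx|exact: Gy].
  by have [Hs _ _] := HH; apply: (subV Hs); exact: Gx.
have G0n g : level sg U n0 g -> G0 g.
  by move=> gn H [_ Ho Hs]; apply: n0P gn => // x /Hs.
have G0s g : G0 (sg g) <-> G0 g.
  split=> Gg H HH; have [_ _ Hs] := HH; first by apply/Hs; exact: Gg.
  by apply/Hs; exact: Gg.
have G0cl : closed_set sg U G0 by apply: open_closed => //; exists n0.
have [L1 L1E] : exists M : sigmaSubfield s, sfield M = fixed_field G0.
  by apply: (fixed_sigma KL) => g /G0s.
have stabL1 g : stab K L L1 g <-> G0 g.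
  rewrite L1E; split=> [|Gg x /fixed_fieldP[_]]; last exact.
  exact: fix_closed KL Ugen G0sub G0cl g.
have KL1 : {subset K <= L1} by rewrite L1E; exact: fixed_field_base.
have L1L : {subset L1 <= L} by rewrite L1E; exact: fixed_field_sub.
have L1g := galois_tower KL KL1 L1L.
have inL1 (M : sigmaSubfield s) : {subset M <= L} -> inv_open (stab K L M) -> {subset M <= L1}.
  move=> ML HM x xM; rewrite L1E; apply/fixed_fieldP; split; first exact: ML.
  by move=> g /(_ _ HM); apply.
exists L1; split=> //.
  apply/seteqP; split=> x /=; last first.
    move=> [M [KM ML finM sepM xM]]; apply: inL1 xM => //; split; first exact: stab_sub.
      exact: open_finite_ext.
    exact: pi0_stab Ugen KM ML finM sepM.
  move=> xL1; exists L1; have finL1 : finite_ext K L1.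
    by apply: (finite_ext_open (n := n0) KL Ugen KL1 L1L) => g /G0n/stabL1.
  split=> //; apply/(sigma_separable_stab KL Ugen KL1 L1L finL1) => g /stabL1/G0s Gg.
  exact/stabL1.
move=> M L1M ML [l lL lM] sM.
have [l0 l0L l0P] := lev n0.
have restr (g : gal K L) (gL1 : stab K L L1 g) :=
  gal_restrict_sigma KL L1g (fun x xL => xL) gL1.
apply: inL1 => //; split; first exact: stab_sub.
  have [|n nP] := generating_list_open Ugen (l := l0 ++ l).
    by move=> x; rewrite mem_cat => /orP[/l0L|/lL].
  exists n => g /nP gl x xM.
  have [|h hg _] := restr g.
    by apply/stabL1; apply: G0n; apply/l0P => y yl; apply: gl; rewrite mem_cat yl.
  rewrite -hg ?ML // lM // => y yl; rewrite hg ?lL // gl //.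
  by rewrite mem_cat yl orbT.
move=> g; split=> gM; last first.
  by move=> x xM; apply/(stab_sigma KL 1 g (ML x xM)); apply: gM; exact: sfieldP.
have [|h hg shg] := restr g.
  have Gsg : G0 (sg g) by apply/stabL1 => x /L1M; exact: gM.
  by apply/stabL1; exact: (proj1 (G0s g) Gsg).
move=> x xM; rewrite -hg ?ML //; apply: sM xM => y yM.
by rewrite shg ?ML // gM.
Qed.

Lemma connected_chain L1 : {subset K <= sfield L1} -> {subset sfield L1 <= sfield L} ->
  sigma_connected L1 L -> exists E, [/\ shift_chain L1 E, {subset E <= L} & sigma_radicial E L].
Proof.
move=> KL1 L1L con; have L1g := galois_tower KL KL1 L1L.
have fg1 := sigma_finitely_generated_over KL1 L1L.
have [U Ugen] := generating_exists L1L L1g fg1; have [Uexp _ _] := Ugen.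
pose sg1 := @gal_sigma W s L1 L.
have sg1M : {morph sg1 : g h / (g * h)%g} := gal_sigmaM L1g.
have [j jP] := connected_image_stabilizes Uexp (connected_shift_connected L1g Ugen con).
(* As s^j G = s^(j+1) G, s is onto on G / N, the Galois group of the fixed field M of N. *)
pose N : set (gal L1 L) := fun g => iter j sg1 g = 1%g.
have Nsub : is_subgroup N.
  split=> [|x y Nx Ny|x Nx]; first exact: iter_endo1.
    by rewrite /N (iter_endoM sg1M) Nx Ny mulg1.
  by rewrite /N (iter_endoV sg1M) Nx invg1.
have Ncl : closed_set sg1 U N.
  move=> x xP; apply: (exp_sep Uexp) => n; have [h Nh hx] := xP (j + n)%N.
  have := level_iter hx; rewrite (iter_endoM sg1M) (iter_endoV sg1M).
  by rewrite (_ : iter j sg1 h = 1%g) // invg1 mul1g.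
have Nnorm h g : N h -> N (h ^ g)%g.
  by move=> Nh; rewrite /N (iter_endoJ Uexp) (_ : iter j sg1 h = 1%g) // conj1g.
have Nst g : N g -> N (sg1 g).
  by rewrite /N -iterSr /= => ->; exact: endo1.
have [M MN] := fixed_sigma L1g Nst.
have ML : {subset M <= L} by rewrite MN; exact: fixed_field_sub.
have L1M : galois_ext L1 M by rewrite MN; exact: fixed_field_galois.
have fgM := quotient_finitely_generated L1g Ugen Nsub Ncl Nst MN.
have conM := connected_sub L1g L1M ML con.
have surjM : sigma_surjective L1 M.
  apply: (surjective_sub L1g L1M ML) => h; have [y hy] := jP h; exists y => x xM.
  have : x \in fixed_field N by rewrite -MN.
  move=> /fixed_fieldP[xL /(_ (h^-1 * sg1 y)%g)]; rewrite ga_mul => hyx.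
  have /hyx/(congr1 (ga h)) : N (h^-1 * sg1 y)%g.
    by rewrite /N (iter_endoM sg1M) (iter_endoV sg1M) -iterSr -hy mulVg.
  by rewrite gaVK ?ga_in.
have [L1Ms _ _] := L1M.
have [U' Ugen'] := generating_exists L1Ms L1M fgM; have [Uexp' _ _] := Ugen'.
have [Q [q qP]] := level_fin Uexp' 1.
have sgM' : {morph (@gal_sigma W s L1 M) : g h / (g * h)%g} := gal_sigmaM L1M.
have [|r [_ rP]] := @finite_listing _ (fun g : gal L1 M => gal_sigma g = 1%g) Q q.
  move=> x y x1 y1 /qP xy; apply: mulVg_eq1; apply: (ker_level Uexp' xy).
  by rewrite /= sgM' (endoV sgM') x1 y1 invg1 mulg1.
have [|E chE EM] := @connected_shift_chain W s L1 (size r) M r L1M fgM conM surjM (leqnn _).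
  by move=> g g1; apply/rP.
exists E; split=> // x; first by rewrite EM => /ML.
(* For g in N, g (s^j x) is s^j applied to the image of x under the j-th iterate of g, which is
   1. *)
move=> xL; exists j; rewrite EM MN; apply/fixed_fieldP; split.
  exact: sfield_iter.
by move=> g Ng; rewrite -(iter_gal_sigmaP L1g) // Ng ga_one.
Qed.

End Top.

(** * Uniqueness of the chain *)

Section Uniqueness.
Variables (W : fieldType) (s : {rmorphism W -> W}) (K L : sigmaSubfield s).
Hypotheses (KL : galois_ext K L) (fgL : sigma_finitely_generated K L).
Let KLs : {subset K <= L}. Proof. by case: KL. Qed.
Local Notation sg := (@gal_sigma W s K L).

Lemma full_shift_epi (F E : sigmaSubfield s) (T : finGroupType) :
  {subset K <= F} -> {subset F <= E} -> {subset E <= L} -> galois_ext F E ->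
  gal_isog_full_shift F E T ->
  exists rho : gal K L -> nat -> T, shift_epi sg (stab K L F) (stab K L E) rho.
Proof.
move=> KF FE EL gFE [phi [psi [[phiK psiK] _ phiM phis]]].
have rst_ex (g : gal K L) : exists h : gal F E, stab K L F g ->
    {in E, ga h =1 ga g} /\ {in E, ga (gal_sigma h) =1 ga (sg g)}.
  have [gF|ngF] := pselect (stab K L F g); last by exists 1%g.
  by have [h hg shg] := gal_restrict_sigma KL gFE EL gF; exists h.
have /choice[rst rstP] := rst_ex.
have rst_eq (g : gal K L) (h : gal F E) : stab K L F g -> {in E, ga g =1 ga h} -> rst g = h.
  by move=> /rstP[gE _] gh; apply: ga_ext => x xE; rewrite gE // gh.
have phi1 n : phi 1%g n = 1%g :> T.
  by apply: (mulgI (phi 1%g n : T)); rewrite -phiM !mulg1.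
have Fsub := stab_sub K (fun x xF => EL x (FE x xF)).
exists (fun g => phi (rst g)); split=> [x y n xF yF|t|x|x n xF].
- rewrite -phiM; congr (phi _ n); apply: rst_eq; first exact: (subM Fsub).
  have [xE _] := rstP _ xF; have [yE _] := rstP _ yF => z zE.
  by rewrite !ga_mul xE ?ga_in // yE.
- have [g gE] := gal_extend (psi t) KL KF FE EL.
  have gF : stab K L F g by move=> x xF; rewrite gE ?FE // ga_fix.
  by exists g => // n; rewrite (rst_eq g (psi t)) // psiK.
- split=> [xE|[xF phix]].
    have xF : stab K L F x by move=> y /FE; exact: xE.
    split=> // n; rewrite (rst_eq x 1%g) // => y yE.
    by rewrite xE // ga_one.
  have x1 : rst x = 1%g.
    by rewrite -[LHS]phiK -[RHS]phiK; congr psi; apply: funext => n; rewrite phix phi1.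
  by move=> y yE; have [xy _] := rstP _ xF; rewrite -xy // x1 ga_one.
- rewrite -phis; congr (phi _ n); have [_ sxE] := rstP _ xF.
  apply: rst_eq => [y yF|y yE]; last by rewrite sxE.
  by apply/(stab_sigma KL 1 x); [exact/EL/FE|apply: xF; exact: sfieldP].
Qed.

(** A single r works for the finitely many generators a. If g fixes F, then its r-th iterate under s
    fixes all the s^n a, hence L. *)
Lemma radicial_nilpotent (F : sigmaSubfield s) : {subset K <= F} -> sigma_radicial F L ->
  exists r, forall g, stab K L F g -> iter r sg g = 1%g.
Proof.
move=> KF radF; have [A LA] := fgL.
have AL : {subset A <= sfield L}.
  by move=> a aA; rewrite LA; apply/asboolP => M _; apply; exists 0%N => //; exists a.
have [r rP] : exists r, forall a, a \in A -> iter r s a \in F.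
  elim: A AL {LA} => [|a A IH] AL; first by exists 0%N.
  have [|r rP] := IH; first by move=> x xA; apply: AL; rewrite in_cons xA orbT.
  have [n nP] := radF a (AL a (mem_head _ _)); exists (n + r)%N => x.
  rewrite in_cons => /predU1P[->|xA]; first by rewrite addnC iterD; exact: sfield_iter.
  by rewrite iterD; apply: sfield_iter; exact: rP.
exists r => g gF; apply: ga_ext => x xL; rewrite ga_one //.
have /fixed_fieldP[_] : x \in fixed_field (fun h => h = iter r sg g); last exact.
move: xL; rewrite {1}LA => /asboolP; apply=> [y yK|_ [n _ [a aA <-]]].
  exact: fixed_field_base.
have aL : iter n s a \in sfield L by apply: sfield_iter; exact: AL.
apply/fixed_fieldP; split=> // _ ->; apply/(stab_sigma KL) => //.
by apply: gF; rewrite -iterD addnC iterD; apply: sfield_iter; exact: rP.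
Qed.

(** Passing to stabilizers in the fixed group of L over K makes two chains comparable, although
    their intermediate Galois groups are unrelated types. *)
Lemma benign_chain_series m (C : 'I_m.+1 -> sigmaSubfield s) (G : 'I_m -> finGroupType) :
  benign_chain K L C G -> shift_series sg G (fun k => stab K L (C (inord k))).
Proof.
move=> [CKL C0 step rad]; have CL i : {subset C i <= L} by have [] := CKL i.
have CK i : {subset K <= C i} by have [] := CKL i.
have in0 (i : 'I_m) : inord i = widen_ord (leqnSn m) i.
  by apply: val_inj; rewrite /= inordK // ltnW // ltnS.
have in1 (i : 'I_m) : inord i.+1 = lift ord0 i.
  by apply: val_inj; rewrite /= inordK // ltnS.
split=> [i _|i _ x xC y yC|i|i|].
- exact: stab_sub.
- by apply/(stab_sigma KL 1 x); [exact: CL yC|apply: xC; exact: sfieldP].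
- by have [_ _] := step i.
- have [sub [gal12 _] _ iso] := step i; rewrite in0 in1; exact: full_shift_epi.
- have [r rP] := radicial_nilpotent (CK ord_max) rad; exists r => x xC; apply: rP.
  by move: xC; rewrite (_ : inord m = ord_max) //; apply: val_inj; rewrite /= inordK.
Qed.

End Uniqueness.

Theorem theorem7p5 (W : fieldType) (s : {rmorphism W -> W})
    (K L : sigmaSubfield s) :
  {subset K <= L} ->
  sigma_finitely_generated K L ->
  galois_ext K L ->
  (exists (m : nat) (C : 'I_m.+1 -> sigmaSubfield s)
          (G : 'I_m -> finGroupType),
     benign_chain K L C G)
  /\
  (forall (m : nat) (C : 'I_m.+1 -> sigmaSubfield s)
          (G : 'I_m -> finGroupType)
          (m' : nat) (C' : 'I_m'.+1 -> sigmaSubfield s)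
          (G' : 'I_m' -> finGroupType),
     benign_chain K L C G -> benign_chain K L C' G' ->
     m = m' /\
     exists2 p : 'I_m -> 'I_m', bijective p &
       forall i, [set: G i]%G \isog [set: G' (p i)]%G).
Proof.
move=> KLs fgL KL; split; last first.
  move=> m C G m' C' G' chC chC'.
  have serC := benign_chain_series KL fgL chC.
  have serC' := benign_chain_series KL fgL chC'.
  apply: (shift_series_uniq (gal_sigmaM KL) serC serC') => g.
  have [_ C0 _ _] := chC; have [_ C0' _ _] := chC'.
  have i0 n : inord 0 = ord0 :> 'I_n.+1 by apply: val_inj; rewrite /= inordK.
  have CC' x : (x \in C ord0) = (x \in C' ord0).
    by apply/idP/idP; have := congr1 (fun P => P x) (etrans C0 (esym C0')) => /= E H;
       [rewrite -E|rewrite E].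
  rewrite !i0; split=> gC x xC; apply: gC; first by rewrite CC'.
  by rewrite -CC'.
have [L1 [KL1 L1L L1pi con]] := pi0_exists KL fgL.
have [E [chE EL radE]] := connected_chain KL fgL KL1 L1L con.
have [m [C [G [C0 Cm step]]]] := shift_chain_indexed chE.
have CL1 i : (i <= m)%N -> {subset L1 <= C i}.
  elim: i => [_|i IH ltim] x; first by rewrite C0.
  by move=> /(IH (ltnW ltim)); have [sub _ _ _] := step i ltim; exact: sub.
have CE i : (i <= m)%N -> {subset C i <= E}.
  move=> leim; rewrite -Cm -(subnKC leim).
  have : (i + (m - i) <= m)%N by rewrite subnKC.
  elim: (m - i)%N => [|k IH]; first by rewrite addn0 => _ x.
  rewrite addnS => ltim x /(IH (ltnW ltim)); have [sub _ _ _] := step _ ltim; exact: sub.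
exists m, (fun i => C i), (fun i => G i); split.
- move=> i; have leim : (i <= m)%N by rewrite -ltnS.
  split=> x; first by move=> /KL1; exact: CL1.
  by move=> /(CE _ leim)/EL.
- by rewrite /= C0.
- by move=> i /=; exact: step.
- by rewrite /= Cm.
Qed.
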